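(* Let $R=\mathbb{k}[x_1,\dots,x_d]$ be a polynomial ring over a field $\mathbb{k}$ of characteristic zero with $d\leqslant3$, and $\mathfrak m=(x_1,\dots,x_d)$ the homogeneous maximal ideal of $R$. If $L$ is a lex-segment ideal of height $g\geqslant2$ generated in degree $\delta\geqslant2$, then $$\operatorname{core}(L)=L\,\mathfrak m^{d(\delta-2)+g-\delta+1}.$$
   Context: Lex-segment ideal: a monomial ideal $L=\bigoplus_{i\geqslant 0}L_i$ of $R$ such that, for every $i$, $L_i$ is spanned by the $\dim_{\mathbb{k}}L_i$ largest monomials of degree $i$ in the lexicographic order with $x_1>x_2>\cdots>x_d$. ''Generated in degree $\delta$'' means all minimal monomial generators have degree $\delta$. A subideal $J\subseteq L$ is a reduction of $L$ if $L^{m+1}=JL^m$ for $m\gg0$; $\operatorname{core}(L)$ is the intersection of all reductions of $L$. *)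

(* Defs.v *)
From mathcomp Require Import all_boot all_order all_algebra.
From mathcomp Require Import boolp classical_sets.
From mathcomp Require Import mpoly.

Set Implicit Arguments.
Unset Strict Implicit.
Unset Printing Implicit Defensive.

Import Order.TTheory GRing.Theory.
Local Open Scope classical_set_scope.
Local Open Scope ring_scope.

Section Ideals.
Context {R : comNzRingType}.
Implicit Types (I J P L : set R) (n g : nat).

(* Unlike idealr_closed, this does not exclude the unit ideal. *)
Definition is_ideal I : Prop :=
  [/\ I 0, forall x y, I x -> I y -> I (x + y) & forall a x, I x -> I (a * x)].

Definition ideal_gen (S : set R) : set R := smallest is_ideal S.

Definition ideal_mul I J : set R := ideal_gen [set x * y | x in I & y in J].

Definition ideal_exp I n : set R := iter n (ideal_mul I) setT.

Definition is_prime_ideal P : Prop :=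
  [/\ is_ideal P, ~ P 1 & forall x y, P (x * y) -> P x \/ P y].

(* n <= ht P: there is a chain p_0 < p_1 < ... < p_n = P of primes. *)
Definition prime_height_ge P n : Prop :=
  exists p : nat -> set R,
    [/\ forall i, (i <= n)%N -> is_prime_ideal (p i),
        forall i, (i < n)%N -> p i `<` p i.+1
      & p n = P].

(* ht I is the infimum of ht P over the primes P containing I, so
   n <= ht I iff n <= ht P for all of them (the unit ideal has height oo). *)
Definition height_ge I n : Prop :=
  forall P, is_prime_ideal P -> I `<=` P -> prime_height_ge P n.

Definition has_height I g : Prop := height_ge I g /\ ~ height_ge I g.+1.

Definition is_reduction J L : Prop :=
  [/\ is_ideal J, J `<=` L
    & exists N, forall m, (N <= m)%N ->
        ideal_exp L m.+1 = ideal_mul J (ideal_exp L m)].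

Definition core L : set R := \bigcap_(J in [set J | is_reduction J L]) J.

End Ideals.

Section Dimension.
Context {K : fieldType} {V : lmodType K}.

Definition lin_span (s : seq V) : set V :=
  [set v | exists c : nat -> K, v = \sum_(j < size s) c j *: s`_j].

Definition lin_indep (s : seq V) : Prop :=
  forall c : nat -> K, \sum_(j < size s) c j *: s`_j = 0 ->
    forall j, (j < size s)%N -> c j = 0.

Definition has_dim (W : set V) (r : nat) : Prop :=
  exists s : seq V, [/\ size s = r, lin_indep s & W = lin_span s].

End Dimension.

Section LexSegment.
Context {K : fieldType} {d : nat}.
Implicit Types (L : set {mpoly K[d]}) (m : 'X_{1..d}).

Definition is_monomial_ideal L : Prop :=
  exists S : set 'X_{1..d}, L = ideal_gen [set 'X_[K, m] | m in S].

Definition graded_piece L (i : nat) : set {mpoly K[d]} :=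
  [set p | L p /\ p \is i.-homog].

(* The monomials of degree i, largest first. The order <=%O on 'X_{1..d}
   (mnmc_le) compares the sequences (mdeg m, m_0, ..., m_(d-1))
   lexicographically; in a fixed degree it is therefore the lexicographic order
   with x_0 > x_1 > ... > x_(d-1), see ltmcP. *)
Definition lex_monomials (i : nat) : seq 'X_{1..d} :=
  sort (fun m1 m2 => (m2 <= m1)%O)
    [seq m <- [seq bmnm b | b <- enum {: 'X_{1..d < i.+1}}] | mdeg m == i].

Definition is_lex_segment_ideal L : Prop :=
  is_monomial_ideal L /\
  forall i, exists r, has_dim (graded_piece L i) r /\
    graded_piece L i = lin_span [seq 'X_[K, m] | m <- take r (lex_monomials i)].

(* (m' <= m)%MM is divisibility of monomials. *)
Definition is_minimal_generator L m : Prop :=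
  L 'X_[m] /\ forall m', (m' <= m)%MM -> L 'X_[m'] -> m' = m.

Definition generated_in_degree L (delta : nat) : Prop :=
  forall m, is_minimal_generator L m -> mdeg m = delta.

End LexSegment.

Definition hom_max_ideal (K : fieldType) (d : nat) : set {mpoly K[d]} :=
  ideal_gen [set 'X_i | i in [set: 'I_d]].
Arguments hom_max_ideal : clear implicits.

(* Main.v *)
(* Height and generation degree leave two shapes for L: with x, y, z the
   variables, L = (x, y^a) /\ m^delta in three variables, where a = 0 (that is,
   L = m^delta) if g = 3 and 1 <= a <= delta if g = 2; and L = m^delta in two
   variables. In all cases the claim says that core L consists of the elements of
   L of order at least n0, where n0 = 2 delta - 1 for d = 2, n0 = 3 delta - 2 for
   d = g = 3 and n0 = 3 delta - 3 for d = 3, g = 2.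

   Lower bound. Let J be a reduction of L, V its space of forms of degree delta
   (the degree delta parts of elements of J) and I = (x, y^a). Comparing the parts
   of lowest weight (x and y having weight a and 1) in J L^N = L^(N + 1) gives
   z^k I inside J and inside (V). Modulo z, the forms in V have no common factor,
   so two of them, f and g, form a regular sequence with z. Every form of
   degree at least 2 delta - 1 lies in (f, g, z); for a > 0 this persists in degree
   2 delta - 2 if one adds the determinant D of the coefficients of f and g on
   x and y^a, times y^(a - 1), and D I is contained in (f, g). Hence z can be
   cancelled from z^k u in (V) as soon as u in I has degree at least n0.

   Upper bound. The core is stable under the automorphisms that preserve L, among
   them the triangular substitutions x_i |-> e x_i + v_i x_0. These degenerate any
   form to a multiple of a power of x, so it is enough to find one reduction
   of L that does not contain x^(n0 - 1). One is generated by y^delta, by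
   x z^(delta - 1) (or z^delta if a = 0) and by
   x^delta - x^(delta - 1) (y + z) - y^a z^(delta - a). *)
Require Import Defs.
From HB Require Import structures.
From mathcomp Require Import all_boot all_order all_algebra.
From mathcomp Require Import boolp classical_sets.
From mathcomp Require Import mpoly.
From mathcomp Require Import zify ring.

Set Implicit Arguments.
Unset Strict Implicit.
Unset Printing Implicit Defensive.

Import Order.TTheory GRing.Theory.
Local Open Scope classical_set_scope.
Local Open Scope ring_scope.

(** A reduction need not be homogeneous. The lower bound is therefore proved for (V) and then
    transferred: an element of (V) lifts to J up to terms of higher degree, and the corrections end
    because J contains all monomials of I of large degree. Such a monomial has either a large power
    of z, or so large a degree in x and y that it lies in L^(N + 1). The value 3 delta - 2 comes
    from the cancellation of z. Let z u = sum r_i v_i with v_i in V, so that r_i has degree n + 1 -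
    delta. Once this is at least 2 delta - 1, each r_i is some z r_i' modulo (f, g), so z (u - sum
    r_i' v_i) lies in (f, g), where z can be cancelled. One degree lower, r_i has an extra term in
    the one-dimensional socle of K[x, y]/(f, g); for a > 0, its representative built from D is
    multiplied into (f, g) by v_i, which saves one degree. In the upper bound, the degeneration
    occurs at e = 0, where the substitution is not invertible. A linear functional with natural
    weights that kills the chosen reduction remedies this: its value is a polynomial in e that is
    nonzero at 0, hence at some nonzero e. *)

Section IdealTheory.
Context {R : comNzRingType}.
Implicit Types (I J S P : set R).

Lemma is_ideal_gen S : is_ideal (ideal_gen S).
Proof.
split=> [|x y Ix Iy|a x Ix] J hJ; have [[J0 JD JM] _] := hJ => //.
- by apply: JD; [apply: (Ix J hJ) | apply: (Iy J hJ)].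
- by apply: JM; apply: (Ix J hJ).
Qed.

Lemma sub_ideal_gen S : S `<=` ideal_gen S.
Proof. by move=> x Sx J [_]; apply. Qed.

Lemma ideal_gen_min S I : is_ideal I -> S `<=` I -> ideal_gen S `<=` I.
Proof. by move=> idI SI x; apply. Qed.

Lemma ideal_sum I (T : Type) (s : seq T) (P : pred T) (F : T -> R) :
  is_ideal I -> (forall t, P t -> I (F t)) -> I (\sum_(t <- s | P t) F t).
Proof.
move=> [I0 ID _] IF; elim/big_rec: _ => // t x Pt Ix.
by apply: ID => //; apply: IF.
Qed.

Lemma ideal_sum_seq I (T : eqType) (s : seq T) (F : T -> R) :
  is_ideal I -> (forall t, t \in s -> I (F t)) -> I (\sum_(t <- s) F t).
Proof. by move=> idI IF; rewrite big_seq; apply: ideal_sum. Qed.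

Lemma idealN I x : is_ideal I -> I x -> I (- x).
Proof. by move=> [_ _ IM] Ix; rewrite -mulN1r; apply: IM. Qed.

Lemma idealB I x y : is_ideal I -> I x -> I y -> I (x - y).
Proof.
by move=> idI Ix Iy; case: (idI) => _ ID _; apply: ID => //; apply: idealN.
Qed.

Lemma ideal_subr I x y : is_ideal I -> I (x - y) -> I y -> I x.
Proof. by move=> [_ ID _] Ixy Iy; rewrite -(subrK y x); apply: ID. Qed.

Lemma ideal_gen_sum S p : ideal_gen S p ->
  exists s : seq (R * R), (forall t, t \in s -> S t.2) /\
    p = \sum_(t <- s) t.1 * t.2.
Proof.
move: p; apply: (@ideal_gen_min S
  [set p | exists s : seq (R * R), (forall t, t \in s -> S t.2) /\
             p = \sum_(t <- s) t.1 * t.2]) => [|x Sx]; last first.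
  exists [:: (1, x)]; split; last by rewrite big_seq1 mul1r.
  by move=> t; rewrite inE => /eqP ->.
split=> [|x y [s [Ss ->]] [s' [Ss' ->]]|a x [s [Ss ->]]].
- by exists [::]; split=> //; rewrite big_nil.
- exists (s ++ s'); split; last by rewrite big_cat.
  by move=> t; rewrite mem_cat => /orP [/Ss|/Ss'].
- exists [seq (a * t.1, t.2) | t <- s]; split.
    by move=> t /mapP [t' /Ss St' ->].
  by rewrite big_map big_distrr; apply: eq_bigr => t _ /=; rewrite mulrA.
Qed.

Lemma is_ideal_mul I J : is_ideal (ideal_mul I J).
Proof. exact: is_ideal_gen. Qed.

Lemma mem_ideal_mul I J x y : I x -> J y -> ideal_mul I J (x * y).
Proof. by move=> Ix Jy; apply: sub_ideal_gen; exists x => //; exists y. Qed.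

Lemma ideal_mul_sum I J p : is_ideal I -> ideal_mul I J p ->
  exists s : seq (R * R), (forall t, t \in s -> I t.1 /\ J t.2) /\
    p = \sum_(t <- s) t.1 * t.2.
Proof.
move=> [_ _ IM] /ideal_gen_sum [s [Ss ->]].
elim: s Ss => [|t s IHs] Ss; first by exists [::]; rewrite !big_nil.
have [|s' [Ss' eqs]] := IHs.
  by move=> u us; apply: Ss; rewrite inE us orbT.
have [x Ix [y Jy xy]] := Ss t (mem_head _ _).
exists ((t.1 * x, y) :: s'); split; last by rewrite !big_cons eqs -xy /= mulrA.
by move=> u; rewrite inE => /predU1P [->|/Ss' //]; split=> //=; apply: IM.
Qed.

Lemma ideal_mulSl I J : is_ideal I -> ideal_mul I J `<=` I.
Proof.
move=> idI p /(ideal_mul_sum idI) [s [Ss ->]]; apply: ideal_sum_seq => // t.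
by case/Ss => It _; case: idI => _ _ IM; rewrite mulrC; apply: IM.
Qed.

Lemma ideal_mul_mono I I' J J' :
  I `<=` I' -> J `<=` J' -> ideal_mul I J `<=` ideal_mul I' J'.
Proof.
move=> sI sJ; apply: ideal_gen_min; first exact: is_ideal_mul.
by move=> _ [x Ix [y Jy <-]]; apply: mem_ideal_mul; [apply: sI|apply: sJ].
Qed.

Lemma ideal_expS I n : ideal_exp I n.+1 = ideal_mul I (ideal_exp I n).
Proof. by []. Qed.

Lemma prime_expr (P : set R) x n : is_prime_ideal P -> P (x ^+ n) -> P x.
Proof.
move=> [_ P1 PM]; elim: n => [/P1 //|n IHn].
by rewrite exprS => /PM [].
Qed.

End IdealTheory.

(** * Monomial ideals as spans, and homogeneous components *)

Section MonomialSpan.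
Context {K : fieldType} {d : nat}.
Implicit Types (P Q : 'X_{1..d} -> Prop) (m u : 'X_{1..d}) (p q : {mpoly K[d]}).
Implicit Types (I J L : set {mpoly K[d]}).

(** Membership is tested coefficientwise, so that a monomial ideal becomes a predicate on exponents.
    [P] need not be up-closed: degree bounds are expressed in the same way. *)
Definition monspan P : set {mpoly K[d]} := [set p | forall m, p@_m != 0 -> P m].

Definition upclosed P := forall m u, (m <= u)%MM -> P m -> P u.

Lemma upclosedD P m u : upclosed P -> P m -> P (u + m)%MM.
Proof. by move=> upP; apply: upP; apply: lem_addl. Qed.

Lemma monspanX P m : monspan P 'X_[m] <-> P m.
Proof.
split=> [|Pm m']; first by apply; rewrite mcoeffX eqxx oner_eq0.
by rewrite mcoeffX; case: (m =P m') => [<- //|_]; rewrite eqxx.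
Qed.

Lemma monspan_ideal P : upclosed P -> is_ideal (monspan P).
Proof.
move=> upP; split=> [m|p q Pp Pq m|p q Pq m]; first by rewrite mcoeff0 eqxx.
  rewrite mcoeffD; have [->|/Pp //] := eqVneq p@_m 0.
  by rewrite add0r => /Pq.
rewrite -mcoeff_msupp => /msuppM_le /allpairsP [[m1 m2] /= [_ m2q ->]].
by apply: upclosedD => //; apply: Pq; rewrite -mcoeff_msupp.
Qed.

Lemma monspan_min P I : is_ideal I -> (forall m, P m -> I 'X_[m]) ->
  monspan P `<=` I.
Proof.
move=> idI PI p Pp; rewrite (mpolyE p); apply: ideal_sum_seq => // m.
rewrite mcoeff_msupp => /Pp /PI Im; case: idI => _ _ IM.
by rewrite -mul_mpolyC; apply: IM.
Qed.

Lemma monspan_sub P Q : (forall m, P m -> Q m) -> monspan P `<=` monspan Q.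
Proof. by move=> PQ p Pp m /Pp /PQ. Qed.

Lemma eq_monspan P Q : (forall m, P m <-> Q m) -> monspan P = monspan Q.
Proof.
by move=> PQ; rewrite eqEsubset; split; apply: monspan_sub => m /PQ.
Qed.

(** The multiples of the generating monomials span an ideal that contains the generators; hence
    every monomial of an element of [L] is divisible by one of them. *)
Lemma monomial_ideal_monspan L : is_monomial_ideal L ->
  L = monspan (fun m => L 'X_[m]).
Proof.
move=> [S LS]; have idL : is_ideal L by rewrite LS; apply: is_ideal_gen.
rewrite eqEsubset; split; last exact: monspan_min.
suff: L `<=` monspan (fun m => exists2 u, S u & (u <= m)%MM).
  move=> sub p Lp m /(sub _ Lp) [u Su le_um].
  rewrite -(submK le_um) mpolyXD; case: (idL) => _ _; apply.
  by rewrite LS; apply: sub_ideal_gen; exists u.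
rewrite {1}LS; apply: ideal_gen_min => [|_ [u Su <-]].
  apply: monspan_ideal => m u le_mu [v Sv le_vm].
  by exists v => //; apply: lepm_trans le_vm le_mu.
by apply/monspanX; exists u => //; apply: lepm_refl.
Qed.

Lemma mem_ideal_divX I m u : is_ideal I -> (m <= u)%MM -> I 'X_[m] -> I 'X_[u].
Proof.
by move=> [_ _ IM] le_mu Im; rewrite -(submK le_mu) mpolyXD; apply: IM.
Qed.

Lemma dhomog_coeff p n m : p \is n.-homog -> p@_m != 0 -> mdeg m = n.
Proof. by move=> /dhomogP hp; rewrite -mcoeff_msupp => /hp. Qed.

Lemma dhomogIP p n : (forall m, p@_m != 0 -> mdeg m = n) -> p \is n.-homog.
Proof. by move=> hp; apply/dhomogP => m; rewrite mcoeff_msupp; apply: hp. Qed.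

Lemma mcoeff_pihomog n p m :
  (pihomog mdeg n p)@_m = if mdeg m == n then p@_m else 0.
Proof.
transitivity (if mdeg m == n then
    (\sum_(u <- msupp p) p@_u *: 'X_[u] : {mpoly K[d]})@_m else 0); last first.
  by rewrite -mpolyE.
rewrite pihomogE !raddf_sum /= big_mkcond /=.
have [mn|mn] := ifP.
  apply: eq_bigr => u _; rewrite mcoeffZ mcoeffX.
  have [->|] := eqVneq u m; first by rewrite mn.
  by rewrite mulr0 if_same.
rewrite big1 // => u _; rewrite mcoeffZ mcoeffX.
have [->|] := eqVneq u m; first by rewrite mn.
by rewrite mulr0 if_same.
Qed.

Lemma pihomog_monspan P n p : monspan P p -> monspan P (pihomog mdeg n p).
Proof.
by move=> Pp m; rewrite mcoeff_pihomog; case: ifP => _; [apply: Pp|rewrite eqxx].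
Qed.

Lemma pihomogMl e p q n : p \is e.-homog -> (e <= n)%N ->
  pihomog mdeg n (q * p) = pihomog mdeg (n - e) q * p.
Proof.
move=> hp le_en; rewrite {1}(mpolyE q) [in RHS](mpolyE q).
rewrite mulr_suml raddf_sum [pihomog _ (n - e) _]raddf_sum mulr_suml /=.
apply: eq_bigr => m _; rewrite -scalerAl linearZ /= linearZ /= -scalerAl.
congr (_ *: _); rewrite pihomogX.
have hmp : 'X_[m] * p \is (mdeg m + e).-homog.
  by apply: dhomogM => //; rewrite dhomogX.
case: eqP => [mn|mn]; first by rewrite pihomog_dE // -(subnK le_en) -mn.
rewrite mul0r (pihomog_ne0 _ hmp) //; apply: contra_notN mn => /eqP mn.
by rewrite -mn addnK.
Qed.

Lemma pihomogMl_lt e p q n : p \is e.-homog -> (n < e)%N ->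
  pihomog mdeg n (q * p) = 0.
Proof.
move=> hp lt_ne; rewrite (mpolyE q) mulr_suml raddf_sum big1 //= => m _.
rewrite -scalerAl linearZ /= (@pihomog_ne0 _ _ _ (mdeg m + e)) ?scaler0 //.
  by apply/eqP; lia.
by apply: dhomogM => //; rewrite dhomogX.
Qed.

Lemma monspan_mdeg_mul p q a b : monspan (fun m => a <= mdeg m)%N p ->
  monspan (fun m => b <= mdeg m)%N q -> monspan (fun m => a + b <= mdeg m)%N (p * q).
Proof.
move=> hp hq m; rewrite -mcoeff_msupp => /msuppM_le /allpairsP [[m1 m2] /=].
rewrite !mcoeff_msupp => -[/hp h1 /hq h2 ->]; rewrite mdegD; lia.
Qed.

(** Replacing a factor by what remains above its lowest degree pushes the product above degree
    [a + b]. *)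
Lemma pihomogM_low p q a b : monspan (fun m => a <= mdeg m)%N p ->
  monspan (fun m => b <= mdeg m)%N q ->
  pihomog mdeg (a + b) (p * q) = pihomog mdeg a p * pihomog mdeg b q.
Proof.
move=> hp hq; set p0 := pihomog mdeg a p; set q0 := pihomog mdeg b q.
have high c (r : {mpoly K[d]}) : monspan (fun m => c <= mdeg m)%N r ->
    monspan (fun m => c.+1 <= mdeg m)%N (r - pihomog mdeg c r).
  move=> hr m; rewrite mcoeffB mcoeff_pihomog; case: (mdeg m =P c) => [_|mc].
    by rewrite subrr eqxx.
  by rewrite subr0 => /hr; rewrite leq_eqVlt eq_sym => /orP [/eqP|].
have vanish c (r : {mpoly K[d]}) :
    monspan (fun m => c.+1 <= mdeg m)%N r -> pihomog mdeg c r = 0.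
  move=> hr; apply/mpolyP => m; rewrite mcoeff_pihomog mcoeff0.
  case: eqP => // mc; apply/eqP; apply/negPn/negP => /hr; lia.
have -> : p * q = (p - p0) * q + p0 * (q - q0) + p0 * q0 by ring.
have v1 : pihomog mdeg (a + b) ((p - p0) * q) = 0.
  apply: vanish; have -> : (a + b).+1 = (a.+1 + b)%N by lia.
  by apply: monspan_mdeg_mul hq; apply: high.
have v2 : pihomog mdeg (a + b) (p0 * (q - q0)) = 0.
  apply: vanish; have -> : (a + b).+1 = (a + b.+1)%N by lia.
  by apply: monspan_mdeg_mul (high _ _ hq); apply: pihomog_monspan.
rewrite !raddfD /= v1 v2 !add0r pihomog_dE //.
by apply: dhomogM; apply: pihomogP.
Qed.

End MonomialSpan.

(** * Powers of monomial ideals generated in one degree *)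

Section PowersOfMonomialIdeals.
Context {K : fieldType} {d : nat}.
Implicit Types (P Q U : 'X_{1..d} -> Prop) (m u : 'X_{1..d}) (p q : {mpoly K[d]}).

Lemma ideal_mul_monspan P Q U : upclosed P -> upclosed Q -> upclosed U ->
    (forall m u, P m -> Q u -> U (m + u)%MM) ->
    (forall m, U m -> exists u, [/\ (u <= m)%MM, P u & Q (m - u)%MM]) ->
  ideal_mul (@monspan K d P) (monspan Q) = monspan U.
Proof.
move=> uP uQ uU PQU UPQ; rewrite eqEsubset; split.
  apply: ideal_gen_min; first exact: monspan_ideal.
  move=> _ [p Pp [q Qq <-]] m; rewrite -mcoeff_msupp => /msuppM_le.
  move=> /allpairsP [[m1 m2] /= []]; rewrite !mcoeff_msupp => /Pp P1 /Qq Q2 ->.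
  exact: PQU.
apply: monspan_min => [|m /UPQ [u [le_um Pu Qmu]]]; first exact: is_ideal_mul.
rewrite -(submK le_um) addmC mpolyXD.
by apply: mem_ideal_mul; apply/monspanX.
Qed.

Lemma mnm_neq0 m : m != 0%MM -> exists i, m i != 0%N.
Proof.
move=> m0; apply: contra_neqP m0 => ex; apply/mnmP => i; rewrite mnm0E.
by apply/eqP/negPn/negP => ne; apply: ex; exists i.
Qed.

Lemma submonomial_mdeg m k : (k <= mdeg m)%N ->
  exists u, (u <= m)%MM /\ mdeg u = k.
Proof.
elim: k => [|k IHk] le_km.
  by exists 0%MM; rewrite mdeg0; split=> //; apply/mnm_lepP => i; rewrite mnm0E.
have [u [le_um du]] := IHk (ltnW le_km).
have: (mdeg (m - u)%MM != 0)%N.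
  by move: (congr1 mdeg (submK le_um)); rewrite mdegD; lia.
rewrite mdeg_eq0 => /mnm_neq0 [i mui].
exists (u + U_(i))%MM; rewrite mdegD mdeg1 du addn1; split=> //.
apply/mnm_lepP => j; rewrite mnmDE mnm1E; have := mnm_lepP le_um j.
by move: mui; rewrite mnmBE; have [->|_] := eqVneq i j; lia.
Qed.

(* T M plays the role of the set of monomials in the M-th power of an ideal
   generated in degree delta. *)
Record power_system (delta : nat) (T : nat -> 'X_{1..d} -> Prop) : Prop :=
  PowerSystem {
    psys_up : forall M, upclosed (T M);
    psys0 : forall m, T 0 m;
    psysD : forall M N m u, T M m -> T N u -> T (M + N) (m + u)%MM;
    psys_split : forall M m, T M.+1 m -> exists u,
      [/\ (u <= m)%MM, mdeg u = delta, T 1 u & T M (m - u)%MM];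
    psys_mdeg : forall M m, T M m -> (M * delta <= mdeg m)%N }.

Section Powers.
Context {delta : nat} {T : nat -> 'X_{1..d} -> Prop}.
Context (psT : power_system delta T).

Lemma ideal_exp_monspan M : ideal_exp (@monspan K d (T 1)) M = monspan (T M).
Proof.
elim: M => [|M IHM].
  by rewrite eqEsubset; split=> // p _ m _; apply: (psys0 psT).
rewrite ideal_expS IHM; apply: ideal_mul_monspan; try exact: (psys_up psT).
  by move=> m u; apply: (psysD psT).
by move=> m /(psys_split psT) [u [le_um _ Tu Tmu]]; exists u.
Qed.

Lemma psys_min_degree M m : T M m ->
  exists u, [/\ (u <= m)%MM, mdeg u = (M * delta)%N & T M u].
Proof.
elim: M m => [|M IHM] m TM.
  exists 0%MM; rewrite mdeg0; split=> //; last exact: (psys0 psT).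
  by apply/mnm_lepP => i; rewrite mnm0E.
have [u [le_um du Tu /IHM [v [le_v dv Tv]]]] := psys_split psT TM.
exists (u + v)%MM; rewrite mdegD du dv; split=> //.
  by apply/mnm_lepP => i; move/mnm_lepP: le_v => /(_ i);
    move/mnm_lepP: le_um => /(_ i); rewrite mnmDE mnmBE; lia.
exact: (psysD psT Tu Tv).
Qed.

End Powers.

Lemma mdeg_power_system : power_system 1 (fun M m => M <= mdeg m)%N.
Proof.
split=> [M m u le_mu|//|M N m u|M m le_Mm|M m]; last by rewrite muln1.
- by move/(leq_trans)->; rewrite // -(submK le_mu) mdegD leq_addl.
- by rewrite mdegD => *; apply: leq_add.
have [u [le_um du]] := @submonomial_mdeg m 1 (leq_trans (ltn0Sn M) le_Mm).
exists u; rewrite du; split=> //.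
by move: (congr1 mdeg (submK le_um)) le_Mm; rewrite mdegD du; lia.
Qed.

Lemma upclosed_mdeg k : upclosed (fun m : 'X_{1..d} => k <= mdeg m)%N.
Proof. exact: (psys_up mdeg_power_system). Qed.

Lemma hom_max_ideal_monspan :
  hom_max_ideal K d = monspan (fun m => 1 <= mdeg m)%N.
Proof.
rewrite eqEsubset; split.
  apply: ideal_gen_min => [|_ [i _ <-]]; last by apply/monspanX; rewrite mdeg1.
  exact/monspan_ideal/upclosed_mdeg.
apply: monspan_min => [|m m1]; first exact: is_ideal_gen.
have [u [le_um /eqP]] := submonomial_mdeg m1; rewrite mdeg_eq1.
move=> /existsP [i /eqP eu]; apply: (mem_ideal_divX (is_ideal_gen _) le_um).
by rewrite eu; apply: sub_ideal_gen; exists i.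
Qed.

Lemma hom_max_ideal_exp n :
  ideal_exp (hom_max_ideal K d) n = monspan (fun m => n <= mdeg m)%N.
Proof.
by rewrite hom_max_ideal_monspan (ideal_exp_monspan mdeg_power_system).
Qed.

(** A monomial of the ideal of degree at least [delta + n] splits off a generator of degree [delta]
    and leaves a cofactor of degree at least [n]. Thus the right side of the theorem is cut out of L
    by a degree bound alone. *)
Lemma ideal_mul_hom_max_ideal delta T n : power_system delta T ->
  ideal_mul (monspan (T 1)) (ideal_exp (hom_max_ideal K d) n) =
  monspan (fun m => T 1 m /\ (delta + n <= mdeg m)%N).
Proof.
move=> psT; rewrite hom_max_ideal_exp; apply: ideal_mul_monspan.
- exact: (psys_up psT).
- exact: upclosed_mdeg.
- move=> m u le_mu [Tm dm]; split; first exact: (psys_up psT) Tm.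
  exact: upclosed_mdeg dm.
- move=> m u Tm nu; split.
    exact: (psysD psT Tm (psys0 psT u)).
  by rewrite mdegD; apply: leq_add => //; have := psys_mdeg psT Tm; rewrite mul1n.
move=> m [Tm dm]; have [u [le_um du Tu _]] := psys_split psT Tm.
exists u; split=> //.
by move: (congr1 mdeg (submK le_um)) dm; rewrite mdegD du; lia.
Qed.

End PowersOfMonomialIdeals.

(** * Monomials in two and three variables; the powers of L *)

Definition ix0 {n} : 'I_n.+2 := @Ordinal n.+2 0 isT.
Definition ix1 {n} : 'I_n.+2 := @Ordinal n.+2 1 isT.
Definition ix2 : 'I_3 := @Ordinal 3 2 isT.

Definition mon2 i j : 'X_{1..2} := [multinom nth 0%N [:: i; j] t | t < 2].
Definition mon3 i j k : 'X_{1..3} := [multinom nth 0%N [:: i; j; k] t | t < 3].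

Lemma mon2E i j : (mon2 i j ix0 = i) * (mon2 i j ix1 = j).
Proof. by rewrite !mnmE. Qed.

Lemma mon3E i j k :
  (mon3 i j k ix0 = i) * (mon3 i j k ix1 = j) * (mon3 i j k ix2 = k).
Proof. by rewrite !mnmE. Qed.

Lemma forall_ord2 (P : 'I_2 -> Prop) : P ix0 -> P ix1 -> forall t, P t.
Proof.
move=> P0 P1 [[|[|//]] lt_t2].
- by rewrite (_ : Ordinal _ = ix0) //; apply: val_inj.
- by rewrite (_ : Ordinal _ = ix1) //; apply: val_inj.
Qed.

Lemma forall_ord3 (P : 'I_3 -> Prop) : P ix0 -> P ix1 -> P ix2 -> forall t, P t.
Proof.
move=> P0 P1 P2 [[|[|[|//]]] lt_t3].
- by rewrite (_ : Ordinal _ = ix0) //; apply: val_inj.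
- by rewrite (_ : Ordinal _ = ix1) //; apply: val_inj.
- by rewrite (_ : Ordinal _ = ix2) //; apply: val_inj.
Qed.

Lemma mnm2_eq (m : 'X_{1..2}) : m = mon2 (m ix0) (m ix1).
Proof. by apply/mnmP; apply: forall_ord2; rewrite mon2E. Qed.

Lemma mnm3_eq (m : 'X_{1..3}) : m = mon3 (m ix0) (m ix1) (m ix2).
Proof. by apply/mnmP; apply: forall_ord3; rewrite mon3E. Qed.

Lemma mnm2_ind (P : 'X_{1..2} -> Prop) : (forall i j, P (mon2 i j)) -> forall m, P m.
Proof. by move=> Pij m; rewrite (mnm2_eq m). Qed.

Lemma mnm3_ind (P : 'X_{1..3} -> Prop) :
  (forall i j k, P (mon3 i j k)) -> forall m, P m.
Proof. by move=> Pijk m; rewrite (mnm3_eq m). Qed.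

Lemma mdeg_mon2 i j : mdeg (mon2 i j) = (i + j)%N.
Proof. by rewrite mdegE !big_ord_recl big_ord0 !mnmE addn0. Qed.

Lemma mdeg_mon3 i j k : mdeg (mon3 i j k) = (i + j + k)%N.
Proof. by rewrite mdegE !big_ord_recl big_ord0 !mnmE addn0 addnA. Qed.

Lemma mon2D i j i' j' : (mon2 i j + mon2 i' j')%MM = mon2 (i + i') (j + j').
Proof. by apply/mnmP; apply: forall_ord2; rewrite mnmDE !mon2E. Qed.

Lemma mon3D i j k i' j' k' :
  (mon3 i j k + mon3 i' j' k')%MM = mon3 (i + i') (j + j') (k + k').
Proof. by apply/mnmP; apply: forall_ord3; rewrite mnmDE !mon3E. Qed.

Lemma mon3B i j k i' j' k' :
  (mon3 i j k - mon3 i' j' k')%MM = mon3 (i - i') (j - j') (k - k').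
Proof. by apply/mnmP; apply: forall_ord3; rewrite mnmBE !mon3E. Qed.

Lemma le_mon3 i j k i' j' k' :
  (mon3 i j k <= mon3 i' j' k')%MM = [&& i <= i', j <= j' & k <= k']%N.
Proof.
apply/mnm_lepP/and3P => [le|[le1 le2 le3]].
  by have := le ix0; have := le ix1; have := le ix2; rewrite !mon3E.
by apply: forall_ord3; rewrite !mon3E.
Qed.

Lemma mon3_inj i j k i' j' k' :
  mon3 i j k = mon3 i' j' k' -> [/\ i = i', j = j' & k = k'].
Proof.
move=> e; move: (congr1 (fun m : 'X_{1..3} => (m ix0, m ix1, m ix2)) e).
by rewrite !mon3E => -[].
Qed.

Lemma eq_mon3 i j k i' j' k' :
  (mon3 i j k == mon3 i' j' k') = [&& i == i', j == j' & k == k'].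
Proof.
by apply/eqP/and3P => [/mon3_inj [-> -> ->]|[/eqP -> /eqP -> /eqP ->]].
Qed.

(* The monomials of the M-th power of (x, y^a)_{>= delta}: such a monomial
   x^i y^j w is a multiple of a product of M factors x or y^a iff
   i + j / a >= M. *)
Definition lexpow {n} (a delta M : nat) (m : 'X_{1..n.+2}) : Prop :=
  (M * delta <= mdeg m)%N /\ (a * M <= a * m ix0 + m ix1)%N.

Lemma lexpow_power_system0 n delta :
  power_system delta (@lexpow n 0 delta).
Proof.
split=> [M m u le_mu [dm _]|m|M N m u [dm _] [du _]|M m [dm _]|M m [] //].
- by split=> //; apply: upclosed_mdeg dm.
- by split.
- by split=> //; rewrite mulnDl mdegD leq_add.
have [u [le_um du]] := @submonomial_mdeg _ m delta (leq_trans (leq_addr _ _) dm).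
exists u; split=> //; split; rewrite // ?mul1n ?du //.
by move: (congr1 mdeg (submK le_um)) dm; rewrite mdegD du mulSn; lia.
Qed.

(** The generator to be split off takes as much z as it can. Either it is x z^(delta - 1) or y^a
    z^(delta - a), of the least possible weight a, or it absorbs all of z; then only x and y remain,
    and the degree bound implies the weight bound because [a <= delta] ([slack]). *)
Lemma lexpow_power_system a delta : (a <= delta)%N ->
  power_system delta (@lexpow 1 a delta).
Proof.
case: (posnP a) => [->|a_gt0] le_ad; first exact: lexpow_power_system0.
split=> [M m u le_mu [dm am]|m|M N m u [dm am] [du au]||M m [] //].
- split; first exact: upclosed_mdeg dm.
  move/mnm_lepP: le_mu => le; apply: leq_trans am _.
  by apply: leq_add; rewrite ?leq_mul2l ?le ?orbT.
- by split; rewrite ?muln0.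
- split; first by rewrite mulnDl mdegD leq_add.
  by rewrite mulnDr !mnmDE mulnDr addnACA leq_add.
move=> M; apply: mnm3_ind => i j k []; rewrite mdeg_mon3 !mon3E => dm am.
have good i' j' k' : (i' + j' + k' = delta)%N -> (i' <= i)%N -> (j' <= j)%N ->
    (k' <= k)%N -> (0 < i')%N \/ (a <= j')%N ->
    (a * M <= a * (i - i') + (j - j'))%N ->
  exists u, [/\ (u <= mon3 i j k)%MM, mdeg u = delta, lexpow a delta 1 u
    & lexpow a delta M (mon3 i j k - u)%MM].
  move=> e le1 le2 le3 hij hM; exists (mon3 i' j' k').
  rewrite le_mon3 le1 le2 le3 mdeg_mon3 mon3B /lexpow !mdeg_mon3 !mon3E.
  split=> //; split; try by lia.
  by case: hij => h; nia.
have slack s t : (M * delta <= s + t)%N -> (a * M <= a * s + t)%N by nia.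
have [i0|i_gt0] := posnP i.
  have [lt_k|le_k] := ltnP k (delta - a).
    by apply: (good 0%N (delta - k)%N k); rewrite ?i0 //; try lia; apply: slack; lia.
  by apply: (good 0%N a (delta - a)%N); rewrite ?i0 //; try lia; nia.
have [lt_k|le_k] := ltnP k (delta - 1); last first.
  by apply: (good 1%N 0%N (delta - 1)%N) => //; try lia; nia.
have [lt_j|le_j] := ltnP j (delta - k).
  apply: (good (delta - k - j)%N j k) => //; try lia.
  by apply: slack; lia.
by apply: (good 1%N (delta - k - 1)%N k) => //; try lia; apply: slack; lia.
Qed.

(** * Nonvanishing of polynomials in characteristic zero *)

Section Nonvanishing.
Context {K : fieldType}.
Context (charK : [pchar K] =i pred0).

Lemma natr_neq0 n : (0 < n)%N -> n%:R != 0 :> K.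
Proof. by move/pcharf0P: charK => ->; rewrite -lt0n. Qed.

Lemma natr_inj_char0 : injective (fun i : nat => i%:R : K).
Proof.
suff le i j : (i <= j)%N -> i%:R = j%:R :> K -> i = j.
  by move=> i j e; case: (leqP i j) => [/le|/ltnW /le]; [apply|move->].
move=> le_ij /eqP; rewrite eq_sym -subr_eq0 -natrB // => e.
apply/eqP; rewrite eqn_leq le_ij -subn_eq0 /=.
by apply: contraTT e; rewrite -lt0n; apply: natr_neq0.
Qed.

Lemma poly_nonroot (p : {poly K}) : p != 0 -> exists c, p.[c] != 0.
Proof.
move=> p0; pose s := [seq i%:R : K | i <- iota 0 (size p)].
have us : uniq s.
  by rewrite map_inj_uniq ?iota_uniq //; apply: natr_inj_char0.
have [/allP nr|/allPn [c _ nr]] := boolP (all (root p) s); last by exists c.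
have := max_poly_roots p0 (introT allP nr) us.
by rewrite size_map size_iota ltnn.
Qed.

Lemma digits_inj n B (f g : 'I_n -> nat) :
  (forall i, f i < B)%N -> (forall i, g i < B)%N ->
  (\sum_i f i * B ^ i = \sum_i g i * B ^ i)%N -> f =1 g.
Proof.
elim: n f g => [|n IHn] f g fB gB e i; first by case: i.
have B0 : (0 < B)%N by apply: leq_ltn_trans (fB i).
have shift (h : 'I_n.+1 -> nat) : (\sum_i h i * B ^ i =
    (\sum_i h (lift ord0 i) * B ^ i) * B + h ord0)%N.
  rewrite big_ord_recl expn0 muln1 addnC big_distrl; congr (_ + _)%N.
  by apply: eq_bigr => j _; rewrite lift0 expnSr mulnA.
move: e; rewrite !shift => e.
have e0 : f ord0 = g ord0.
  by move: (congr1 (modn^~ B) e); rewrite /= !modnMDl !modn_small.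
have e1 := congr1 (divn^~ B) e; rewrite /= !divnMDl // !divn_small // !addn0 in e1.
case: (unliftP ord0 i) => [j ->|-> //].
exact: (IHn (fun j => f (lift ord0 j)) (fun j => g (lift ord0 j))).
Qed.

(** Kronecker substitution: X_i is sent to c^(B^i), with [B] above all exponents, so that distinct
    monomials of [q] become distinct powers of c and the univariate case applies. *)
Lemma mpoly_nonroot n (q : {mpoly K[n]}) : q != 0 -> exists v, q.@[v] != 0.
Proof.
move=> q0; pose B := msize q; pose e m := (\sum_(i < n) m i * B ^ i)%N.
pose Q := \sum_(m <- msupp q) q@_m *: 'X^(e m) : {poly K}.
have small m : m \in msupp q -> forall i, (m i < B)%N.
  move=> mq i; apply: leq_ltn_trans (msize_mdeg_lt mq).
  by rewrite mdegE (bigD1 i) //= leq_addr.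
have Q0 : Q != 0.
  have mq := mlead_supp q0; set m := mlead q in mq.
  have: Q`_(e m) = q@_m.
    rewrite /Q (bigD1_seq m) ?msupp_uniq //= coefD coefZ coefXn eqxx mulr1.
    rewrite coef_sum big_seq_cond big1 ?addr0 // => u /andP [uq neq].
    rewrite coefZ coefXn; case: eqP => [eq|]; last by rewrite mulr0.
    case/eqP: neq; apply/mnmP; apply: (digits_inj (B := B)); last exact: esym eq.
      exact: small.
    exact: small.
  move=> eQ; apply: contraTneq mq => Q0.
  by rewrite mcoeff_msupp -eQ Q0 coef0 eqxx.
have [c Qc] := poly_nonroot Q0; exists (fun i => c ^+ (B ^ i)).
suff <- : Q.[c] = q.@[fun i => c ^+ (B ^ i)] by [].
rewrite mevalE horner_sum; apply: eq_bigr => m _.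
rewrite hornerZ hornerXn -prodrXr; congr (_ * _).
by apply: eq_bigr => i _; rewrite -exprM mulnC.
Qed.

End Nonvanishing.

Lemma rmorph_mpoly_eq (R : comNzRingType) (S : comNzRingType) n
    (f g : {rmorphism {mpoly R[n]} -> S}) :
  (forall c, f c%:MP = g c%:MP) -> (forall i, f 'X_i = g 'X_i) -> f =1 g.
Proof.
move=> fgC fgX p; rewrite (mpolyE p) !rmorph_sum; apply: eq_bigr => m _ /=.
rewrite -mul_mpolyC !rmorphM fgC mpolyXE_id !rmorph_prod; congr (_ * _).
by apply: eq_bigr => i _; rewrite !rmorphXn fgX.
Qed.

(** * Weighted sums of coefficients and triangular substitutions *)

Section WeightedSum.
Context {n : nat}.
Context (N : 'X_{1..n} -> nat).

Definition wsum {R : comNzRingType} (p : {mpoly R[n]}) : R :=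
  \sum_(m <- msupp p) p@_m *+ N m.

Lemma wsum_sub (R : comNzRingType) (p : {mpoly R[n]}) (s : seq 'X_{1..n}) :
  uniq s -> {subset msupp p <= s} -> wsum p = \sum_(m <- s) p@_m *+ N m.
Proof.
move=> us sub; rewrite (bigID (mem (msupp p))) /= [X in _ + X]big1 ?addr0.
  rewrite -big_filter; apply: perm_big; apply: uniq_perm; rewrite ?msupp_uniq //.
    exact: filter_uniq.
  by move=> m; rewrite mem_filter; case: (boolP (m \in _)) => // /sub.
by move=> m /memN_msupp_eq0 ->; rewrite mul0rn.
Qed.

Lemma wsumD (R : comNzRingType) (p q : {mpoly R[n]}) :
  wsum (p + q) = wsum p + wsum q.
Proof.
pose s := undup (msupp p ++ msupp q).
have us : uniq s := undup_uniq _.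
rewrite !(@wsum_sub _ _ s) //.
- by rewrite -big_split; apply: eq_bigr => m _; rewrite mcoeffD mulrnDl.
- by move=> m mq; rewrite mem_undup mem_cat mq orbT.
- by move=> m mp; rewrite mem_undup mem_cat mp.
- by move=> m /msuppD_le; rewrite mem_undup.
Qed.

Lemma wsumZ (R : comNzRingType) c (p : {mpoly R[n]}) : wsum (c *: p) = c * wsum p.
Proof.
rewrite (@wsum_sub _ _ (msupp p)) ?msupp_uniq //; last exact: msuppZ_le.
by rewrite big_distrr; apply: eq_bigr => m _ /=; rewrite mcoeffZ mulrnAr.
Qed.

Lemma wsum0 (R : comNzRingType) : wsum (0 : {mpoly R[n]}) = 0.
Proof. by rewrite -(scale0r 0) wsumZ mul0r. Qed.

Lemma wsum_sum (R : comNzRingType) T (s : seq T) P (F : T -> {mpoly R[n]}) :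
  wsum (\sum_(t <- s | P t) F t) = \sum_(t <- s | P t) wsum (F t).
Proof. by apply: big_morph; [apply: wsumD | apply: wsum0]. Qed.

Lemma wsumX (R : comNzRingType) m : wsum ('X_[m] : {mpoly R[n]}) = (N m)%:R.
Proof. by rewrite /wsum msuppX big_seq1 mcoeffX eqxx. Qed.

Lemma wsum_map (R S : comNzRingType) (f : {rmorphism R -> S}) (p : {mpoly R[n]}) :
  wsum (map_mpoly f p) = f (wsum p).
Proof.
rewrite (@wsum_sub _ _ (msupp p)) ?msupp_uniq //; last first.
  move=> m; rewrite !mcoeff_msupp mcoeff_map_mpoly.
  by apply: contra => /eqP ->; rewrite raddf0.
rewrite raddf_sum; apply: eq_bigr => m _.
by rewrite mcoeff_map_mpoly raddfMn.
Qed.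

Lemma wsum_mull_eq0 (R : comNzRingType) (p : {mpoly R[n]}) :
  (forall m, wsum ('X_[m] * p) = 0) -> forall q, wsum (q * p) = 0.
Proof.
move=> p0 q; rewrite (mpolyE q) mulr_suml wsum_sum big1 // => m _.
by rewrite -scalerAl wsumZ p0 mulr0.
Qed.

End WeightedSum.

Section Substitution.
Context {n : nat}.

(** The case [e = 0] is allowed: every variable is then sent to a multiple of x_0. *)
Definition triang {R : comNzRingType} (v : 'I_n.+1 -> R) (e : R) :
    n.+1.-tuple {mpoly R[n.+1]} :=
  [tuple (if i == ord0 then 0 else e) *: 'X_i + v i *: 'X_ord0 | i < n.+1].

Lemma triangX (R : comNzRingType) (v : 'I_n.+1 -> R) e i : 'X_i \mPo triang v e =
  (if i == ord0 then 0 else e) *: 'X_i + v i *: 'X_ord0.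
Proof. by rewrite comp_mpolyXU -tnth_nth tnth_mktuple. Qed.

Lemma dhomog_prod_ord (K : fieldType) k (F : 'I_k -> {mpoly K[n.+1]}) (D : 'I_k -> nat) :
  (forall i, F i \is (D i).-homog) -> \prod_i F i \is (\sum_i D i)%N.-homog.
Proof.
move=> FD; elim/big_rec2: _ => [|i e p _ hp]; first exact: dhomog1.
by apply: dhomogM.
Qed.

Context {K : fieldType}.
Implicit Types (p q : {mpoly K[n.+1]}) (v : 'I_n.+1 -> K) (e : K).

Lemma triangK v e : v ord0 != 0 -> e != 0 ->
  exists v' e', [/\ v' ord0 != 0, e' != 0,
    cancel (comp_mpoly (triang v e)) (comp_mpoly (triang v' e')) &
    cancel (comp_mpoly (triang v' e')) (comp_mpoly (triang v e))].
Proof.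
move=> v0 e0; pose v' i := if i == ord0 then (v ord0)^-1
  else - e^-1 * v i * (v ord0)^-1.
exists v', e^-1; rewrite /v' eqxx !invr_eq0; split=> //.
- move=> p; apply: (rmorph_mpoly_eq (f := comp_mpoly (triang v' e^-1) \o
    comp_mpoly (triang v e)) (g := idfun)) => /= [c|i].
    by rewrite !comp_mpolyC.
  rewrite triangX comp_mpolyD !comp_mpolyZ !triangX /v' eqxx.
  have [->|_] := eqVneq i ord0.
    by rewrite !scale0r !add0r scalerA mulfV // scale1r.
  rewrite scale0r add0r scalerDr !scalerA mulfV // scale1r -addrA -scalerDl.
  by rewrite !mulrA mulrN mulfV // mulN1r mulNr addNr scale0r addr0.
- move=> p; apply: (rmorph_mpoly_eq (f := comp_mpoly (triang v e) \o
    comp_mpoly (triang v' e^-1)) (g := idfun)) => /= [c|i].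
    by rewrite !comp_mpolyC.
  rewrite triangX comp_mpolyD !comp_mpolyZ !triangX /v' eqxx.
  have [->|_] := eqVneq i ord0.
    by rewrite !scale0r !add0r scalerA mulVf // scale1r.
  rewrite scale0r add0r scalerDr !scalerA mulVf // scale1r -addrA -scalerDl.
  by rewrite mulfVK // mulNr addrN scale0r addr0.
Qed.

Lemma triang_homog v e p k : p \is k.-homog -> p \mPo triang v e \is k.-homog.
Proof.
move=> hp; rewrite [p in p \mPo _]mpolyE raddf_sum big_seq /=.
apply: rpred_sum => m; rewrite mcoeff_msupp => /(dhomog_coeff hp) <-.
rewrite linearZ /= comp_mpolyX mdegE.
apply: rpredZ; apply: dhomog_prod_ord => i; rewrite tnth_mktuple.
suff h : (if i == ord0 then 0 else e) *: 'X_i + v i *: 'X_ord0 \is 1.-homog.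
  by have := dhomogMn (m i) h; rewrite mul1n.
by apply: rpredD; apply: rpredZ; rewrite dhomogX /= mdeg1.
Qed.

Lemma pihomog_triang v e p k :
  pihomog mdeg k (p \mPo triang v e) = pihomog mdeg k p \mPo triang v e.
Proof.
set w := maxn (msize p) k.+1.
have E := @pihomog_partitionE _ _ mdeg w p (leq_maxl _ _).
have lt_kw : (k < w)%N by rewrite leq_max ltnSn orbT.
transitivity (\sum_(i < w) pihomog mdeg k (pihomog mdeg i p \mPo triang v e)).
  rewrite {1}E (raddf_sum (comp_mpoly (triang v e))).
  by rewrite (raddf_sum (pihomog mdeg k)).
rewrite (bigD1 (Ordinal lt_kw)) //= big1 ?addr0 => [|i ne].
  by apply: pihomog_dE; apply/triang_homog/pihomogP.
apply: (@pihomog_ne0 _ _ _ i) => //.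
exact/triang_homog/pihomogP.
Qed.

Lemma triang0 v p k : p \is k.-homog ->
  p \mPo triang v 0 = p.@[v] *: 'X_ord0 ^+ k.
Proof.
move=> hp; rewrite mevalE comp_mpolyEX scaler_suml big_seq [RHS]big_seq.
apply: eq_bigr => m; rewrite mcoeff_msupp => /(dhomog_coeff hp) <-.
rewrite comp_mpolyX -scalerA; congr (_ *: _).
rewrite mdegE -prodrXr -scaler_prod; apply: eq_bigr => i _.
by rewrite tnth_mktuple if_same scale0r add0r exprZn.
Qed.

End Substitution.

Lemma map_mpoly_triang (R S : comNzRingType) n (f : {rmorphism R -> S})
    (v : 'I_n.+1 -> R) e (p : {mpoly R[n.+1]}) :
  map_mpoly f (p \mPo triang v e) = map_mpoly f p \mPo triang (f \o v) (f e).
Proof.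
apply: (rmorph_mpoly_eq (f := map_mpoly f \o comp_mpoly (triang v e))
  (g := comp_mpoly (triang (f \o v) (f e)) \o map_mpoly f)) => [c|i] /=.
  by rewrite comp_mpolyC !map_mpolyC comp_mpolyC.
rewrite map_mpolyX !triangX rmorphD /= !map_mpolyZ !map_mpolyX.
by case: eqP; rewrite ?rmorph0.
Qed.

Lemma wsum_map_triang (R S : comNzRingType) n (N : 'X_{1..n.+1} -> nat)
    (f : {rmorphism R -> S}) (Q : {mpoly R[n.+1]}) v e m :
  f (wsum N ((Q \mPo triang v e) * 'X_[m])) =
  wsum N ((map_mpoly f Q \mPo triang (f \o v) (f e)) * 'X_[m]).
Proof. by rewrite -wsum_map rmorphM /= map_mpolyX map_mpoly_triang. Qed.

(** The substitution is carried out over K[e], with e an indeterminate; since [wsum] has natural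
    weights, it commutes with the evaluation of e. *)
Lemma wsum_triang_poly (K : fieldType) n (N : 'X_{1..n.+1} -> nat)
    (q : {mpoly K[n.+1]}) (v : 'I_n.+1 -> K) (m : 'X_{1..n.+1}) :
  exists P : {poly K}, forall e, P.[e] = wsum N ((q \mPo triang v e) * 'X_[m]).
Proof.
exists (wsum N ((map_mpoly polyC q \mPo triang (fun i => (v i)%:P) 'X) * 'X_[m])).
move=> e; rewrite -[_.[e]]/(horner_eval e _) wsum_map_triang.
have -> : map_mpoly (horner_eval e) (map_mpoly polyC q) = q.
  by apply/mpolyP => u; rewrite !mcoeff_map_mpoly [LHS]hornerC.
have -> : horner_eval e \o (fun i => (v i)%:P) = v.
  by apply/funext => i; rewrite /= [LHS]hornerC.
have eX : horner_eval e 'X = e by apply: hornerX.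
by rewrite [X in triang _ X]eX.
Qed.

Lemma rmorph_ideal_mul (R S : comNzRingType) (f : {rmorphism R -> S})
    (I J : set R) (I' J' : set S) :
  (forall x, I x -> I' (f x)) -> (forall x, J x -> J' (f x)) ->
  forall x, ideal_mul I J x -> ideal_mul I' J' (f x).
Proof.
move=> If Jf; apply: ideal_gen_min => [|_ [x Ix [y Jy <-]]] /=; last first.
  by rewrite rmorphM; apply: mem_ideal_mul; [apply: If | apply: Jf].
split=> [|x y|a x]; rewrite /= ?rmorph0 ?rmorphD ?rmorphM.
- by case: (is_ideal_mul I' J').
- by case: (is_ideal_mul I' J') => _ + _; apply.
- by case: (is_ideal_mul I' J') => _ _; apply.
Qed.

Lemma rmorph_ideal_exp (R S : comNzRingType) (f : {rmorphism R -> S})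
    (I : set R) (I' : set S) : (forall x, I x -> I' (f x)) ->
  forall M x, ideal_exp I M x -> ideal_exp I' M (f x).
Proof. by move=> If; elim=> // M IHM; apply: rmorph_ideal_mul. Qed.

Lemma reduction_preimage (R : comNzRingType) (f g : {rmorphism R -> R})
    (J L : set R) : cancel f g -> cancel g f ->
  (forall x, L x -> L (f x)) -> (forall x, L x -> L (g x)) ->
  is_reduction J L -> is_reduction (f @^-1` J) L.
Proof.
move=> fK gK Lf Lg [[J0 JD JM] JL [N redN]].
have sub : f @^-1` J `<=` L by move=> x /JL /Lg; rewrite fK.
split=> //.
  split=> [|x y|a x] /=; first by rewrite rmorph0.
    by rewrite rmorphD; apply: JD.
  by rewrite rmorphM; apply: JM.
exists N => m le_Nm; rewrite eqEsubset; split; last exact: ideal_mul_mono.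
move=> x Lx; rewrite -(fK x).
have: ideal_exp L m.+1 (f x) by apply: rmorph_ideal_exp Lx.
rewrite redN //; apply: rmorph_ideal_mul => y; first by rewrite /= gK.
exact: rmorph_ideal_exp.
Qed.

(* The core of L is stable under the automorphisms x_0 |-> v_0 x_0,
   x_i |-> e x_i + v_i x_0, and as e tends to 0 they push a form q of degree k
   to q(v) x_0^k. *)
Lemma core_sub_mdeg (K : fieldType) n (N : 'X_{1..n.+1} -> nat) top
    (J L : set {mpoly K[n.+1]}) : [pchar K] =i pred0 ->
  (forall v e p, L p -> L (p \mPo triang v e)) ->
  is_reduction J L ->
  (forall p, J p -> wsum N p = 0) ->
  (forall m, N m != 0%N -> mdeg m = top) ->
  N (U_(ord0) *+ top)%MM != 0%N ->
  core L `<=` monspan (fun m => top < mdeg m)%N.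
Proof.
move=> charK Lt redJ JN Ntop N0 p core_p m pm; rewrite ltnNge.
apply/negP => le_m; set k := mdeg m in le_m; pose q := pihomog mdeg k p.
have q0 : q != 0.
  have qm : q@_m = p@_m by rewrite /q mcoeff_pihomog eqxx.
  by apply: contraNneq pm => q0; rewrite -qm q0 mcoeff0.
(* The factor x_0 ensures that v_0 is nonzero too, so that the substitution is invertible for
   nonzero e. *)
have [v] : exists v, (q * 'X_ord0).@[v] != 0.
  by apply: (mpoly_nonroot charK); rewrite mulf_neq0 // -msize_poly_eq0 msizeX.
rewrite mevalM mevalXU mulf_eq0 negb_or => /andP [qv v0].
pose h : {mpoly K[n.+1]} := 'X_[U_(ord0) *+ (top - k)].
have [P PE] := wsum_triang_poly N q v (U_(ord0) *+ (top - k))%MM.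
have P0 : P.[0] != 0.
  rewrite PE (triang0 _ (pihomogP _ _ _)) -scalerAl wsumZ mulf_neq0 //.
  rewrite mpolyXn -mpolyXD (_ : _ + _ = U_(ord0) *+ top)%MM; last first.
    by apply/mnmP => i; rewrite mnmDE !mulmnE -mulnDr subnKC.
  by rewrite wsumX natr_neq0 // lt0n.
(* [P] is nonzero at 0, where the substitution degenerates; the factor ['X] selects a nonroot other
   than 0. *)
have [e] : exists e, ('X * P).[e] != 0.
  apply: (poly_nonroot charK); rewrite mulf_neq0 ?polyX_eq0 //.
  by apply: contraNneq P0 => ->; rewrite horner0.
rewrite hornerM hornerX mulf_eq0 negb_or => /andP [e0 /eqP []]; rewrite PE.
have [v' [e' [v'0 e'0 fK gK]]] := triangK v0 e0.
have redf := reduction_preimage fK gK (Lt v e) (Lt v' e') redJ.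
have Jp : J ((p \mPo triang v e) * h).
  case: (redJ) => [[_ _ JM] _ _]; rewrite mulrC; apply: JM.
  exact: (core_p _ redf).
(* The weights live in degree [top], so only that component of the element of [J] counts; it comes
   from the component [q] of [p]. *)
rewrite -pihomog_triang -[X in _ = X](JN _ Jp).
have eh : h \is (top - k).-homog.
  by rewrite /h dhomogX /= mdegMn mdeg1 mul1n.
have -> : pihomog mdeg k (p \mPo triang v e) * h =
    pihomog mdeg top ((p \mPo triang v e) * h).
  by rewrite (pihomogMl _ eh) ?leq_subr // subKn.
set r := _ * h; rewrite (@wsum_sub _ N _ _ (msupp r)) ?msupp_uniq //.
  apply: eq_bigr => u _; rewrite mcoeff_pihomog.
  by case: eqP => // /eqP; case: (N u =P 0%N) => [->|/eqP /Ntop ->];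
    rewrite ?mulr0n ?eqxx.
by move=> u; rewrite !mcoeff_msupp mcoeff_pihomog; case: ifP => // _; rewrite eqxx.
Qed.

(** * Dimension of the polynomial ring, and heights *)

Section KrullDimension.
Context {K : fieldType} {d : nat}.
Implicit Types (p q : {mpoly K[d]}) (m u : 'X_{1..d}) (P Q L : set {mpoly K[d]}).

Definition deg_le (b : nat) : set {mpoly K[d]} := monspan (fun m => mdeg m <= b)%N.

Lemma deg_leM p q a b : deg_le a p -> deg_le b q -> deg_le (a + b) (p * q).
Proof.
move=> hp hq m; rewrite -mcoeff_msupp => /msuppM_le /allpairsP [[m1 m2] /=].
by rewrite !mcoeff_msupp => -[/hp h1 /hq h2 ->]; rewrite mdegD leq_add.
Qed.

Lemma deg_leX p a k : deg_le a p -> deg_le (k * a) (p ^+ k).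
Proof.
move=> hp; elim: k => [|k IHk]; last by rewrite exprS mulSn; apply: deg_leM.
by rewrite expr0 -mpolyX0; apply/monspanX; rewrite mdeg0.
Qed.

Lemma deg_le_prod n (F : 'I_n -> {mpoly K[d]}) (D : 'I_n -> nat) :
  (forall i, deg_le (D i) (F i)) -> deg_le (\sum_i D i) (\prod_i F i).
Proof.
move=> FD; elim/big_rec2: _ => [|i a p _ hp]; last exact: deg_leM.
by rewrite -mpolyX0; apply/monspanX; rewrite mdeg0.
Qed.

(* Counting: products of d + 1 polynomials with exponents below N outnumber the
   monomials that they involve. *)
Lemma algebraic_dependence (x : 'I_d.+1 -> {mpoly K[d]}) :
  exists N (c : {ffun 'I_d.+1 -> 'I_N} -> K), (exists e, c e != 0) /\
    \sum_e c e *: \prod_i x i ^+ e i = 0.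
Proof.
pose D := \max_i msize (x i).
have xD i : deg_le D (x i).
  move=> m; rewrite -mcoeff_msupp => /msize_mdeg_lt lt_m.
  by apply: ltnW (leq_trans lt_m _); apply: leq_bigmax.
(* [C] exceeds (d + 1) D, so the products have degree below [B]; [N] exceeds C^d, so the N^(d + 1)
   exponent vectors outnumber the B^d candidate monomials. *)
pose C := (d.+1 * D + 1)%N; pose N := (C ^ d + 1)%N; pose B := (N * C)%N.
pose E := {ffun 'I_d.+1 -> 'I_N}; pose M := {ffun 'I_d -> 'I_B}.
pose y (e : E) := \prod_i x i ^+ e i.
have yB e m : (y e)@_m != 0 -> (mdeg m < B)%N.
  move=> nz; have := deg_le_prod (fun i => deg_leX (k := e i) (xD i)) nz.
  move=> le_m; apply: leq_ltn_trans le_m _.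
  rewrite -big_distrl /= -/D; apply: (@leq_ltn_trans (d.+1 * N * D)%N).
    rewrite leq_mul2r; apply/orP; right.
    rewrite -[X in (X * _)%N]card_ord -sum_nat_const; apply: leq_sum => i _.
    exact: ltnW.
  rewrite /B /C mulnDr muln1 mulnA [(N * d.+1)%N]mulnC.
  by rewrite -[ltnLHS]addn0 ltn_add2l /N addn1.
pose A : 'M[K]_(#|{: E}|, #|{: M}|) := \matrix_(i, j)
  (y (enum_val i))@_[multinom ((enum_val j : M) t : nat) | t < d].
have: kermx A != 0.
  rewrite -mxrank_eq0 mxrank_ker subn_eq0 -ltnNge.
  apply: leq_ltn_trans (rank_leq_col _) _.
  have N0 : (0 < N)%N by rewrite /N addn1.
  rewrite !card_ffun !card_ord /B expnMn expnSr ltn_pmul2l ?expn_gt0 ?N0 //.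
  by rewrite /N addn1.
move=> /rowV0Pn [w /sub_kermxP wA w0].
exists N, (fun e => w 0 (enum_rank e)); split.
  have [i wi] : exists i, w 0 i != 0.
    apply: contra_neqP w0 => ex; apply/rowP => i; rewrite mxE.
    by apply/eqP/negPn/negP => wi; apply: ex; exists i.
  by exists (enum_val i); rewrite enum_valK.
apply/mpolyP => m; rewrite mcoeff0 raddf_sum /=.
have [lt_m|le_m] := ltnP (mdeg m) B; last first.
  rewrite big1 // => e _; rewrite mcoeffZ; apply/eqP; rewrite mulf_eq0.
  by apply/orP; right; apply/negPn/negP => /yB; rewrite ltnNge le_m.
have mB (t : 'I_d) : (m t < B)%N.
  by apply: leq_ltn_trans lt_m; rewrite mdegE (bigD1 t) //= leq_addr.
pose f : M := [ffun t => Ordinal (mB t)].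
have := congr1 (fun v : 'rV_#|{: M}| => v 0 (enum_rank f)) wA.
rewrite !mxE => wAf; rewrite -[RHS]wAf [RHS](reindex_onto enum_rank enum_val) /=; last first.
  by move=> i _; rewrite enum_valK.
apply: eq_big => [e|e _]; first by rewrite enum_rankK eqxx.
rewrite mcoeffZ mxE !enum_rankK /y; congr (_ * mcoeff _ _).
by apply/mnmP => t; rewrite mnmE ffunE.
Qed.

(** In a chain longer than d, pick x_i in p_(i + 1) outside p_i for i = 0, ..., d, and a polynomial
    relation among them. For k = 0, 1, ..., keep the terms of least exponent in x_k: this power of
    x_k can be divided out modulo the prime p_k, and the other terms keep a factor x_k and so lie in
    p_(k + 1). In the end a nonzero constant lies in p_(d + 1). *)
Lemma prime_height_le P n : prime_height_ge P n -> (n <= d)%N.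
Proof.
move=> [p [prime_p chain_p _]]; rewrite leqNgt; apply/negP => lt_dn.
have /choice [x xp] : forall i : 'I_d.+1, exists x, p i.+1 x /\ ~ p i x.
  move=> i; have lt_in : (i < n)%N by apply: leq_trans lt_dn.
  have [_ nsub] := chain_p i lt_in.
  apply: contra_notP nsub => ex y py; apply: contra_notP ex => npy.
  by exists y.
have [N [c [[e0 ce0] rel]]] := algebraic_dependence x.
pose E := {ffun 'I_d.+1 -> 'I_N}.
pose y k (e : E) := \prod_(i < d.+1 | (k <= i)%N) x i ^+ e i.
have key k : (k <= d.+1)%N -> exists S : {set E}, [/\ S != finset.set0,
    forall e, e \in S -> c e != 0,
    forall e e' (i : 'I_d.+1), e \in S -> e' \in S -> (i < k)%N -> e i = e' i &
    p k (\sum_(e in S) c e *: y k e)].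
  elim: k => [_|k IHk lt_kd].
    exists [set e : E | c e != 0]%SET; split=> //.
    - by apply/finset.set0Pn; exists e0; rewrite inE.
    - by move=> e; rewrite inE.
    suff -> : \sum_(e in [set e : E | c e != 0]%SET) c e *: y 0%N e = 0.
      by have [[p0 _ _] _ _] := prime_p 0%N (leq0n _).
    rewrite -[RHS]rel [RHS](bigID (fun e => c e != 0)) /=.
    rewrite [X in _ = _ + X]big1 ?addr0 => [|e /negPn /eqP ->]; last first.
      by rewrite scale0r.
    by apply: eq_big => [e|e _ //]; rewrite inE.
  have [S [S0 cS eqS pS]] := IHk (ltnW lt_kd).
  pose ik := Ordinal lt_kd; have /finset.set0Pn [e1 e1S] := S0.
  case: (arg_minnP (fun e : E => (e ik : nat)) e1S) => e2 e2S min_e2.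
  pose S' := [set e in S | e ik == e2 ik]%SET.
  have S'P e : e \in S' -> e \in S /\ e ik = e2 ik.
    by rewrite inE => /andP [eS /eqP].
  have lt_kn : (k < n)%N by apply: leq_trans lt_dn.
  have [Pk Pk1] := (prime_p k (ltnW lt_kn), prime_p k.+1 lt_kn).
  have [[pk0 pkD pkM] _ pkP] := Pk; have [idk1 _ _] := Pk1.
  have [sub_k _] := chain_p k lt_kn.
  have yS e : y k e = x ik ^+ e ik * y k.+1 e.
    rewrite /y (bigD1 ik) //=; congr (_ * _); apply: eq_bigl => i.
    by rewrite ltn_neqAle andbC eq_sym.
  pose r := \sum_(e in S | e \notin S')
    c e *: (x ik ^+ (e ik - e2 ik).-1 * y k.+1 e).
  exists S'; split.
  - by apply/finset.set0Pn; exists e2; rewrite inE (e2S : e2 \in S) /=.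
  - by move=> e /S'P [/cS].
  - move=> e e' i /S'P [eS eik] /S'P [e'S e'ik]; rewrite ltnS leq_eqVlt.
    case/orP => [/eqP ek|]; last exact: eqS.
    by have -> : i = ik by [apply: val_inj]; rewrite eik e'ik.
  have fact : \sum_(e in S) c e *: y k e = x ik ^+ e2 ik *
      (\sum_(e in S') c e *: y k.+1 e + x ik * r).
    rewrite (bigID (mem S')) /= mulrDr mulrA /r !mulr_sumr.
    congr (_ + _); [apply: eq_big => [e|e /andP [_ /S'P [_ eik]]]|apply: eq_bigr => e].
    - by rewrite inE; case: (e \in S).
    - by rewrite yS eik scalerAr.
    move=> /andP [eS]; rewrite inE eS /= => ne; rewrite yS -!scalerAr; congr (_ *: _).
    have lt_e : (e2 ik < e ik)%N.
      by rewrite ltn_neqAle min_e2 // andbT eq_sym.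
    rewrite !mulrA -exprSr -exprD addSn -addnS prednK ?subn_gt0 //.
    by rewrite subnKC // ltnW.
  move: pS; rewrite fact => /pkP [pxk|/sub_k].
    by case: (xp ik) => _ []; apply: prime_expr Pk pxk.
  move=> pin; apply: (ideal_subr (y := - (x ik * r)) idk1); first by rewrite opprK.
  apply: idealN => //; rewrite mulrC; case: idk1 => _ _; apply.
  by case: (xp ik).
have [S [/finset.set0Pn [e eS] cS eqS]] := key _ (leqnn _).
have [[_ _ pM] p1 _] := prime_p d.+1 lt_dn.
rewrite (bigD1 e) //= big1 ?addr0 => [|e' /andP [e'S /eqP ne]]; last first.
  by case: ne; apply/ffunP => i; apply: eqS.
rewrite /y big_pred0 => [|i]; last by rewrite leqNgt ltn_ord.
move=> pc; apply: p1.
have -> : 1 = (c e)^-1%:MP * (c e *: 1) :> {mpoly K[d]}.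
  by rewrite mul_mpolyC scalerA mulVf ?scale1r ?cS.
exact: pM.
Qed.

Lemma prime_height_ge_lt P Q n : is_prime_ideal Q -> P `<` Q ->
  prime_height_ge P n -> prime_height_ge Q n.+1.
Proof.
move=> primeQ ltPQ [p [prime_p chain_p pn]].
exists (fun i => if (i <= n)%N then p i else Q); split.
- by move=> i; case: (leqP i n) => [/prime_p|].
- move=> i; rewrite ltnS => le_in; rewrite le_in; case: ltnP => [/chain_p //|le_ni].
  have -> : i = n by apply/eqP; rewrite eqn_leq le_in.
  by rewrite pn.
- by rewrite ltnn.
Qed.

Definition coord_kill (k : nat) : d.-tuple {mpoly K[d]} :=
  [tuple if (i < k)%N then 0 else 'X_i | i < d].

(* The prime ideal (X_0, ..., X_(k-1)). *)
Definition coord_prime (k : nat) : set {mpoly K[d]} :=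
  [set p | p \mPo coord_kill k = 0].

Lemma coord_killX k i :
  'X_i \mPo coord_kill k = if (i < k)%N then 0 else 'X_i.
Proof. by rewrite comp_mpolyXU -tnth_nth tnth_mktuple. Qed.

Lemma coord_prime_prime k : is_prime_ideal (coord_prime k).
Proof.
rewrite /coord_prime; split=> [||x y] /=.
- split=> [|x y|a x] /=; first by rewrite comp_mpoly0.
    by rewrite comp_mpolyD => -> ->; rewrite addr0.
  by rewrite rmorphM /= => ->; rewrite mulr0.
- by rewrite comp_mpoly1 => /eqP; rewrite oner_eq0.
by rewrite rmorphM /= => /eqP; rewrite mulf_eq0 => /orP [] /eqP; [left|right].
Qed.

Lemma coord_primeX k (i : 'I_d) : coord_prime k 'X_i <-> (i < k)%N.
Proof.
rewrite /coord_prime /= coord_killX; case: ltnP => // _; split=> // /eqP.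
by rewrite -msize_poly_eq0 msizeX.
Qed.

Lemma coord_prime_lt k : (k < d)%N -> coord_prime k `<` coord_prime k.+1.
Proof.
move=> lt_kd; split=> [|sub]; last first.
  have /sub : coord_prime k.+1 'X_(Ordinal lt_kd) by apply/coord_primeX.
  by move/coord_primeX; rewrite ltnn.
move=> p /= pk; have: (p \mPo coord_kill k) \mPo coord_kill k.+1 = 0.
  by rewrite pk comp_mpoly0.
rewrite /coord_prime /= => <-.
apply: (rmorph_mpoly_eq (f := comp_mpoly (coord_kill k.+1)) (g :=
  comp_mpoly (coord_kill k.+1) \o comp_mpoly (coord_kill k))) => [c|i] /=.
  by rewrite !comp_mpolyC.
rewrite !coord_killX; case: (ltnP i k) => [lt_ik|_]; last by rewrite coord_killX.
by rewrite comp_mpoly0 ltnS (ltnW lt_ik).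
Qed.

Lemma coord_prime_height k n j : (k + j <= d)%N ->
  prime_height_ge (coord_prime k) n -> prime_height_ge (coord_prime (k + j)) (n + j).
Proof.
elim: j => [|j IHj]; first by rewrite !addn0.
rewrite !addnS => lt_kjd /(IHj (ltnW lt_kjd)).
apply: prime_height_ge_lt; [exact: coord_prime_prime|exact: coord_prime_lt].
Qed.

(** A chain of length g ending in [coord_prime k] is prolonged by the d - k larger coordinate
    primes, and the result has length at most d. *)
Lemma height_le_coord L g k : (k <= d)%N -> height_ge L g ->
  L `<=` coord_prime k -> (g <= k)%N.
Proof.
move=> le_kd hL /(hL _ (coord_prime_prime k)).
move=> /(coord_prime_height (j := d - k)); rewrite subnKC // => /(_ (leqnn d)).
move/prime_height_le; lia.
Qed.

Lemma coord_prime_full p : p@_0%MM = 0 -> coord_prime d p.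
Proof.
move=> p0; rewrite /coord_prime /= comp_mpolyEX big_seq big1 // => m.
rewrite mcoeff_msupp comp_mpolyX; have [->|m0 _] := eqVneq m 0%MM.
  by rewrite p0 eqxx.
have [i mi] := mnm_neq0 m0.
by rewrite (bigD1 i) //= tnth_mktuple ltn_ord expr0n (negPf mi) mul0r scaler0.
Qed.

(** A prime containing these powers contains all variables, hence is the top of the chain of
    coordinate primes. *)
Lemma height_full L k : (forall i : 'I_d, L ('X_i ^+ k)) -> height_ge L d.
Proof.
move=> LX P primeP LP; have [idP P1 _] := primeP; have [P0 PD PM] := idP.
have PX i : P 'X_i by apply: prime_expr primeP (LP _ (LX i)).
have sub p : p@_0%MM = 0 -> P p.
  move=> p0; rewrite (mpolyE p); apply: ideal_sum_seq => // m.
  rewrite mcoeff_msupp; have [->|m0 _] := eqVneq m 0%MM; first by rewrite p0 eqxx.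
  have [i mi] := mnm_neq0 m0.
  rewrite -mul_mpolyC; apply: PM; apply: (mem_ideal_divX idP _ (PX i)).
  by rewrite lep1mP.
suff -> : P = coord_prime (0 + d).
  rewrite -[d in prime_height_ge _ d]add0n; apply: coord_prime_height => //.
  by exists (fun=> coord_prime 0); split=> // i _; apply: coord_prime_prime.
rewrite add0n eqEsubset; split=> p; last first.
  have [p0 _|p0] := eqVneq p@_0%MM 0; first exact: sub.
  have: coord_prime d (p - (p@_0%MM)%:MP).
    by apply: coord_prime_full; rewrite mcoeffB mcoeffC eqxx mulr1 subrr.
  rewrite /coord_prime /= comp_mpolyB comp_mpolyC => e e0.
  by move: e; rewrite e0 sub0r => /eqP; rewrite oppr_eq0 mpolyC_eq0 (negPf p0).
move=> Pp; apply: coord_prime_full; apply/eqP/negPn/negP => p0; apply: P1.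
have -> : 1 = (p@_0%MM)^-1%:MP * (p - (p - (p@_0%MM)%:MP)).
  by rewrite subKr -mpolyCM mulVf.
apply: PM; apply: idealB => //; apply: sub.
by rewrite mcoeffB mcoeffC eqxx mulr1 subrr.
Qed.

End KrullDimension.

(** * Structure and classification of lex-segment ideals *)

Section LexStructure.
Context {K : fieldType} {d : nat}.
Implicit Types (L : set {mpoly K[d]}) (m u : 'X_{1..d}).

Lemma mem_lex_monomials i m : (m \in lex_monomials i) = (mdeg m == i).
Proof.
rewrite mem_sort mem_filter andb_idr // => /eqP dm.
have lt_m : (mdeg m < i.+1)%N by rewrite dm.
by apply/mapP; exists (BMultinom lt_m); rewrite ?mem_enum.
Qed.

Lemma lin_span_mem (V : lmodType K) (s : seq V) x : x \in s -> lin_span s x.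
Proof.
move=> xs; have lt_x : (index x s < size s)%N by rewrite index_mem.
exists (fun j => (j == index x s)%:R).
rewrite (bigD1 (Ordinal lt_x)) //= eqxx scale1r nth_index // big1 ?addr0 //.
by move=> j /negPf; rewrite -val_eqE /= => ->; rewrite scale0r.
Qed.

(** Monomials are linearly independent, so a monomial in the span of [take r] belongs to that list,
    and the list is decreasing. *)
Lemma lex_segment_up L m u : is_lex_segment_ideal L -> mdeg m = mdeg u ->
  (m <= u)%O -> L 'X_[m] -> L 'X_[u].
Proof.
move=> [_ lexL] dmu le_mu Lm; have [r [_ eL]] := lexL (mdeg m).
have: graded_piece L (mdeg m) 'X_[m] by split; rewrite // dhomogX.
set s := lex_monomials (mdeg m) in eL *; rewrite eL => -[c ec].
have mr : m \in take r s.
  apply/negPn/negP => nmr; move: (congr1 (mcoeff m) ec).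
  rewrite mcoeffX eqxx raddf_sum big1 /= => [/eqP|j _]; first by rewrite oner_eq0.
  have lt_j : (j < size (take r s))%N.
    by rewrite -(size_map (fun m => 'X_[K, m])) ltn_ord.
  rewrite (nth_map 0%MM) // mcoeffZ mcoeffX; case: eqP => [e|]; last by rewrite mulr0.
  by case/negP: nmr; rewrite -e mem_nth.
have us : u \in s by rewrite mem_lex_monomials dmu.
have ur : u \in take r s.
  move: us; rewrite -{1}(cat_take_drop r s) mem_cat => /orP [//|ud].
  have srt : sorted (fun m1 m2 : 'X_{1..d} => (m2 <= m1)%O) s.
    by apply: sort_sorted => x y; apply: le_total.
  move: srt; rewrite -(cat_take_drop r s) sorted_pairwise; last first.
    by move=> y x z /= le_yx le_zy; exact: (le_trans le_zy le_yx).
  rewrite pairwise_cat => /andP [/allrelP /(_ m u mr ud) le_um _].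
  by rewrite cat_take_drop; have <- : m = u by apply: le_anti; rewrite le_mu.
suff: graded_piece L (mdeg m) 'X_[u] by case.
by rewrite eL; apply/lin_span_mem/map_f.
Qed.

Lemma generated_submonomial L delta m : generated_in_degree L delta ->
  L 'X_[m] -> exists u, [/\ (u <= m)%MM, mdeg u = delta & L 'X_[u]].
Proof.
move=> genL; have [k] := ubnP (mdeg m); elim: k m => // k IHk m lt_mk Lm.
have [minm|] := pselect (is_minimal_generator L m).
  by exists m; split=> //; [apply: lepm_refl | apply: genL].
move=> nmin; have [u le_um [Lu ne]] : exists2 u, (u <= m)%MM & L 'X_[u] /\ u <> m.
  apply: contra_notP nmin => ex; split=> // u le_um Lu.
  by apply: contra_notP ex => ne; exists u.
have lt_uk : (mdeg u < k)%N.
  move: (congr1 mdeg (submK le_um)); rewrite mdegD => e.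
  have: (mdeg (m - u)%MM != 0)%N.
    rewrite mdeg_eq0; apply: contra_notN ne => /eqP e0.
    by rewrite -(submK le_um) e0 add0m.
  by move: lt_mk; lia.
have [v [le_vu dv Lv]] := IHk u lt_uk Lu.
by exists v; split=> //; apply: lepm_trans le_um.
Qed.

Lemma mnm_pure_power m (i : 'I_d) : mdeg m = m i -> m = (U_(i) *+ m i)%MM.
Proof.
move=> dm; apply/mnmP => j; rewrite mulmnE mnm1E.
have [->|ne] := eqVneq i j; first by rewrite mul1n.
move: dm; rewrite mdegE (bigD1 i) //= (bigD1 j) 1?eq_sym //=; lia.
Qed.

Lemma lex_le_coordX m (k : 'I_d) : (forall i : 'I_d, (i < k)%N -> m i = 0%N) ->
  (m <= (U_(k) *+ mdeg m)%MM)%O.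
Proof.
move=> m0; have [mk|ne] := eqVneq (mdeg m) (m k).
  by rewrite mk -(mnm_pure_power mk).
apply/ltW/ltmcP; first by rewrite mdegMn mdeg1 mul1n.
exists k => [j lt_jk|].
  by rewrite mulmnE mnm1E -val_eqE /= gtn_eqF // m0.
rewrite mulmnE mnm1E eqxx mul1n ltn_neqAle eq_sym ne /=.
by rewrite mdegE (bigD1 k) //= leq_addr.
Qed.

(** Height above g means that [L] is not inside (x_0, ..., x_(g - 1)), so some monomial of [L]
    involves only x_g and later variables. A divisor of it of degree [delta] lies in [L], and
    x_g^delta is at least as large. *)
Lemma lex_segment_coordX L delta g (lt_gd : (g < d)%N) :
  is_lex_segment_ideal L -> generated_in_degree L delta -> height_ge L g.+1 ->
  L 'X_[U_(Ordinal lt_gd) *+ delta].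
Proof.
move=> lexL genL htL; have [monL _] := lexL.
have LE := monomial_ideal_monspan monL.
have [p [Lp np]] : exists p, L p /\ ~ coord_prime g p.
  apply: contrapT => nex; have: (g.+1 <= g)%N; last by rewrite ltnn.
  apply: (height_le_coord (ltnW lt_gd) htL) => p Lp.
  by apply: contrapT => np; apply: nex; exists p.
have [m [pm m0]] : exists m, p@_m != 0 /\ forall i : 'I_d, (i < g)%N -> m i = 0%N.
  apply: contrapT => nex; apply: np; rewrite /coord_prime /= comp_mpolyEX.
  rewrite big_seq big1 // => m; rewrite mcoeff_msupp comp_mpolyX => pm.
  have [i lt_ig mi] : exists2 i : 'I_d, (i < g)%N & m i != 0%N.
    apply: contra_notP nex => ex; exists m; split=> // i lt_ig.
    by apply/eqP/negPn/negP => ne; apply: ex; exists i.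
  by rewrite (bigD1 i) //= tnth_mktuple lt_ig expr0n (negPf mi) mul0r scaler0.
have Lm : L 'X_[m] by move: Lp; rewrite {1}LE; apply.
have [u [le_um <- Lu]] := generated_submonomial genL Lm.
apply: (lex_segment_up lexL _ _ Lu); first by rewrite mdegMn mdeg1 mul1n.
apply: lex_le_coordX => i /m0 mi; apply/eqP; rewrite -leqn0 -mi.
exact: (mnm_lepP le_um).
Qed.

Lemma height_le_dim L delta g : is_monomial_ideal L ->
  generated_in_degree L delta -> (0 < delta)%N -> height_ge L g -> (g <= d)%N.
Proof.
move=> /monomial_ideal_monspan LE genL d0 htL.
apply: (height_le_coord (leqnn d) htL) => p; rewrite LE => Lp.
apply: coord_prime_full; apply/eqP/negPn/negP => /Lp /(generated_submonomial genL).
move=> [u [le_u0 du _]]; move: d0; rewrite -du lt0n mdeg_eq0 => /eqP [].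
by apply/mnmP => i; apply/eqP; rewrite mnm0E -leqn0 -(mnm0E i); apply/mnm_lepP.
Qed.

End LexStructure.

Section LexClassification.
Context {K : fieldType}.

Lemma lex_le_last n (m : 'X_{1..n.+2}) :
  ((U_(ord_max) *+ mdeg m)%MM <= m)%O.
Proof.
rewrite leNgt; apply/negP => /ltmcP []; first by rewrite mdegMn mdeg1 mul1n.
move=> i m0; rewrite mulmnE mnm1E; case: eqP => [ei|_]; last by rewrite mul0n ltn0.
rewrite mul1n mdegE (bigD1 i) //= big1 ?addn0 ?ltnn // => j ne.
have lt_ji : (j < i)%N.
  by rewrite ltn_neqAle ne -ei -ltnS ltn_ord.
by rewrite m0 // mulmnE mnm1E ei eq_sym (negPf ne).
Qed.

Lemma lex_segment_full n (L : set {mpoly K[n.+2]}) delta :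
  is_lex_segment_ideal L -> generated_in_degree L delta ->
  L 'X_[U_(ord_max) *+ delta] -> L = monspan (lexpow 0 delta 1).
Proof.
move=> lexL genL Lz; have [monL _] := lexL.
have idL : is_ideal L by case: monL => S ->; apply: is_ideal_gen.
rewrite (monomial_ideal_monspan monL); apply: eq_monspan => m; split=> [|[dm _]].
  move=> /(generated_submonomial genL) [u [le_um du _]]; split; rewrite ?mul1n //.
  by apply: upclosed_mdeg le_um _; rewrite du.
have [u [le_um du]] := submonomial_mdeg dm.
apply: (mem_ideal_divX idL le_um); apply: lex_segment_up lexL _ _ Lz.
  by rewrite mdegMn mdeg1 mul1n du mul1n.
by have := lex_le_last u; rewrite du mul1n.
Qed.

Lemma height_lexpow0 n delta :
  height_ge (@monspan K n.+2 (lexpow 0 delta 1)) n.+2.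
Proof.
apply: (@height_full _ _ _ delta) => i; rewrite mpolyXn.
by apply/monspanX; split; rewrite // mdegMn mdeg1 !mul1n.
Qed.

Lemma lex_classification2 (L : set {mpoly K[2]}) g delta :
  is_lex_segment_ideal L -> has_height L g -> (2 <= g)%N ->
  generated_in_degree L delta -> (2 <= delta)%N ->
  g = 2%N /\ L = monspan (lexpow 0 delta 1).
Proof.
move=> lexL [htL _] g2 genL d2.
have le_g2 : (g <= 2)%N by apply: height_le_dim htL; [case: lexL|exact: genL|lia].
have eg : g = 2%N by lia.
split=> //; apply: lex_segment_full => //; rewrite eg in htL.
have -> : ord_max = Ordinal (ltnSn 1) by apply: val_inj.
exact: lex_segment_coordX.
Qed.

(** In height 2, [a] is the least j with y^j z^(delta - j) in [L]; it exists because y^delta lies in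
    [L]. *)
Lemma lex_classification3 (L : set {mpoly K[3]}) g delta :
  is_lex_segment_ideal L -> has_height L g -> (2 <= g)%N ->
  generated_in_degree L delta -> (2 <= delta)%N ->
  exists a, [/\ (a <= delta)%N, g = (if a == 0 then 3 else 2)%N &
    L = monspan (lexpow a delta 1)].
Proof.
move=> lexL [htL nhtL] g2 genL d2; have [monL _] := lexL.
have le_g3 : (g <= 3)%N by apply: height_le_dim htL; [done|exact: genL|lia].
have idL : is_ideal L by case: monL => S ->; apply: is_ideal_gen.
have [eg|eg] : g = 3%N \/ g = 2%N by lia.
  exists 0%N; split=> //; apply: lex_segment_full => //; rewrite eg in htL.
  have -> : ord_max = Ordinal (ltnSn 2) by apply: val_inj.
  exact: lex_segment_coordX.
rewrite {g g2 le_g3}eg in htL nhtL *.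
have Ly : L 'X_[mon3 0 delta 0].
  suff -> : mon3 0 delta 0 = (U_(Ordinal (isT : (1 < 3)%N)) *+ delta)%MM.
    exact: lex_segment_coordX.
  by apply/mnmP; apply: forall_ord3; rewrite mulmnE mnm1E mon3E -?val_eqE /= ?mul1n.
have Lup m u : mdeg m = mdeg u -> (m <= u)%O -> L 'X_[m] -> L 'X_[u].
  exact: lex_segment_up.
have exa : exists j, (j <= delta)%N && `[< L 'X_[mon3 0 j (delta - j)] >].
  by exists delta; rewrite leqnn subnn; apply/asboolP.
case: (ex_minnP exa) => a /andP [le_ad /asboolP La] min_a.
(* For a = 0 the ideal would be the full power m^delta, of height 3. *)
have a0 : (0 < a)%N.
  rewrite lt0n; apply/eqP => a0; case: nhtL.
  rewrite (lex_segment_full lexL genL); first exact: height_lexpow0.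
  move: La; rewrite a0 subn0; congr (L 'X_[_]).
  by apply/mnmP; apply: forall_ord3; rewrite mulmnE mnm1E mon3E -?val_eqE /= ?mul1n.
exists a; split=> //; first by rewrite eqn0Ngt a0.
have good i j k : (i + j + k = delta)%N -> (0 < i)%N || (a <= j)%N ->
    L 'X_[mon3 i j k].
  move=> dijk; have [i0 /= le_aj|i0 _] := posnP i; last first.
    apply: Lup Ly; first by rewrite !mdeg_mon3; lia.
    apply/ltW/ltmcP; first by rewrite !mdeg_mon3; lia.
    by exists ix0 => [t|]; rewrite ?mon3E.
  apply: Lup La; first by rewrite !mdeg_mon3; lia.
  have [ej|ne] := eqVneq a j.
    have -> : k = (delta - a)%N by lia.
    by rewrite i0 ej lexx.
  apply/ltW/ltmcP; first by rewrite !mdeg_mon3; lia.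
  exists ix1; last by rewrite !mon3E; lia.
  by apply: forall_ord3; rewrite ?mon3E.
rewrite (monomial_ideal_monspan monL); apply: eq_monspan => m; split.
  move=> /(generated_submonomial genL) [u [le_um du Lu]].
  apply: (psys_up (lexpow_power_system le_ad) le_um).
  move: u du Lu {le_um}; apply: mnm3_ind => i j k; rewrite mdeg_mon3 => dijk Lu.
  split; rewrite ?mdeg_mon3 ?dijk ?mul1n // !mon3E muln1.
  case: (posnP i) => [i0|]; last by move=> ?; nia.
  rewrite i0 muln0; apply: min_a; apply/andP; split; first lia.
  have -> : (delta - j = k)%N by lia.
  by apply/asboolP; rewrite -[X in mon3 X]i0.
move=> /(psys_min_degree (lexpow_power_system le_ad)) [u [le_um + Tu]].
move=> du; apply: (mem_ideal_divX idL le_um).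
move: u du Tu {le_um}; apply: mnm3_ind => i j k; rewrite mdeg_mon3 mul1n => dijk [_].
rewrite !mon3E muln1 => le_a; apply: good => //.
by case: (posnP i) le_a => [->|//]; rewrite muln0.
Qed.

End LexClassification.

(** * Coprime members of a linear system of polynomials *)

Section CoprimeSelection.
Context {K : fieldType}.
Context (charK : [pchar K] =i pred0).
Implicit Types (p q D F G H : {poly K}).

Lemma coprimep_prodr D n (E : nat -> {poly K}) :
  (forall i, (i < n)%N -> coprimep D (E i)) -> coprimep D (\prod_(i < n) E i).
Proof.
move=> DE; elim/big_rec: _ => [|i p _ cop]; first exact: coprimep1.
by rewrite coprimepMr DE.
Qed.

(** The gcds of [F] with G + c H, for c = 1, 2, ..., are pairwise coprime: a common divisor of two
    of them divides [H] and therefore [G]. If none were constant, a product of sufficiently many of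
    them would divide [F] and be larger than [F]. *)
Lemma coprimep_addZ F G H : F != 0 -> coprimep F G ->
  exists2 c, c != 0 & coprimep F (G + c *: H).
Proof.
move=> F0 copFG; pose c i : K := i.+1%:R; pose D i := gcdp F (G + c i *: H).
have [//|nex] := pselect (exists2 c, c != 0 & coprimep F (G + c *: H)).
have sD i : (1 < size (D i))%N.
  have: D i != 0 by rewrite gcdp_eq0 negb_and F0.
  rewrite -size_poly_gt0 leq_eqVlt eq_sym => /orP [|//] s1; case: nex.
  by exists (c i); [apply: (natr_neq0 charK)|].
have copD i j : i != j -> coprimep (D i) (D j).
  move=> ne; apply/coprimepP => E; rewrite !dvdp_gcd.
  move=> /andP [EF Ei] /andP [_ Ej].
  have cij : c i - c j != 0.
    by rewrite subr_eq0; apply: contra ne => /eqP /(natr_inj_char0 charK) [->].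
  have EH : E %| H.
    have := dvdp_sub Ei Ej; rewrite opprD addrACA subrr add0r -scalerBl.
    by rewrite dvdpZr.
  have EG : E %| G by move: Ei; rewrite dvdp_addl // dvdpZr ?natr_neq0.
  by apply: (coprimepP _ _ copFG).
have prodD n : \prod_(i < n) D i %| F /\ (n < size (\prod_(i < n) D i)%R)%N.
  elim: n => [|n [dvd lt_n]]; first by rewrite big_ord0 dvd1p size_poly1.
  rewrite big_ord_recr /=; split.
    rewrite Gauss_dvdp ?dvd ?dvdp_gcdl //.
    rewrite coprimep_sym; apply: coprimep_prodr => i lt_in.
    by apply: copD; rewrite gtn_eqF.
  rewrite size_mul ?gcdp_eq0 ?negb_and ?F0 //.
    case: (size (D n)) (sD n) => [|[|k]] // _.
    by rewrite addnS /= addnS ltnS (leq_trans lt_n) ?leq_addr.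
  by rewrite -size_poly_gt0 (leq_trans _ lt_n).
have [dvd] := prodD (size F); rewrite ltnNge => /negP [].
exact: dvdp_leq.
Qed.

(** Induction on the size of [F]. A divisor p of least positive degree is irreducible; take G1 in
    [S] coprime to F / p. If p divides G1, add c H with p not dividing H: a suitable nonzero c keeps
    the sum coprime to F / p. *)
Lemma coprimep_select (S : {poly K} -> Prop) F : F != 0 ->
  (forall G H c, S G -> S H -> S (G + c *: H)) -> (exists G, S G) ->
  (forall D, (1 < size D)%N -> D %| F -> exists2 H, S H & ~~ (D %| H)) ->
  exists2 G, S G & coprimep F G.
Proof.
move=> F0 SD exS; have [k] := ubnP (size F); elim: k F F0 => // k IHk F F0 lt_k hF.
have [G0 SG0] := exS.
have [le_F1|lt_F] := leqP (size F) 1.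
  exists G0 => //; rewrite -size_poly_gt0 in F0.
  have/size_poly1P [c c0 ->] : size F == 1%N by rewrite eqn_leq le_F1 F0.
  by rewrite coprimep_def -[size _ == _]/(coprimep _ _) -alg_polyC coprimepZl // coprime1p.
have exD : exists s, `[< exists2 D, D %| F & (1 < size D)%N && (size D == s) >].
  by exists (size F); apply/asboolP; exists F; rewrite ?dvdpp ?lt_F ?eqxx.
case: (ex_minnP exD) => _ /asboolP [p pF /andP [p1 /eqP <-]] min_p.
have p_coprime G : ~~ (p %| G) -> coprimep p G.
  apply: contraR; rewrite coprimep_def => ne1.
  have p0 : p != 0 by rewrite -size_poly_gt0; lia.
  have g0 : gcdp p G != 0 by rewrite gcdp_eq0 negb_and p0.
  have lt1 : (1 < size (gcdp p G))%N.
    by rewrite -size_poly_gt0 in g0; rewrite ltn_neqAle eq_sym ne1.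
  suff : gcdp p G %= p by move/eqp_dvdl <-; apply: dvdp_gcdr.
  rewrite -dvdp_size_eqp ?dvdp_gcdl // eqn_leq dvdp_leq ?dvdp_gcdl //=.
  apply: min_p; apply/asboolP; exists (gcdp p G); last by rewrite lt1 eqxx.
  by apply: dvdp_trans pF; apply: dvdp_gcdl.
pose F1 := F %/ p; have eF : F = F1 * p by rewrite divpK.
have [F10 p0] : F1 != 0 /\ p != 0.
  by move: F0; rewrite eF mulf_eq0 negb_or => /andP [].
have lt_F1 : (size F1 < k)%N.
  by move: p1 lt_k; rewrite eF size_mul //; move: (size F1) (size p) => a b; lia.
have [|G1 SG1 cop1] := IHk F1 F10 lt_F1.
  by move=> D D1 DF1; apply: hF => //; rewrite eF dvdp_mulr.
have [pG1|/p_coprime copG1] := boolP (p %| G1); last first.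
  by exists G1; rewrite // eF coprimepMl cop1 copG1.
have [H SH npH] := hF p p1 pF.
have [c c0 copc] := coprimep_addZ H F10 cop1.
exists (G1 + c *: H); first exact: SD.
rewrite eF coprimepMl copc p_coprime // dvdp_addr //.
by rewrite dvdpZr.
Qed.

End CoprimeSelection.

Section MonomialDivision.
Context {K : fieldType} {d : nat}.
Implicit Types (p q : {mpoly K[d]}) (m u : 'X_{1..d}).

Lemma monomial_div u p : (forall m, p@_m != 0 -> (u <= m)%MM) ->
  exists q, p = 'X_[u] * q /\
    forall P, (forall m, p@_m != 0 -> P (m - u)%MM) -> monspan P q.
Proof.
move=> up; pose q := \sum_(m <- msupp p) p@_m *: 'X_[K, m - u].
have eq : p = 'X_[u] * q.
  rewrite {1}(mpolyE p) mulr_sumr big_seq [RHS]big_seq; apply: eq_bigr => m.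
  by rewrite mcoeff_msupp => /up le_um; rewrite -scalerAr -mpolyXD addmC submK.
exists q; split=> // P hP m qm; have: p@_(u + m)%MM != 0.
  by rewrite eq mulrC mcoeffMX.
by move/hP; rewrite addmC addmK.
Qed.

Lemma monomial_div_homog u p n : p \is n.-homog ->
  (forall m, p@_m != 0 -> (u <= m)%MM) ->
  exists2 q, p = 'X_[u] * q & q \is (n - mdeg u).-homog.
Proof.
move=> hp up; have [q [eq Pq]] := monomial_div up.
exists q => //; apply: dhomogIP; apply: Pq => m pm.
by rewrite -(dhomog_coeff hp pm) -{2}(submK (up _ pm)) mdegD addnK.
Qed.

Lemma monspan_split P Q p : monspan (fun m => P m \/ Q m) p ->
  exists p1 p2, [/\ p = p1 + p2,
    forall m, p1@_m != 0 -> P m /\ p@_m != 0 &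
    forall m, p2@_m != 0 -> Q m /\ p@_m != 0].
Proof.
move=> pPQ; pose p1 := \sum_(m <- msupp p | `[< P m >]) p@_m *: 'X_[K, m].
pose p2 := \sum_(m <- msupp p | ~~ `[< P m >]) p@_m *: 'X_[K, m].
have coef (A : pred 'X_{1..d}) m :
    (\sum_(u <- msupp p | A u) p@_u *: 'X_[K, u])@_m = if A m then p@_m else 0.
  rewrite raddf_sum /=; have [mp|/[dup] mp /memN_msupp_eq0 ->] := boolP (m \in msupp p).
    rewrite big_mkcond (bigD1_seq m) ?msupp_uniq //= big1 => [|u /negPf ne].
      by rewrite addr0 mcoeffZ mcoeffX eqxx mulr1.
    by rewrite mcoeffZ mcoeffX ne mulr0 if_same.
  rewrite if_same big_seq_cond big1 // => u /andP [up _]; rewrite mcoeffZ mcoeffX.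
  by case: eqP => [e|]; [rewrite -e up in mp|rewrite mulr0].
exists p1, p2; split=> [|m|m].
- by rewrite {1}(mpolyE p) (bigID (fun m => `[< P m >])).
- rewrite coef; case: asboolP => [//|_]; by rewrite eqxx.
- rewrite coef; case: asboolP => [_|nP pm]; first by rewrite eqxx.
  by split=> //; case: (pPQ m pm).
Qed.

End MonomialDivision.

(** * Binary forms as univariate polynomials *)

Section Dehomogenize.
Context {K : fieldType}.
Implicit Types (p q : {mpoly K[3]}) (f g : {poly K}).

(* x |-> 'X, y |-> 1, z |-> 0 : forms of degree n in x and y correspond to
   polynomials of size at most n + 1. *)
Definition dehom : {mpoly K[3]} -> {poly K} :=
  mmap polyC (fun i : 'I_3 => nth 0 [:: 'X; 1] i).

HB.instance Definition _ := GRing.RMorphism.on dehom.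

Lemma dehomZ c p : dehom (c *: p) = c *: dehom p.
Proof. by rewrite /dehom mmapZ mul_polyC. Qed.

Lemma dehomX i j k : dehom 'X_[mon3 i j k] = if k == 0%N then 'X^i else 0.
Proof.
rewrite /dehom mmapX /mmap1 !big_ord_recl big_ord0 !mnmE /= expr1n mul1r mulr1.
by case: k => [|k]; rewrite ?mulr1 // exprS mul0r mulr0.
Qed.

Lemma dehom_coef p n i : p \is n.-homog ->
  (dehom p)`_i = if (i <= n)%N then p@_(mon3 i (n - i) 0) else 0.
Proof.
move=> hp; transitivity (\sum_(m <- msupp p)
    p@_m * ((m ix2 == 0%N) && (m ix0 == i))%:R).
  rewrite {1}(mpolyE p) rmorph_sum coef_sum; apply: eq_bigr => m _ /=.
  rewrite dehomZ coefZ (mnm3_eq m) dehomX !mon3E; congr (_ * _).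
  by case: eqP; rewrite ?coef0 ?coefXn 1?eq_sym.
have key m : m \in msupp p -> (m ix2 == 0%N) && (m ix0 == i) ->
    (i <= n)%N /\ m = mon3 i (n - i) 0.
  rewrite mcoeff_msupp (mnm3_eq m) => /(dhomog_coeff hp).
  rewrite mdeg_mon3 !mon3E => dm /andP [/eqP e2 /eqP e0].
  by split; [lia|congr mon3; lia].
case: leqP => [le_in|lt_ni]; last first.
  rewrite big_seq big1 // => m mp; case: (boolP (_ && _)); rewrite ?mulr0 //.
  by case/(key m mp); lia.
set u := mon3 i (n - i) 0; have [up|nup] := boolP (u \in msupp p); last first.
  rewrite (memN_msupp_eq0 nup) big_seq big1 // => m mp.
  case: (boolP (_ && _)); rewrite ?mulr0 // => /(key m mp) [_ e].
  by rewrite -/u in e; rewrite -e mp in nup.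
rewrite (bigD1_seq u) ?msupp_uniq //= big_seq_cond big1 => [|m /andP [mp ne]].
  by rewrite !mon3E !eqxx mulr1 addr0.
case: (boolP (_ && _)); rewrite ?mulr0 // => /(key m mp) [_ e].
by rewrite e eqxx in ne.
Qed.

Lemma size_dehom p n : p \is n.-homog -> (size (dehom p) <= n.+1)%N.
Proof.
by move=> hp; apply/leq_sizeP => i lt_ni; rewrite (dehom_coef _ hp) leqNgt lt_ni.
Qed.

Definition rehom n f : {mpoly K[3]} :=
  \sum_(i < n.+1) f`_i *: 'X_[mon3 i (n - i) 0].

Lemma rehom_homog n f : rehom n f \is n.-homog.
Proof.
apply: rpred_sum => i _; apply: rpredZ; rewrite dhomogX /= mdeg_mon3.
by rewrite addn0 subnKC // -ltnS ltn_ord.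
Qed.

Lemma rehomK n f : (size f <= n.+1)%N -> dehom (rehom n f) = f.
Proof.
move=> sf; rewrite rmorph_sum; apply/polyP => i; rewrite coef_sum /=.
rewrite (eq_bigr (fun j : 'I_n.+1 => f`_j * (i == j)%:R)) => [|j _]; last first.
  by rewrite dehomZ dehomX coefZ coefXn.
have [lt_in|le_ni] := ltnP i n.+1.
  rewrite (bigD1 (Ordinal lt_in)) //= eqxx mulr1 big1 ?addr0 // => j ne.
  by rewrite eq_sym (negPf (_ : val j != i)) ?mulr0.
rewrite big1 => [|j _]; first by rewrite nth_default //; apply: leq_trans le_ni.
by rewrite gtn_eqF ?mulr0 //; apply: leq_trans (ltn_ord j) le_ni.
Qed.

Lemma dehom_eq0 p n : p \is n.-homog -> dehom p = 0 ->
  exists2 q, p = 'X_ix2 * q & q \is n.-1.-homog.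
Proof.
move=> hp p0; have [|q eq hq] := @monomial_div_homog _ _ U_(ix2)%MM p n hp.
  move=> m pm; rewrite lep1mP; apply: contraNneq pm => m2.
  have := congr1 (fun f : {poly K} => f`_(m ix0)) p0.
  rewrite coef0 (dehom_coef _ hp); have [//|pm] := eqVneq p@_m 0.
  have dm := dhomog_coeff hp pm; rewrite [in mdeg _](mnm3_eq m) mdeg_mon3 m2 in dm.
  have e : mon3 (m ix0) (n - m ix0) 0 = m.
    by rewrite [RHS]mnm3_eq m2; congr mon3; lia.
  by rewrite e ifT; [move/eqP; rewrite (negPf pm) | lia].
by exists q => //; rewrite mdeg1 subn1 in hq.
Qed.

End Dehomogenize.

Section UnivariateDecomposition.
Context {K : fieldType}.
Implicit Types (F G q u v al be ga ep : {poly K}).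

Lemma size_mulr_le F u delta N : size F = delta.+1 ->
  (size (u * F)%R <= N + delta)%N -> (size u <= N)%N.
Proof.
move=> sF; have [->|u0] := eqVneq u 0; first by rewrite size_poly0.
have F0 : F != 0 by rewrite -size_poly_gt0 sF.
by rewrite size_mul // sF addnS /= leq_add2r.
Qed.

Lemma size_sum_le u v N : (size u <= N)%N -> (size v <= N)%N -> (size (u + v)%R <= N)%N.
Proof.
by move=> su sv; apply: leq_trans (size_polyD _ _) _; rewrite geq_max su.
Qed.

Lemma size_prod_le u v a b N : (size u <= a)%N -> (size v <= b)%N ->
  (a + b <= N.+1)%N -> (size (u * v)%R <= N)%N.
Proof.
move=> su sv le_N; apply: leq_trans (size_polyMleq _ _) _.
by have := leq_trans (leq_add su sv) le_N; case: (size u + size v)%N.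
Qed.

Lemma bezout_remainder F G q delta : coprimep F G -> size F = delta.+1 ->
  exists u v, q = u * F + v * G /\ (size v <= delta)%N.
Proof.
move=> /Bezout_eq1_coprimepP [[a b] /= ab] sF.
exists (q * a + (q * b) %/ F * G), ((q * b) %% F); split; last first.
  by rewrite -ltnS -sF ltn_modp -size_poly_gt0 sF.
rewrite -[LHS]mulr1 -ab.
by rewrite {1}(_ : q * (a * F + b * G) = q * a * F + q * b * G);
  [rewrite {1}(divp_eq (q * b) F); ring | ring].
Qed.

Section Forms.
Context {F G : {poly K}} {delta : nat}.
Context (copFG : coprimep F G) (sF : size F = delta.+1).
Context (sG : (size G <= delta.+1)%N).

(** Two coprime binary forms of degree delta generate all forms from degree 2 delta - 1 on. Reducing
    the cofactor of [G] modulo [F] gives it size at most delta, which fits the bound from this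
    degree on; the size of u F = q - v G then bounds u. *)
Lemma uni_decomp q n : (size q <= n.+1)%N -> (2 * delta - 1 <= n)%N ->
  exists u v, [/\ q = u * F + v * G, (size u <= (n - delta).+1)%N &
    (size v <= (n - delta).+1)%N].
Proof.
move=> sq le_n; have [u [v [eq sv]]] := bezout_remainder q copFG sF.
have uF : u * F = q - v * G by rewrite eq addrK.
exists u, v; split=> //; last by apply: leq_trans sv _; lia.
have [lt_nd|le_dn] := ltnP n delta.
  have d0 : delta = 0%N by lia.
  apply: (size_mulr_le sF); rewrite uF d0 addn0.
  have -> : v = 0 by apply/eqP; rewrite -size_poly_leq0 -[0%N]d0.
  by rewrite mul0r subr0 subn0.
apply: (size_mulr_le sF); rewrite uF addSn subnK //.
apply: size_sum_le => //; rewrite size_polyN.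
by apply: (size_prod_le sv sG); lia.
Qed.

(* The determinant al * ep - be * ga represents the socle of K[x, y]/(F, G)
   inside the colon ideal (F, G) : (x, y^a). *)
Lemma uni_socle_decomp al be ga ep q :
  F = al * 'X + be -> G = ga * 'X + ep ->
  (size al <= delta)%N -> (size ga <= delta)%N ->
  (size be <= delta)%N -> (size ep <= delta)%N ->
  (0 < delta)%N -> (size q <= 2 * delta - 1)%N ->
  exists c u v, [/\ q = u * F + v * G + c *: (al * ep - be * ga),
    (size u <= delta - 1)%N & (size v <= delta - 1)%N].
Proof.
move=> eF eG sal sga sbe sep d0 sq; set D := al * ep - be * ga.
have [u0 [v0 [eD sv0]]] := bezout_remainder D copFG sF.
have [u1 [v1 [eq1 sv1]]] := bezout_remainder q copFG sF.
have [k ek] : exists k, delta = k.+1 by exists delta.-1; rewrite prednK.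
(* The coefficient of [v0] in degree delta - 1. If it vanished, X D = ep F - be G would yield the
   relation [eX], whose factor X v0 + be is too small to be a nonzero multiple of [F]; both sides
   vanish, and X divides [F] and [G]. *)
pose kap := v0`_k.
have kap0 : kap != 0.
  apply/negP => /eqP k0.
  have sv0' : (size v0 <= k)%N.
    apply/leq_sizeP => j; rewrite leq_eqVlt => /predU1P [<- //|lt_kj].
    by move/leq_sizeP: sv0; apply; rewrite ek.
  have e1 : 'X * D = ep * F - be * G by rewrite /D eF eG; ring.
  have eX : ('X * v0 + be) * G = (ep - 'X * u0) * F.
    rewrite mulrBl (_ : ep * F = 'X * D + be * G); last by rewrite e1 subrK.
    by rewrite eD; ring.
  have vb0 : 'X * v0 + be = 0.
    apply/eqP/negPn/negP => nz.
    have: F %| 'X * v0 + be.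
      by rewrite -(Gauss_dvdpl _ copFG) eX dvdp_mulIr.
    move/(dvdp_leq nz); rewrite sF leqNgt ltnS => /negP []; apply: size_sum_le => //.
    by apply: (@size_prod_le _ _ 2 k) => //; rewrite ?size_polyX // ek.
  have XF : 'X %| F.
    rewrite eF; have -> : be = - ('X * v0) by apply/eqP; rewrite -addr_eq0 addrC vb0.
    by rewrite dvdp_sub ?dvdp_mulIr ?dvdp_mulIl.
  have XG : 'X %| G.
    have: (ep - 'X * u0) * F = 0 by rewrite -eX vb0 mul0r.
    move/eqP; rewrite mulf_eq0 orbC -size_poly_leq0 sF /= subr_eq0 => /eqP e.
    by rewrite eG e dvdp_add ?dvdp_mulIr ?dvdp_mulIl.
  have := coprimepP _ _ copFG _ XF XG.
  by rewrite -size_poly_eq1 size_polyX.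
(* Subtracting this multiple of the representation of [D] removes the top coefficient of [v1]; the
   bound on the cofactor of [F] follows by comparing sizes. *)
have sv : (size (v1 - (v1`_k / kap) *: v0)%R <= k)%N.
  apply/leq_sizeP => j; rewrite leq_eqVlt coefB coefZ => /predU1P [<-|lt_kj].
    by rewrite -mulrA mulVf // mulr1 subrr.
  have out (v : {poly K}) : (size v <= delta)%N -> v`_j = 0.
    by move/leq_sizeP; apply; rewrite ek.
  by rewrite !out // mulr0 subr0.
exists (v1`_k / kap), (u1 - (v1`_k / kap) *: u0), (v1 - (v1`_k / kap) *: v0).
set c := v1`_k / kap in sv *; split; last by rewrite ek subn1.
  by rewrite eD eq1 -!mul_polyC; ring.
apply: (size_mulr_le sF).
have -> : (u1 - c *: u0) * F = q - (v1 - c *: v0) * G - c *: D.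
  by rewrite eD eq1 -!mul_polyC; ring.
have bnd (r s : {poly K}) : (size r <= delta)%N -> (size s <= delta)%N ->
    (size (r * s)%R <= delta - 1 + delta)%N.
  by move=> sr ss; apply: (size_prod_le sr ss); lia.
apply: size_sum_le; last first.
  rewrite size_polyN; apply: leq_trans (size_scale_leq _ _) _.
  by apply: size_sum_le; rewrite ?size_polyN bnd.
apply: size_sum_le; first by apply: leq_trans sq _; lia.
by rewrite size_polyN; apply: (size_prod_le sv sG); lia.
Qed.

End Forms.
End UnivariateDecomposition.

(** * Cancelling a variable modulo a smaller ideal *)

Section ColonStep.
Context {K : fieldType} {d : nat}.
Implicit Types (B V : set {mpoly K[d]}) (u v : {mpoly K[d]}) (z : 'I_d).

(** [B] stands for (f, g) in three variables and for (f) in two; [c] is the part of [r] not absorbed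
    by multiples of z, which every form of [V] multiplies into [B]. The coefficients in a
    representation of z u have degree n + 1 - delta, whence the bound on n. *)
Lemma colon_step z V B delta m0 : is_ideal B -> B `<=` ideal_gen V ->
  (forall v, V v -> v \is delta.-homog) -> (0 < m0)%N ->
  (forall n u, u \is n.-homog -> B ('X_z * u) -> B u) ->
  (forall m r, (m0 <= m)%N -> r \is m.-homog -> exists r' c,
    [/\ r' \is m.-1.-homog, forall v, V v -> B (v * c) &
      B (r - 'X_z * r' - c)]) ->
  forall n u, u \is n.-homog -> (m0 + delta <= n.+1)%N ->
    ideal_gen V ('X_z * u) -> ideal_gen V u.
Proof.
move=> idB BV homV m0_gt0 colonB decB n u hu le_n /ideal_gen_sum [s [Vs es]].
have idV : is_ideal (ideal_gen V) := is_ideal_gen V.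
have [_ BD BM] := idB; have [_ VD VM] := idV.
have hzu : 'X_z * u \is n.+1.-homog.
  by rewrite -[n.+1]add1n; apply: dhomogM => //; rewrite dhomogX /= mdeg1.
have {}es : 'X_z * u = \sum_(t <- s) pihomog mdeg (n.+1 - delta) t.1 * t.2.
  rewrite -(pihomog_dE hzu) es raddf_sum /= big_seq [RHS]big_seq.
  apply: eq_bigr => t /Vs /homV ht; apply: pihomogMl => //; lia.
suff [w [hw Vw Bw]] : exists w, [/\ w \is n.-homog, ideal_gen V w &
    B (\sum_(t <- s) pihomog mdeg (n.+1 - delta) t.1 * t.2 - 'X_z * w)].
  apply: (ideal_subr idV _ Vw); apply: BV; apply: (colonB n).
    by rewrite -scaleN1r; apply: rpredD => //; apply: rpredZ.
  by rewrite mulrBr es.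
elim: s Vs {es} => [|t s IHs] Vs.
  exists 0; rewrite big_nil mulr0 subr0; split; first exact: rpred0.
    by case: idV.
  by case: idB.
have [|w [hw Vw Bw]] := IHs; first by move=> x xs; apply: Vs; rewrite inE xs orbT.
have Vt : V t.2 by apply: Vs; rewrite mem_head.
have [|r' [c [hr' Vc Br]]] := decB (n.+1 - delta)%N _ _ (pihomogP _ _ t.1).
  by lia.
exists (r' * t.2 + w); split.
- apply: rpredD => //.
  have -> : n = ((n.+1 - delta).-1 + delta)%N by lia.
  exact: dhomogM hr' (homV _ Vt).
- by apply: VD => //; apply: VM; apply: sub_ideal_gen.
rewrite big_cons; set r := pihomog _ _ t.1 in Br *; set S := \sum_(_ <- s) _ in Bw *.
have -> : r * t.2 + S - 'X_z * (r' * t.2 + w) =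
  t.2 * (r - 'X_z * r' - c) + t.2 * c + (S - 'X_z * w) by ring.
by apply: (BD _ _ _ Bw); apply: BD; [apply: BM | apply: Vc].
Qed.

End ColonStep.

(** * Ideals of leading forms *)

Section LeadingForms.
Context {K : fieldType} {d : nat} {delta : nat} {T : nat -> 'X_{1..d} -> Prop}.
Context (psT : power_system delta T).
Implicit Types (J : set {mpoly K[d]}) (p q u v : {mpoly K[d]}).

(** One exponent and one inclusion are all that the lower bound uses, and in this form the property
    passes to the ideal of leading forms. *)
Definition weak_reduction J N : Prop :=
  [/\ is_ideal J, J `<=` monspan (T 1) &
      monspan (T N.+1) `<=` ideal_mul J (monspan (T N))].

Lemma reduction_weak J : is_reduction J (monspan (T 1)) ->
  exists N, weak_reduction J N.
Proof.
move=> [idJ JL [N redN]]; exists N; split=> //.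
by rewrite -(ideal_exp_monspan psT N.+1) -(ideal_exp_monspan psT N) redN.
Qed.

Lemma weak_reductionX J N m : weak_reduction J N -> T N.+1 m -> J 'X_[m].
Proof.
move=> [idJ _ red] Tm; apply: (ideal_mulSl idJ (J := monspan (T N))).
by apply: red; apply/monspanX.
Qed.

Definition lead_forms J : set {mpoly K[d]} := [set pihomog mdeg delta j | j in J].

Lemma lead_forms_homog J v : lead_forms J v -> v \is delta.-homog.
Proof. by move=> [j _ <-]; apply: pihomogP. Qed.

Lemma lead_forms_lin J u v c : is_ideal J -> lead_forms J u -> lead_forms J v ->
  lead_forms J (u + c *: v).
Proof.
move=> [_ JD JM] [j Jj <-] [j' Jj' <-]; exists (j + c%:MP * j').
  by apply: JD => //; apply: JM.
by rewrite mul_mpolyC pihomogD [pihomog _ _ (_ *: _)]linearZ.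
Qed.

(** A monomial of L^(N + 1) of least degree (N + 1) delta is a sum of products from J and L^N, whose
    factors start in degrees delta and N delta; its component in this degree involves only the
    leading forms of elements of [J]. *)
Lemma lead_forms_weak_reduction J N : weak_reduction J N ->
  weak_reduction (ideal_gen (lead_forms J)) N.
Proof.
move=> [idJ JL red]; split; first exact: is_ideal_gen.
  apply: ideal_gen_min => [|_ [j /JL Lj <-]]; last exact: pihomog_monspan.
  exact/monspan_ideal/(psys_up psT).
apply: monspan_min; first exact: is_ideal_mul.
move=> m /(psys_min_degree psT) [u [le_um du Tu]].
apply: (mem_ideal_divX (is_ideal_mul _ _) le_um).
have /red : monspan (T N.+1) ('X_[u] : {mpoly K[d]}) by apply/monspanX.
move=> /(ideal_mul_sum idJ) [s [sP es]].
have hu : 'X_[K, u] \is (delta + N * delta).-homog.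
  by rewrite dhomogX; apply/eqP; rewrite /= du mulSn.
rewrite -(pihomog_dE hu) es raddf_sum /=.
apply: ideal_sum_seq => [|t /sP [Jt Tt]]; first exact: is_ideal_mul.
have low M p : monspan (T M) p -> monspan (fun m => M * delta <= mdeg m)%N p.
  by apply: monspan_sub => ?; apply: (psys_mdeg psT).
rewrite pihomogM_low; last first.
- exact: low.
- by have := low _ _ (JL _ Jt); rewrite mul1n.
apply: mem_ideal_mul; last exact: pihomog_monspan.
by apply: sub_ideal_gen; exists t.1.
Qed.

(* Leading forms lift to J, with an error of higher degree. *)
Lemma monspan_sub_lead (P : 'X_{1..d} -> Prop) J n0 n1 : is_ideal J ->
  upclosed P -> (forall m, T 1 m <-> P m /\ (delta <= mdeg m)%N) ->
  J `<=` monspan (T 1) ->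
  (forall n u, (n0 <= n)%N -> u \is n.-homog -> monspan P u ->
     ideal_gen (lead_forms J) u) ->
  (forall m, P m -> (n1 <= mdeg m)%N -> J 'X_[m]) -> (delta <= n0)%N ->
  monspan (fun m => P m /\ (n0 <= mdeg m)%N) `<=` J.
Proof.
move=> idJ upP TP JL leadJ highJ le_dn0.
have idPn n : is_ideal (@monspan K d (fun m => P m /\ (n <= mdeg m)%N)).
  apply: monspan_ideal => m u le_mu [Pm nm].
  by split; [apply: upP Pm | apply: upclosed_mdeg nm].
(* [k] bounds the number of degrees left before [n1], from where on [J] contains everything. *)
have key k n p : (n0 <= n)%N -> (n1 <= n + k)%N ->
    monspan (fun m => P m /\ (n <= mdeg m)%N) p -> J p.
  elim: k n p => [|k IHk] n p le_n0 le_n1 Pp.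
    rewrite addn0 in le_n1; apply: monspan_min Pp => // m [Pm nm].
    by apply: highJ => //; apply: leq_trans nm.
  set u := pihomog mdeg n p.
  have Pu : monspan P u by apply: pihomog_monspan; apply: monspan_sub Pp => m [].
  have /ideal_gen_sum [s [sV eu]] := leadJ n u le_n0 (pihomogP _ _ _) Pu.
  suff [j Jj Pj] : exists2 j, J j & monspan (fun m => P m /\ (n.+1 <= mdeg m)%N) (u - j).
    apply: (ideal_subr idJ _ Jj); apply: (IHk n.+1); [lia|lia|].
    have -> : p - j = (p - u) + (u - j) by ring.
    case: (idPn n.+1) => _ + _; apply=> // m.
    rewrite mcoeffB mcoeff_pihomog; case: (mdeg m =P n) => [_|ne].
      by rewrite subrr eqxx.
    rewrite subr0 => /Pp [Pm nm]; split=> //; lia.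
  have {}eu : u = \sum_(t <- s) pihomog mdeg (n - delta) t.1 * t.2.
    transitivity (pihomog mdeg n u); first by rewrite pihomog_dE ?pihomogP.
    rewrite eu raddf_sum /=.
    rewrite big_seq [RHS]big_seq; apply: eq_bigr => t /sV /lead_forms_homog ht.
    by apply: pihomogMl => //; lia.
  rewrite eu; elim: s sV {eu} => [|t s IHs] sV.
    exists 0; first by case: idJ.
    by rewrite big_nil subr0; case: (idPn n.+1).
  have [|j Jj Pj] := IHs; first by move=> x xs; apply: sV; rewrite inE xs orbT.
  have [|j' Jj' ej'] := sV t; first by rewrite mem_head.
  pose r := pihomog mdeg (n - delta) t.1; exists (r * j' + j).
    by case: idJ => _ JD JM; apply: JD => //; apply: JM.
  rewrite big_cons -/r -ej'; set S := \sum_(_ <- s) _ in Pj *.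
  have -> : r * pihomog mdeg delta j' + S - (r * j' + j) =
    r * (pihomog mdeg delta j' - j') + (S - j) by ring.
  (* [j'] lies in L, so it has no terms below degree delta; its difference from its leading form
     starts in degree delta + 1, and the product with [r] in degree n + 1. *)
  have [_ addP mulP] := idPn n.+1; apply: addP => // m.
  rewrite -mcoeff_msupp => /msuppM_le /allpairsP [[m1 m2] /=].
  rewrite !mcoeff_msupp => -[/(dhomog_coeff (pihomogP _ _ _)) dm1 + ->].
  rewrite mcoeffB mcoeff_pihomog; case: (mdeg m2 =P delta) => [_|ne].
    by rewrite subrr eqxx.
  rewrite sub0r oppr_eq0 => /(JL _ Jj') /TP [Pm2 dm2].
  by split; [apply: upclosedD | rewrite mdegD; lia].
by move=> p; apply: (key n1) => //; apply: leq_addl.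
Qed.

End LeadingForms.

Lemma coefM_low (R : comNzRingType) (p q : {poly R}) a b :
  (forall i, (i < a)%N -> p`_i = 0) -> (forall i, (i < b)%N -> q`_i = 0) ->
  (p * q)`_(a + b) = p`_a * q`_b.
Proof.
move=> pa qb; rewrite coefM.
have lt_a : (a < (a + b).+1)%N by rewrite ltnS leq_addr.
rewrite (bigD1 (Ordinal lt_a)) //= addKn big1 ?addr0 // => i ne.
have [/pa ->|] := ltnP i a; first by rewrite mul0r.
rewrite leq_eqVlt => /orP [/eqP e|lt_ai].
  by case/eqP: ne; apply: val_inj; apply: esym.
by rewrite [X in _ * X]qb ?mulr0 //; have := ltn_ord i; lia.
Qed.

(** * Multiples of a power of z inside a reduction *)

Section Saturation.
Context {K : fieldType} {a delta : nat}.
Context (a_gt0 : (0 < a)%N) (le_ad : (a <= delta)%N).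
Local Notation R := {mpoly K[3]}.
Local Notation T := (@lexpow 1 a delta).
Implicit Types (p q : R) (u v c : {poly K}) (J : set R).

(* With x and y of weight a and 1, the elements of L^M have weight at least
   a * M over K[z]; the coefficient at 'X^(a * M) of wsubst u v p is the value at
   (x, y^a) = (u, v^a) of the part of weight a * M. *)
Definition wsubst u v : R -> {poly {poly K}} :=
  mmap (polyC \o polyC)
    (fun i : 'I_3 => nth 0 [:: u *: 'X^a; v *: 'X; 'X%:P] i).

HB.instance Definition _ u v := GRing.RMorphism.on (wsubst u v).

Lemma wsubstZ u v b p : wsubst u v (b *: p) = b%:P *: wsubst u v p.
Proof. by rewrite /wsubst mmapZ /= mul_polyC. Qed.

Lemma wsubstX u v i j k :
  wsubst u v 'X_[mon3 i j k] = (u ^+ i * v ^+ j * 'X^k) *: 'X^(a * i + j).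
Proof.
rewrite /wsubst mmapX /mmap1 !big_ord_recl big_ord0 !mnmE /= mulr1.
by rewrite -!mul_polyC !exprMn -exprM exprD !polyCM !polyC_exp; ring.
Qed.

Lemma wsubst_coef u v p t : (wsubst u v p)`_t = \sum_(m <- msupp p)
  p@_m *: (u ^+ m ix0 * v ^+ m ix1 * 'X^(m ix2)) *+ (a * m ix0 + m ix1 == t)%N.
Proof.
rewrite {1}(mpolyE p) rmorph_sum coef_sum; apply: eq_bigr => m _ /=.
rewrite wsubstZ [in LHS](mnm3_eq m) wsubstX !coefZ coefXn mul_polyC [t == _]eq_sym.
by rewrite mulr_natr -mnm3_eq scalerMnr.
Qed.

Lemma wsubst_low u v M p t : monspan (T M) p -> (t < a * M)%N ->
  (wsubst u v p)`_t = 0.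
Proof.
move=> Tp lt_t; rewrite wsubst_coef big_seq big1 // => m.
rewrite mcoeff_msupp => /Tp [_ le_aM]; case: eqP => // e.
  by move: le_aM; rewrite e leqNgt lt_t.
Qed.

(** The monomials of weight [a] are x z^k and y^a z^k; [xlead] and [ylead] are the coefficients in
    K[z] of x and of y^a. *)
Definition xlead p : {poly K} := (wsubst 1 0 p)`_a.
Definition ylead p : {poly K} := (wsubst 0 1 p)`_a.

Lemma wsubst_lead u v p : monspan (T 1) p ->
  (wsubst u v p)`_a = u * xlead p + v ^+ a * ylead p.
Proof.
move=> Tp; rewrite /xlead /ylead !wsubst_coef !mulr_sumr -big_split.
rewrite big_seq [RHS]big_seq; apply: eq_bigr => m; rewrite mcoeff_msupp /=.
move=> /Tp [_]; rewrite muln1; move: (m ix0) (m ix1) (m ix2) => i j k le_a.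
case: eqP => [e|_]; last by rewrite !mulr0n !mulr0 addr0.
rewrite !mulr1n -!scalerAr -scalerDr; congr (_ *: _).
have [[-> ->]|[-> ->]] : (i = 1 /\ j = 0 \/ i = 0 /\ j = a)%N.
- case: i e {le_a} => [|[|i]]; rewrite ?muln0 ?muln1 ?mulnS; lia.
- by rewrite !expr0 !expr1; ring.
- by rewrite !expr0 expr1n expr0n gtn_eqF //=; ring.
Qed.

Definition inz c : R := \sum_(i < size c) c`_i *: 'X_[mon3 0 0 i].

Lemma wsubst_inz u v c : wsubst u v (inz c) = c%:P.
Proof.
rewrite rmorph_sum /= -[in RHS](coefK c) poly_def rmorph_sum; apply: eq_bigr => i _.
by rewrite wsubstZ wsubstX muln0 !expr0 !mul1r alg_polyC -[LHS]mul_polyC -polyCM mul_polyC.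
Qed.

Lemma xleadD p q : xlead (p + q) = xlead p + xlead q.
Proof. by rewrite /xlead rmorphD coefD. Qed.

Lemma yleadD p q : ylead (p + q) = ylead p + ylead q.
Proof. by rewrite /ylead rmorphD coefD. Qed.

Lemma xlead_inz c p : xlead (inz c * p) = c * xlead p.
Proof. by rewrite /xlead rmorphM /= wsubst_inz coefCM. Qed.

Lemma ylead_inz c p : ylead (inz c * p) = c * ylead p.
Proof. by rewrite /ylead rmorphM /= wsubst_inz coefCM. Qed.

Lemma xlead_coef p k : (xlead p)`_k = p@_(mon3 1 0 k).
Proof.
rewrite /xlead wsubst_coef coef_sum [p in RHS]mpolyE raddf_sum /=.
apply: eq_bigr => m _; rewrite mcoeffZ mcoeffX (mnm3_eq m) !mon3E eq_mon3.
move: (m ix0) (m ix1) (m ix2) => i j t; rewrite coefMn coefZ expr1n mul1r.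
have [->|j0] := eqVneq j 0%N; last first.
  by rewrite expr0n (negPf j0) mul0r coef0 mulr0 mul0rn andbF mulr0.
rewrite expr0 mul1r addn0 coefXn [k == t]eq_sym.
have -> : (a * i == a)%N = (i == 1)%N by rewrite -{2}[a]muln1 eqn_pmul2l.
by case: (i == 1%N); rewrite ?mulr1n // mulr0n mulr0.
Qed.

Lemma ylead_coef p k : (ylead p)`_k = p@_(mon3 0 a k).
Proof.
rewrite /ylead wsubst_coef coef_sum [p in RHS]mpolyE raddf_sum /=.
apply: eq_bigr => m _; rewrite mcoeffZ mcoeffX (mnm3_eq m) !mon3E eq_mon3.
move: (m ix0) (m ix1) (m ix2) => i j t; rewrite coefMn coefZ expr1n mulr1.
have [->|i0] := eqVneq i 0%N; last first.
  by rewrite expr0n (negPf i0) mul0r coef0 !(mulr0, mul0rn).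
rewrite expr0 mul1r muln0 add0n coefXn [k == t]eq_sym.
by case: (j == a); rewrite ?mulr1n // mulr0n mulr0.
Qed.

Section Unimodular.
Context {J : set R} {N : nat}.
Context (redJ : weak_reduction (T := T) J N).

(** [w] lies in J L^N. The factors have weights at least a and a N, so their parts of these weights
    multiply; the values of the L^N factors lie in K[z] and are absorbed into a single element of
    [J]. *)
Lemma weak_reduction_lead u v w : monspan (T N.+1) w -> exists2 j, J j &
  u * xlead j + v ^+ a * ylead j = (wsubst u v w)`_(a * N.+1).
Proof.
have [idJ JL red] := redJ; have [J0 JD JM] := idJ.
move=> /red /(ideal_mul_sum idJ) [s [sP ->]].
elim: s sP => [|t s IHs] sP.
  exists 0 => //; rewrite big_nil /xlead /ylead !rmorph0 !coef0.
  by rewrite !mulr0 addr0.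
have [|j Jj ej] := IHs; first by move=> x xs; apply: sP; rewrite inE xs orbT.
have [Jt Tt] : J t.1 /\ monspan (T N) t.2 by apply: sP; rewrite mem_head.
exists (inz (wsubst u v t.2)`_(a * N) * t.1 + j).
  by apply: JD => //; apply: JM.
rewrite big_cons rmorphD coefD -ej rmorphM /= mulnS coefM_low.
- rewrite (wsubst_lead _ _ (JL _ Jt)) xleadD yleadD xlead_inz ylead_inz; ring.
- by move=> i lt_i; apply: wsubst_low (JL _ Jt) _; rewrite muln1.
- by move=> i; apply: wsubst_low Tt.
Qed.

(* The pairs (xlead j, ylead j), for j in J, form a submodule of K[z]^2 on which
   every unimodular linear form (u, v^a) takes a power of z as value; the forms
   (1, 0) and (- ylead j1, xlead j1) then suffice to produce multiples of both
   unit vectors. *)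
Lemma weak_reduction_unit_vectors : exists k jx jy,
  [/\ J jx, J jy, xlead jx = 'X^k /\ ylead jx = 0 &
      xlead jy = 0 /\ ylead jy = 'X^k].
Proof.
have [idJ JL _] := redJ; have [J0 JD JM] := idJ.
have Tx : monspan (T N.+1) ('X_[mon3 N.+1 0 ((delta - 1) * N.+1)] : R).
  by apply/monspanX; split; rewrite ?mdeg_mon3 ?mon3E; nia.
have Ty : monspan (T N.+1) ('X_[mon3 0 (a * N.+1) ((delta - a) * N.+1)] : R).
  by apply/monspanX; split; rewrite ?mdeg_mon3 ?mon3E; nia.
have [j0 Jj0] := weak_reduction_lead 1 0 Tx.
rewrite mul1r expr0n gtn_eqF // mul0r addr0 wsubstX addn0 coefZ coefXn eqxx.
rewrite expr1n expr0 !mul1r mulr1; set c := ((delta - 1) * N.+1)%N => xj0.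
(* With exponent a c the x-coefficient is the a-th power of z^c, as required of the second entry of
   the linear form (u, v^a) used next. *)
have [j1 Jj1 xj1] : exists2 j1, J j1 & xlead j1 = 'X^(a * c).
  exists (inz 'X^(c * a.-1) * j0); first exact: JM.
  by rewrite xlead_inz xj0 -exprD -mulnSr prednK // mulnC.
(* The value of this form at [j2] is the determinant of the leads of [j1] and [j2]; it is a power of
   z. *)
have [j2 Jj2] := weak_reduction_lead (- ylead j1) 'X^c Ty.
rewrite wsubstX muln0 add0n coefZ coefXn eqxx expr0 mul1r mulr1 -!exprM -exprD.
set e := (_ + _)%N => yj2.
have [j3 [Jj3 xj3 yj3]] : exists j3, [/\ J j3, xlead j3 = 0 & ylead j3 = 'X^e].
  exists (inz 'X^(a * c) * j2 + inz (- xlead j2) * j1); split.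
  - by apply: JD; apply: JM.
  - by rewrite xleadD !xlead_inz xj1; ring.
  - by rewrite yleadD !ylead_inz -yj2 [(c * a)%N]mulnC; ring.
exists (a * c + e)%N, (inz 'X^e * j1 + inz (- ylead j1) * j3), (inz 'X^(a * c) * j3).
split; first by apply: JD; apply: JM.
- exact: JM.
- by rewrite xleadD yleadD !xlead_inz !ylead_inz xj1 xj3 yj3 exprD; split; ring.
- by rewrite xlead_inz ylead_inz xj3 yj3 exprD mulr0.
Qed.

(** By the unit vectors, x z^k and y^a z^k lie in [J] up to errors in (x, y) I. Each further factor
    z^k raises the order of the error in x and y, until a last power of z moves it into L^(N +
    1). *)
Lemma weak_reduction_saturation : exists k, forall m : 'X_{1..3},
  (0 < m ix0)%N \/ (a <= m ix1)%N -> J 'X_[m + mon3 0 0 k].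
Proof.
have [idJ JL _] := redJ; have [J0 JD JM] := idJ.
have [k [jx [jy [Jjx Jjy [xjx yjx] [xjy yjy]]]]] := weak_reduction_unit_vectors.
(* The monomials of (x, y)^r I: those divisible by x need degree r + 1 in x and y, the others need
   y^(a + r). *)
pose Q r (m : 'X_{1..3}) := [/\ (0 < m ix0)%N \/ (a <= m ix1)%N,
  (0 < m ix0)%N -> (r < m ix0 + m ix1)%N &
  m ix0 = 0%N -> (a + r <= m ix1)%N].
have upQ r : upclosed (Q r).
  move=> m u /mnm_lepP le_mu [hm h1 h2]; have := le_mu ix0; have := le_mu ix1.
  by split; lia.
have errQ j i0 j0 : J j -> (a * i0 + j0 = a)%N ->
    xlead ('X_[mon3 i0 j0 k] - j) = 0 -> ylead ('X_[mon3 i0 j0 k] - j) = 0 ->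
    monspan (Q 1%N) ('X_[mon3 i0 j0 k] - j).
  move=> /JL Tj e0 x0 y0; apply: mnm3_ind => i' j' k' nz; rewrite /Q !mon3E.
  have ge_a : (a <= a * i' + j')%N.
    move: nz; rewrite mcoeffB mcoeffX; case: (mon3 i0 j0 k =P _) => [/mon3_inj|_].
      by case=> <- <- _ _; rewrite e0.
    by rewrite sub0r oppr_eq0 => /Tj [_]; rewrite muln1 !mon3E.
  have nx : (i', j') <> (1%N, 0%N).
    by case=> ei ej; move: nz; rewrite ei ej -xlead_coef x0 coef0 eqxx.
  have ny : (i', j') <> (0%N, a).
    by case=> ei ej; move: nz; rewrite ei ej -ylead_coef y0 coef0 eqxx.
  have [i0'|] := posnP i'.
    have : j' <> a by move=> ej; apply: ny; rewrite i0' ej.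
    by split; lia.
  case: i' nx ny ge_a {nz} => [//|[|i']] nx ny ge_a _; last by split; lia.
  have : j' <> 0%N by move=> ej; apply: nx; rewrite ej.
  by split; lia.
have xerr : monspan (Q 1%N) ('X_[mon3 1 0 k] - jx).
  apply: errQ => //; first by rewrite muln1 addn0.
    apply/polyP => t; rewrite xlead_coef mcoeffB -(xlead_coef jx) xjx coefXn coef0.
    by rewrite mcoeffX eq_mon3 /= eq_sym subrr.
  apply/polyP => t; rewrite ylead_coef mcoeffB -(ylead_coef jx) yjx coef0.
  by rewrite mcoeffX eq_mon3 /= subrr.
have yerr : monspan (Q 1%N) ('X_[mon3 0 a k] - jy).
  apply: errQ => //; first by rewrite muln0.
    apply/polyP => t; rewrite xlead_coef mcoeffB -(xlead_coef jy) xjy coef0.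
    by rewrite mcoeffX eq_mon3 /= subrr.
  apply/polyP => t; rewrite ylead_coef mcoeffB -(ylead_coef jy) yjy coefXn coef0.
  by rewrite mcoeffX eq_mon3 /= eqxx eq_sym subrr.
(* C r is J + (x, y)^r I, where I = (x, y^a); by xerr and yerr, multiplication
   by z^k maps (x, y)^r I into C r.+1. *)
pose C r : set R := [set p | exists2 j, J j & monspan (Q r) (p - j)].
have idC r : is_ideal (C r).
  have [Q0 QD QM] := monspan_ideal (K := K) (upQ r).
  split=> [|p q [j Jj Qj] [j' Jj' Qj']|b p [j Jj Qj]].
  - by exists 0; rewrite ?subr0.
  - exists (j + j'); first exact: JD.
    by rewrite opprD addrACA; apply: QD.
  - exists (b * j); first exact: JM.
    by rewrite -mulrBr; apply: QM.
have mulQ r (e : R) (m : 'X_{1..3}) : monspan (Q 1%N) e -> (r <= m ix0 + m ix1)%N ->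
    monspan (Q r.+1) (e * 'X_[m]).
  move=> Qe le_r u; rewrite -mcoeff_msupp => /msuppM_le /allpairsP [[m1 m2] /=].
  rewrite mcoeff_msupp msuppX inE => -[/Qe [hm h1 h2] /eqP -> ->].
  by rewrite /Q !mnmDE; split; lia.
have stepC r p : monspan (Q r) p -> C r.+1 ('X_[mon3 0 0 k] * p).
  have [C0 CD CM] := idC r.+1.
  apply: (@monspan_min _ _ (Q r) [set p | C r.+1 ('X_[mon3 0 0 k] * p)]).
    split=> [|q q' Cq Cq'|b q Cq] /=; first by rewrite mulr0.
      by rewrite mulrDr; apply: CD.
    by rewrite mulrCA; apply: CM.
  apply: mnm3_ind => i j t; rewrite /Q !mon3E => -[hm h1 h2] /=.
  rewrite -mpolyXD mon3D !add0n.
  have [i0|i_gt0] := posnP i.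
    exists (jy * 'X_[mon3 0 (j - a) t]); first by rewrite mulrC; apply: JM.
    rewrite (_ : mon3 i j (k + t) = (mon3 0 a k + mon3 0 (j - a) t)%MM).
      rewrite mpolyXD -mulrBl; apply: mulQ => //; rewrite !mon3E; lia.
    by rewrite mon3D; congr mon3; lia.
  exists (jx * 'X_[mon3 i.-1 j t]); first by rewrite mulrC; apply: JM.
  rewrite (_ : mon3 i j (k + t) = (mon3 1 0 k + mon3 i.-1 j t)%MM).
    rewrite mpolyXD -mulrBl; apply: mulQ => //; rewrite !mon3E; lia.
  by rewrite mon3D; congr mon3; lia.
have zD s t : mon3 0 0 (s + t) = (mon3 0 0 s + mon3 0 0 t)%MM by rewrite mon3D.
have iterC r p : monspan (Q 0%N) p -> C r ('X_[mon3 0 0 (r * k)] * p).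
  move=> Qp; elim: r => [|r [j Jj Qj]].
    by exists 0; rewrite // subr0 mul0n (_ : mon3 0 0 0 = 0%MM) ?mpolyX0 ?mul1r //;
      apply/mnmP; apply: forall_ord3; rewrite mon3E mnm0E.
  have [_ CD CM] := idC r.+1.
  rewrite mulSn zD mpolyXD -mulrA -[_ * p](subrK j) mulrDr; apply: CD; first exact: stepC.
  exists ('X_[mon3 0 0 k] * j); first exact: JM.
  by rewrite subrr; case: (monspan_ideal (K := K) (upQ r.+1)).
(* For this [r], elements of (x, y)^r I have weight at least a (N + 1); z^t supplies the degree (N +
   1) delta. *)
pose r := (a * N.+1)%N; pose t := (N.+1 * delta)%N.
have endC p : C r p -> J ('X_[mon3 0 0 t] * p).
  move=> [j Jj Qj]; rewrite -(subrK j p) mulrDr; apply: (JD); last exact: JM.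
  apply: (@monspan_min _ _ (Q r) [set p | J ('X_[mon3 0 0 t] * p)]) Qj.
    split=> [|q q' Cq Cq'|b q Cq] /=; first by rewrite mulr0.
      by rewrite mulrDr; apply: JD.
    by rewrite mulrCA; apply: JM.
  apply: mnm3_ind => i j' t'; rewrite /Q !mon3E => -[hm h1 h2] /=.
  rewrite -mpolyXD mon3D; apply: (weak_reductionX redJ).
  split; rewrite ?mdeg_mon3 ?mon3E; first by rewrite /t; lia.
  rewrite !add0n -/r; have [i0|i_gt0] := posnP i; first by rewrite i0; lia.
  by apply: (@leq_trans (i + j')); [lia | rewrite leq_add2r leq_pmull].
exists (t + r * k)%N => m Pm; rewrite addmC mpolyXD.
rewrite zD mpolyXD -mulrA.
apply/endC/iterC/monspanX; split=> //; lia.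
Qed.

End Unimodular.

End Saturation.

(** * Two forms that are coprime modulo z *)

Section FormPairs.
Context {K : fieldType} {delta : nat} {f g : {mpoly K[3]}}.
Local Notation R := {mpoly K[3]}.
Local Notation xyideal a :=
  (@monspan K 3 (fun m => (0 < m ix0)%N \/ (a <= m ix1)%N)).
Implicit Types (u r c : R).
Local Notation F := (dehom f).
Local Notation G := (dehom g).
Context (hf : f \is delta.-homog) (hg : g \is delta.-homog).
Context (sF : size F = delta.+1) (copFG : coprimep F G).

Definition pair_ideal : set R := [set p | exists b1 b2, p = b1 * f + b2 * g].

Lemma pair_ideal_ideal : is_ideal pair_ideal.
Proof.
split=> [|_ _ [b1 [b2 ->]] [c1 [c2 ->]]|b _ [b1 [b2 ->]]].
- by exists 0, 0; rewrite !mul0r addr0.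
- by exists (b1 + c1), (b2 + c2); ring.
- by exists (b * b1), (b * b2); ring.
Qed.

Lemma dehomXz : dehom ('X_ix2 : R) = 0.
Proof.
by rewrite (_ : U_(ix2)%MM = mon3 0 0 1) ?dehomX //;
  apply/mnmP; apply: forall_ord3; rewrite mon3E mnm1E.
Qed.

Lemma mulXz_inj : injective ( *%R ('X_ix2 : R)).
Proof. by apply: mulfI; rewrite -msize_poly_eq0 msizeX. Qed.

(* f and g form a regular sequence modulo z, so their syzygies are Koszul there. *)
Lemma pair_ideal_colon n u : u \is n.-homog ->
  pair_ideal ('X_ix2 * u) -> pair_ideal u.
Proof.
move=> hu [b1 [b2 e]].
have hzu : 'X_ix2 * u \is n.+1.-homog.
  by rewrite -[n.+1]add1n; apply: dhomogM => //; rewrite dhomogX /= mdeg1.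
have [lt_n|le_n] := ltnP n.+1 delta.
  have e0 : 'X_ix2 * u = 0.
    by rewrite -(pihomog_dE hzu) e pihomogD !(@pihomogMl_lt _ _ delta) // addr0.
  have -> : u = 0 by apply: mulXz_inj; rewrite e0 mulr0.
  by case: pair_ideal_ideal.
pose k := (n.+1 - delta)%N; pose c1 := pihomog mdeg k b1; pose c2 := pihomog mdeg k b2.
have {}e : 'X_ix2 * u = c1 * f + c2 * g.
  by rewrite -(pihomog_dE hzu) {1}e pihomogD !(@pihomogMl _ _ delta).
have [hc1 hc2] : c1 \is k.-homog /\ c2 \is k.-homog by split; apply: pihomogP.
have F0 : F != 0 by rewrite -size_poly_gt0 sF.
have e1 : dehom c1 * F + dehom c2 * G = 0.
  by rewrite -!rmorphM -rmorphD -e rmorphM /= dehomXz mul0r.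
have [h eh] : exists h, dehom c2 = h * F.
  apply/dvdpP; rewrite -(Gauss_dvdpl _ copFG).
  have -> : dehom c2 * G = - (dehom c1 * F) by apply/eqP; rewrite -addr_eq0 addrC e1.
  by rewrite dvdpNr dvdp_mulIr.
have eh1 : dehom c1 = - (h * G).
  apply: (mulIf F0); apply/eqP; rewrite -subr_eq0 -e1 eh; apply/eqP; ring.
(* Adding the Koszul syzygy (h' g, - h' f) to (c1, c2) keeps c1 f + c2 g and makes both coefficients
   divisible by z. *)
have [h' [eh' hf' hg']] : exists h', [/\ dehom h' = h, h' * f \is k.-homog &
    h' * g \is k.-homog].
  have sh : (size (h * F)%R <= k.+1)%N by rewrite -eh; apply: size_dehom.
  have [lt_k|le_k] := ltnP k delta.
    exists 0; rewrite !mul0r !rpred0; split=> //; rewrite rmorph0.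
    apply/esym/eqP; rewrite -size_poly_leq0.
    by apply: (size_mulr_le sF); apply: leq_trans sh _.
  exists (rehom (k - delta) h); rewrite rehomK.
    have hh := rehom_homog (k - delta) h.
    by have := dhomogM hh hf; have := dhomogM hh hg; rewrite subnK.
  by apply: (size_mulr_le sF); rewrite addSn subnK.
have [||q1 e2 _] := @dehom_eq0 _ (c1 + h' * g) k.
- exact: rpredD.
- by rewrite rmorphD rmorphM /= eh1 eh' addNr.
have [||q2 e3 _] := @dehom_eq0 _ (c2 - h' * f) k.
- by rewrite -scaleN1r; apply: rpredD => //; apply: rpredZ.
- by rewrite rmorphB rmorphM /= eh eh' subrr.
exists q1, q2; apply: mulXz_inj; rewrite e mulrDr !mulrA -e2 -e3; ring.
Qed.

Lemma pair_ideal_residue r u v c m : r \is m.+1.-homog ->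
    (delta <= m.+1)%N -> u \is (m.+1 - delta).-homog -> v \is (m.+1 - delta).-homog ->
    c \is m.+1.-homog -> dehom r = dehom u * F + dehom v * G + dehom c ->
  exists r', r' \is m.-homog /\ pair_ideal (r - 'X_ix2 * r' - c).
Proof.
move=> hr le_dm hu hv hc e.
have [||r' er hr'] := @dehom_eq0 _ (r - (u * f + v * g + c)) m.+1.
- rewrite -scaleN1r; apply: rpredD => //; apply: rpredZ; apply: rpredD => //.
  have hfu := dhomogM hu hf; have hgv := dhomogM hv hg.
  by rewrite subnK // in hfu hgv; apply: rpredD.
- by rewrite rmorphB !rmorphD !rmorphM /= e subrr.
by exists r'; split=> //; exists u, v; rewrite -er; ring.
Qed.

Lemma pair_ideal_decomp r m : (2 * delta - 1 <= m)%N -> (0 < m)%N -> r \is m.-homog ->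
  exists r', r' \is m.-1.-homog /\ pair_ideal (r - 'X_ix2 * r' - 0).
Proof.
move=> le_m m_gt0 hr; have [n en] : exists n, m = n.+1.
  by exists m.-1; rewrite prednK.
rewrite {m}en in le_m m_gt0 hr *.
have [u [v [e su sv]]] := uni_decomp copFG sF (size_dehom hg) (size_dehom hr) le_m.
apply: (@pair_ideal_residue _ (rehom (n.+1 - delta) u) (rehom (n.+1 - delta) v)) => //.
- lia.
- exact: rehom_homog.
- exact: rehom_homog.
- exact: rpred0.
- by rewrite !rehomK // rmorph0 addr0.
Qed.

Lemma xy_split a w : xyideal a w ->
  exists al be, w = 'X_ix0 * al + 'X_[mon3 0 a 0] * be /\
    forall n, w \is n.-homog -> al \is (n - 1).-homog /\ be \is (n - a).-homog.
Proof.
move=> /monspan_split [w1 [w2 [ew Pw1 Pw2]]].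
have [|al [e1 hal]] := @monomial_div _ _ U_(ix0)%MM w1.
  by move=> m /Pw1 [m0 _]; rewrite lep1mP -lt0n.
have [|be [e2 hbe]] := @monomial_div _ _ (mon3 0 a 0) w2.
  move=> m /Pw2 [m1 _]; apply/mnm_lepP; apply: forall_ord3; rewrite mon3E //.
exists al, be; split=> [|n hw]; first by rewrite ew e1 e2.
split; apply: dhomogIP.
- apply: hal => m /[dup] /Pw1 [m0 /(dhomog_coeff hw) dm] _.
  have le_m : (U_(ix0) <= m)%MM by rewrite lep1mP -lt0n.
  by move: dm; rewrite -{1}(submK le_m) mdegD mdeg1 => <-; rewrite addnK.
- apply: hbe => m /[dup] /Pw2 [m1 /(dhomog_coeff hw) dm] _.
  have le_m : (mon3 0 a 0 <= m)%MM.
    by apply/mnm_lepP; apply: forall_ord3; rewrite mon3E.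
  by move: dm; rewrite -{1}(submK le_m) mdegD mdeg_mon3 addn0 add0n => <-; rewrite addnK.
Qed.

Lemma dehom_xy a al be :
  dehom ('X_ix0 * al + 'X_[mon3 0 a 0] * be : R) = dehom al * 'X + dehom be.
Proof.
have -> : U_(ix0)%MM = mon3 1 0 0.
  by apply/mnmP; apply: forall_ord3; rewrite mon3E mnm1E.
by rewrite rmorphD !rmorphM /= !dehomX /= expr0 mul1r expr1 mulrC.
Qed.

Lemma pair_ideal_socle a r : (0 < a)%N -> (a <= delta)%N -> (1 < delta)%N ->
    xyideal a f ->
    xyideal a g ->
    r \is (2 * delta - 2).-homog ->
  exists r' c, [/\ r' \is (2 * delta - 2).-1.-homog,
    forall w, xyideal a w ->
      pair_ideal (w * c) &
    pair_ideal (r - 'X_ix2 * r' - c)].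
Proof.
move=> a_gt0 le_ad d_gt1.
have e1 : (2 * delta - 2 = delta - 1 + (delta - a) + a.-1)%N by lia.
have e2 : (2 * delta - 2 = (2 * delta - 3).+1)%N by lia.
have e3 : (2 * delta - 2 - delta).+1 = (delta - 1)%N by lia.
have e4 : (delta <= (2 * delta - 3).+1)%N by lia.
have e5 : (2 * delta - 2 < 2 * delta - 1)%N by lia.
have [d_gt0 lt1 lta] : [/\ 0 < delta, delta - 1 < delta & delta - a < delta]%N by split; lia.
move=> /xy_split [al [be [ef /(_ _ hf) [hal hbe]]]].
move=> /xy_split [ga [ep [eg /(_ _ hg) [hga hep]]]] hr.
(* [D] has degree 2 delta - 1 - a; the factor y^(a - 1), which dehomogenizes to 1, brings it to
   degree 2 delta - 2. *)
pose D := al * ep - be * ga; pose E := D * 'X_[mon3 0 a.-1 0].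
have hE : E \is (2 * delta - 2).-homog.
  have hX : 'X_[K, mon3 0 a.-1 0] \is (a.-1).-homog.
    by rewrite dhomogX /= mdeg_mon3 addn0.
  have hD : D \is (delta - 1 + (delta - a)).-homog.
    rewrite /D -scaleN1r; apply: rpredD; first exact: dhomogM.
    by apply: rpredZ; rewrite addnC; apply: dhomogM.
  by rewrite e1; apply: dhomogM.
(* Cramer's rule: x D = ep f - be g and y^a D = al g - ga f. *)
have killE w : xyideal a w ->
    pair_ideal (w * E).
  move=> /xy_split [al' [be' [-> _]]]; rewrite /E /D.
  set x := 'X_ix0; set y := 'X_[mon3 0 a 0]; set t := 'X_[_].
  exists ((al' * ep - be' * ga) * t), ((be' * al - al' * be) * t).
  by rewrite ef eg -/x -/y; ring.
have sizeh (p : R) n : p \is n.-homog -> (n < delta)%N -> (size (dehom p) <= delta)%N.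
  by move=> /size_dehom sp lt_n; apply: leq_trans sp _.
have eF : F = dehom al * 'X + dehom be by rewrite ef dehom_xy.
have eG : G = dehom ga * 'X + dehom ep by rewrite eg dehom_xy.
have [||||||k [u [v [e su sv]]]] := @uni_socle_decomp _ F G delta copFG sF
  (size_dehom hg) (dehom al) (dehom be) (dehom ga) (dehom ep) (dehom r) eF eG.
- exact: sizeh hal lt1.
- exact: sizeh hga lt1.
- exact: sizeh hbe lta.
- exact: sizeh hep lta.
- exact: d_gt0.
- exact: leq_trans (size_dehom hr) e5.
have eE : dehom E = dehom al * dehom ep - dehom be * dehom ga.
  by rewrite /E rmorphM rmorphB !rmorphM /= dehomX /= expr0 mulr1.
rewrite e2 in hr hE e3 *.
have [|||||r' [hr' pr']] := @pair_ideal_residue r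
  (rehom ((2 * delta - 3).+1 - delta) u) (rehom ((2 * delta - 3).+1 - delta) v)
  (k *: E) _ hr.
- exact: e4.
- exact: rehom_homog.
- exact: rehom_homog.
- exact: rpredZ.
- by rewrite !rehomK ?e3 // dehomZ eE.
exists r', (k *: E); split=> // w Pw.
case: pair_ideal_ideal => _ _ mulP.
by rewrite -mul_mpolyC mulrCA; apply: mulP; apply: killE.
Qed.

End FormPairs.

(** * Lower bound in three variables *)

Section LowerBound3.
Context {K : fieldType} {a delta : nat}.
Context (charK : [pchar K] =i pred0) (le_ad : (a <= delta)%N) (d_gt1 : (1 < delta)%N).
Local Notation R := {mpoly K[3]}.
Local Notation T := (@lexpow 1 a delta).
Local Notation xymon := (fun m : 'X_{1..3} => (0 < m ix0)%N \/ (a <= m ix1)%N).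
Implicit Types (J : set R) (m : 'X_{1..3}).

Lemma lexpow1P m : T 1 m <-> xymon m /\ (delta <= mdeg m)%N.
Proof.
rewrite /lexpow mul1n muln1; split=> [[dm am]|[Pm dm]]; split=> //.
  by case: (posnP (m ix0)) am => [->|]; [rewrite muln0; right | left].
by case: Pm; nia.
Qed.

Lemma upclosed_xymon : upclosed xymon.
Proof.
move=> m u /mnm_lepP le_mu [m0|m1]; [left|right].
  exact: leq_trans (le_mu ix0).
exact: leq_trans (le_mu ix1).
Qed.

Lemma saturation3 J N : weak_reduction (T := T) J N ->
  exists k, forall m, xymon m -> J 'X_[m + mon3 0 0 k].
Proof.
move=> redJ; have [a0|a_gt0] := posnP a; last first.
  exact: (weak_reduction_saturation a_gt0 le_ad redJ).
exists (N.+1 * delta)%N => m _; have [idJ _ _] := redJ.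
apply: (mem_ideal_divX idJ (lem_addl _ _)).
by apply: (weak_reductionX redJ); split; rewrite ?mdeg_mon3 ?a0.
Qed.

Lemma high_degree3 J N : weak_reduction (T := T) J N ->
  exists n1, forall m, xymon m -> (n1 <= mdeg m)%N -> J 'X_[m].
Proof.
move=> redJ; have [k Jk] := saturation3 redJ; exists (N.+1 * delta + k)%N.
apply: mnm3_ind => i j t; rewrite mdeg_mon3 !mon3E => Pm dm.
have [lt_t|le_t] := ltnP t k; last first.
  have -> : mon3 i j t = (mon3 i j (t - k) + mon3 0 0 k)%MM.
    by rewrite mon3D; congr mon3; lia.
  by apply: Jk; rewrite !mon3E.
apply: (weak_reductionX redJ); split; rewrite ?mdeg_mon3 ?mon3E; first lia.
have le_ij : (N.+1 * delta <= i + j)%N by lia.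
have [->|a_gt0] := posnP a; first by rewrite mul0n.
apply: (@leq_trans (N.+1 * delta)); first by rewrite mulnC leq_mul2l le_ad orbT.
by apply: leq_trans le_ij _; rewrite leq_add2r leq_pmull.
Qed.

(** A power of x in (V) forces some form to contain x^delta; its dehomogenization has full size, so
    no factor y is lost. A power of y in (V) dehomogenizes to 1, so no nonconstant polynomial
    divides all dehomogenizations, and a coprime partner can be selected. *)
Lemma lead_pair_exists J N : is_ideal J ->
  weak_reduction (T := T) (ideal_gen (lead_forms (delta := delta) J)) N ->
  exists f g, [/\ lead_forms (delta := delta) J f, lead_forms (delta := delta) J g,
    size (dehom f) = delta.+1 & coprimep (dehom f) (dehom g)].
Proof.
set V := lead_forms _ => idJ redV; have [idV _ _] := redV.
have le_aN : (a * N.+1 <= N.+1 * delta)%N by rewrite mulnC leq_mul2l le_ad orbT.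
have [f Vf sf] : exists2 f, V f & size (dehom f) = delta.+1.
  apply: contrapT => nex.
  have Vx v : V v -> v@_(mon3 delta 0 0) = 0.
    move=> Vv; apply/eqP/negPn/negP => nz; apply: nex; exists v => //.
    have hv := lead_forms_homog Vv.
    apply/eqP; rewrite eqn_leq size_dehom //= ltnNge; apply/negP => le_s.
    move/leq_sizeP: le_s => /(_ delta (leqnn _)).
    by rewrite (dehom_coef _ hv) leqnn subnn => /eqP; rewrite (negPf nz).
  pose Q (m : 'X_{1..3}) := (0 < m ix1)%N || (0 < m ix2)%N.
  have upQ : upclosed Q.
    move=> m u /mnm_lepP le_mu; have := le_mu ix1; have := le_mu ix2.
    by rewrite /Q => ? ? /orP []; lia.
  have sub : ideal_gen V `<=` monspan Q.
    apply: ideal_gen_min; first exact: monspan_ideal.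
    move=> v Vv; apply: mnm3_ind => i j t nz; rewrite /Q !mon3E.
    have := dhomog_coeff (lead_forms_homog Vv) nz; rewrite mdeg_mon3 => d.
    apply: contraNT nz; rewrite negb_or -!leqNgt !leqn0 => /andP [/eqP j0 /eqP t0].
    by rewrite j0 t0 (_ : i = delta) ?Vx //; lia.
  have : monspan Q ('X_[mon3 (N.+1 * delta) 0 0] : R).
    apply: sub; apply: (weak_reductionX redV); split; rewrite ?mdeg_mon3 ?mon3E.
      by rewrite !addn0.
    by rewrite addn0 leq_mul2l; apply/orP; right; apply: leq_pmulr; lia.
  by move/monspanX; rewrite /Q !mon3E.
have [|||D D1 _|G [g Vg eg] cop] := @coprimep_select _ charK
    (fun h => exists2 v, V v & dehom v = h) (dehom f).
- by rewrite -size_poly_gt0 sf.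
- move=> _ _ c [v Vv <-] [w Vw <-]; exists (v + c *: w).
    exact: lead_forms_lin.
  by rewrite rmorphD /= dehomZ.
- by exists (dehom f), f.
- apply: contrapT => nex.
  have Vd v : V v -> D %| dehom v.
    move=> Vv; apply/negPn/negP => nd; apply: nex; exists (dehom v) => //.
    by exists v.
  have sub : ideal_gen V `<=` [set p : R | D %| dehom p].
    apply: ideal_gen_min => // ; split=> [|p q Dp Dq|b p Dp] /=.
    - by rewrite rmorph0 dvdp0.
    - by rewrite rmorphD dvdp_add.
    - by rewrite rmorphM dvdp_mull.
  have : D %| dehom ('X_[mon3 0 (N.+1 * delta) 0] : R).
    apply: sub; apply: (weak_reductionX redV); split; rewrite ?mdeg_mon3 ?mon3E.
      by rewrite addn0.
    by rewrite muln0.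
  rewrite dehomX expr0 => /dvdp_leq; rewrite size_poly1 oner_eq0 => /(_ isT).
  by rewrite leqNgt D1.
by exists f, g; split=> //; rewrite eg.
Qed.

Definition core_degree3 : nat := 3 * delta - 2 - (0 < a)%N.

Lemma lead_forms_saturated J N n u : is_ideal J -> J `<=` monspan (T 1) ->
  weak_reduction (T := T) (ideal_gen (lead_forms (delta := delta) J)) N ->
  (core_degree3 <= n)%N -> u \is n.-homog -> monspan xymon u ->
  ideal_gen (lead_forms (delta := delta) J) u.
Proof.
move=> idJ JL redV le_n hu Pu; set V := lead_forms _.
have [f [g [Vf Vg sf cop]]] := lead_pair_exists idJ redV.
have [hf hg] : f \is delta.-homog /\ g \is delta.-homog.
  by split; [apply: lead_forms_homog Vf | apply: lead_forms_homog Vg].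
have [k Vk] := saturation3 redV; rewrite -/V in Vk.
have idV := is_ideal_gen V; have [V0 VD VM] := idV.
have Vxy v : V v -> monspan xymon v.
  move=> [j Jj <-]; apply: pihomog_monspan.
  by apply: monspan_sub (JL _ Jj) => m /lexpow1P [].
pose B := @pair_ideal K f g.
have BV : B `<=` ideal_gen V.
  by move=> _ [b1 [b2 ->]]; apply: VD; apply: VM; apply: sub_ideal_gen.
have step : forall n u, u \is n.-homog -> (core_degree3 <= n)%N ->
    ideal_gen V ('X_ix2 * u) -> ideal_gen V u.
  move=> n' u' hu' le_n'.
  apply: (@colon_step _ _ ix2 V B delta (2 * delta - 1 - (0 < a)%N) _ BV _ _ _ _ n').
  - exact: pair_ideal_ideal.
  - by move=> v; apply: lead_forms_homog.
  - by case: (0 < a)%N; lia.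
  - by move=> ? ?; apply: (pair_ideal_colon hf hg sf cop).
  - move=> m r le_m hr.
    have decomp : (2 * delta - 1 <= m)%N -> exists r' c,
       [/\ r' \is m.-1.-homog, forall v, V v -> B (v * c) & B (r - 'X_ix2 * r' - c)].
      move=> le_m'; have m_gt0 : (0 < m)%N by lia.
      have [r' [hr' Br']] := pair_ideal_decomp hf hg sf cop le_m' m_gt0 hr.
      exists r', 0; split=> // v _; rewrite mulr0.
      by case: (@pair_ideal_ideal _ f g).
    have [a0|a_gt0] := posnP a; first by apply: decomp; rewrite a0 subn0 in le_m.
    have [/decomp //|lt_m] := leqP (2 * delta - 1) m.
    have em : m = (2 * delta - 2)%N by move: le_m; rewrite a_gt0; lia.
    rewrite em in hr *.
    have [r' [c [hr' Pc Br']]] := pair_ideal_socle hf hg sf cop a_gt0 le_ad d_gt1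
      (Vxy _ Vf) (Vxy _ Vg) hr.
    by exists r', c; split=> // v /Vxy; apply: Pc.
  - exact: hu'.
  - by move: le_n'; rewrite /core_degree3; case: (0 < a)%N; lia.
have hX t (p : R) e : p \is e.-homog -> 'X_[mon3 0 0 t] * p \is (t + e).-homog.
  by move=> hp; apply: dhomogM => //; rewrite dhomogX /= mdeg_mon3.
have: ideal_gen V ('X_[mon3 0 0 k] * u).
  apply: (@monspan_min _ _ xymon [set p | ideal_gen V ('X_[mon3 0 0 k] * p)]) Pu.
    split=> [|p q Vp Vq|b p Vp] /=; first by rewrite mulr0.
      by rewrite mulrDr; apply: VD.
    by rewrite mulrCA; apply: VM.
  by move=> m /Vk /=; rewrite addmC mpolyXD.
elim: k {Vk} => [|k IHk].
  rewrite (_ : mon3 0 0 0 = 0%MM) ?mpolyX0 ?mul1r //.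
  by apply/mnmP; apply: forall_ord3; rewrite mon3E mnm0E.
have -> : mon3 0 0 k.+1 = (U_(ix2) + mon3 0 0 k)%MM.
  by apply/mnmP; apply: forall_ord3; rewrite mnmDE mnm1E !mon3E.
rewrite mpolyXD -mulrA => /(step _ _ (hX k u n hu)) hk; apply: IHk; apply: hk.
by apply: leq_trans le_n _; apply: leq_addl.
Qed.

Lemma core_lower3 J : is_reduction J (monspan (T 1)) ->
  monspan (fun m => xymon m /\ (core_degree3 <= mdeg m)%N) `<=` J.
Proof.
have psT := lexpow_power_system le_ad.
move=> /(reduction_weak psT) [N redJ]; have [idJ JL _] := redJ.
have [n1 Jn1] := high_degree3 redJ.
have redV := lead_forms_weak_reduction psT redJ.
apply: (@monspan_sub_lead _ _ delta T xymon J _ n1) => //.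
- exact: upclosed_xymon.
- exact: lexpow1P.
- by move=> n u le_n hu Pu; apply: lead_forms_saturated redV le_n hu Pu.
- by rewrite /core_degree3; case: (0 < a)%N; lia.
Qed.

End LowerBound3.

(** * Lower bound in two variables *)

Section LowerBound2.
Context {K : fieldType} {delta : nat} (d_gt0 : (0 < delta)%N).
Local Notation R := {mpoly K[2]}.
Local Notation T := (@lexpow 0 0 delta).
Implicit Types (J : set R) (p q : R).

(** On forms, evaluation at (1, 0) amounts to reduction modulo y; it replaces [dehom] now that a
    single form takes the place of the pair. *)
Definition ev10 : R -> K := meval (fun i : 'I_2 => (i == ix0)%:R).

HB.instance Definition _ := GRing.RMorphism.on ev10.

Lemma ev10X i j : ev10 'X_[mon2 i j] = (j == 0%N)%:R.
Proof.
rewrite /ev10 mevalX !big_ord_recl big_ord0 !mnmE /= !mulr1 expr1n mul1r.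
by case: j => [|j] //; rewrite exprS mul0r.
Qed.

Lemma ev10_eq0 p n : p \is n.-homog -> ev10 p = 0 ->
  exists2 q, p = 'X_ix1 * q & q \is n.-1.-homog.
Proof.
move=> hp p0; have [|q eq hq] := @monomial_div_homog _ _ U_(ix1)%MM p n hp.
  move=> m pm; rewrite lep1mP; apply/eqP => m1; move/eqP: p0; apply/negP.
  rewrite (mpolyE p) rmorph_sum /= (bigD1_seq m) ?msupp_uniq ?mcoeff_msupp //=.
  have ev (c : K) (m' : 'X_{1..2}) : ev10 (c *: 'X_[m']) = c * (m' ix1 == 0%N)%:R.
    by rewrite /ev10 mevalZ -/(ev10 _) {1}(mnm2_eq m') ev10X.
  rewrite ev m1 mulr1 big_seq_cond big1 ?addr0 // => u /andP [].
  rewrite mcoeff_msupp => pu ne; rewrite ev; case: (u ix1 =P 0%N) => [u1|_].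
    case/eqP: ne; rewrite (mnm2_eq u) (mnm2_eq m) u1 m1; congr mon2.
    have := dhomog_coeff hp pu; rewrite -(dhomog_coeff hp pm).
    by rewrite (mnm2_eq u) (mnm2_eq m) !mdeg_mon2 !mon2E u1 m1 !addn0.
  by rewrite mulr0.
by exists q => //; rewrite mdeg1 subn1 in hq.
Qed.

Lemma ev10Xz : ev10 'X_ix1 = 0.
Proof. by rewrite /ev10 mevalXU. Qed.

Lemma mulXy_inj : injective ( *%R ('X_ix1 : R)).
Proof. by apply: mulfI; rewrite -msize_poly_eq0 msizeX. Qed.

(** The variable y takes the role of z, and [B] is generated by one form [f] containing x^delta.
    Modulo f and y every form of degree at least delta vanishes, hence the bound delta + delta -
    1. *)
Lemma core_lower2 J : is_reduction J (monspan (T 1)) ->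
  monspan (fun m => 2 * delta - 1 <= mdeg m)%N `<=` J.
Proof.
have psT : power_system delta T := lexpow_power_system0 0 delta.
move=> /(reduction_weak psT) [N redJ]; have [idJ JL _] := redJ.
have redV := lead_forms_weak_reduction psT redJ.
set V := lead_forms J in redV; have [idV _ _] := redV; have [V0 VD VM] := idV.
have highT m : (N.+1 * delta <= mdeg m)%N -> T N.+1 m by move=> dm; split.
suff : monspan (fun m => True /\ 2 * delta - 1 <= mdeg m)%N `<=` J.
  by move=> sub; apply: subset_trans sub; apply: monspan_sub.
apply: (@monspan_sub_lead _ _ delta T (fun=> True) J _ (N.+1 * delta)) => //.
- by move=> m; rewrite /lexpow mul1n !mul0n; split=> [[]|[]].
- move=> n u le_n hu _; rewrite -/V.
  have [f Vf f0] : exists2 f, V f & ev10 f != 0.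
    apply: contrapT => nex.
    have sub : ideal_gen V `<=` [set p | ev10 p = 0].
      apply: ideal_gen_min => [|v Vv]; last first.
        by apply/eqP/negPn/negP => nz; apply: nex; exists v.
      split=> [|p q /= p0 q0|b p /= p0]; first by rewrite /= rmorph0.
        by rewrite rmorphD /= p0 q0 addr0.
      by rewrite rmorphM /= p0 mulr0.
    have: ev10 'X_[mon2 (N.+1 * delta) 0] = 0.
      apply: sub; apply: (weak_reductionX redV); apply: highT.
      by rewrite mdeg_mon2 addn0.
    by rewrite ev10X => /eqP; rewrite oner_eq0.
  have hf := lead_forms_homog Vf.
  pose B : set R := [set p | exists b, p = b * f].
  have idB : is_ideal B.
    split=> [|_ _ [b ->] [c ->]|b _ [c ->]]; first by exists 0; rewrite mul0r.
      by exists (b + c); rewrite mulrDl.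
    by exists (b * c); rewrite mulrA.
  have step : forall n u, u \is n.-homog -> (2 * delta - 1 <= n)%N ->
      ideal_gen V ('X_ix1 * u) -> ideal_gen V u.
    move=> n' u' hu' le_n'.
    apply: (@colon_step _ _ ix1 V B delta delta _ _ _ _ _ _ n') => //.
    + by move=> _ [b ->]; apply: VM; apply: sub_ideal_gen.
    + by move=> v; apply: lead_forms_homog.
    + move=> k w hw [b e].
      have hzw : 'X_ix1 * w \is k.+1.-homog.
        by rewrite -[k.+1]add1n; apply: dhomogM => //; rewrite dhomogX /= mdeg1.
      have [lt_k|le_k] := ltnP k.+1 delta.
        have -> : w = 0; last by case: idB.
        apply: mulXy_inj; rewrite mulr0 -(pihomog_dE hzw) e.
        by rewrite (pihomogMl_lt _ hf).
      have [|b' eb _] := @ev10_eq0 (pihomog mdeg (k.+1 - delta) b) _ (pihomogP _ _ _).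
        apply: (mulIf f0); rewrite mul0r -rmorphM /= -(pihomogMl _ hf le_k) -e.
        by rewrite pihomog_dE // rmorphM /= ev10Xz mul0r.
      exists b'; apply: mulXy_inj.
      by rewrite -(pihomog_dE hzw) e (pihomogMl _ hf le_k) eb mulrA.
    + move=> m r le_m hr; pose c := ev10 r / ev10 f.
      pose t := c *: ('X_[mon2 (m - delta) 0] * f).
      have ht : t \is m.-homog.
        apply: rpredZ; rewrite -{2}(subnK le_m); apply: dhomogM => //.
        by rewrite dhomogX /= mdeg_mon2 addn0.
      have [||r' er hr'] := @ev10_eq0 (r - t) m.
      * by rewrite -scaleN1r; apply: rpredD => //; apply: rpredZ.
      * rewrite rmorphB /= {2}/ev10 mevalZ -/(ev10 _) rmorphM /= ev10X mul1r.
        by rewrite /c divfK // subrr.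
      exists r', 0; split=> // [v _|]; first by rewrite mulr0; case: idB.
      rewrite -er subr0 subKr; exists (c *: 'X_[mon2 (m - delta) 0]).
      by rewrite -scalerAl.
    + by lia.
  have hX k (p : R) e : p \is e.-homog -> 'X_[mon2 0 k] * p \is (k + e).-homog.
    by move=> hp; apply: dhomogM => //; rewrite dhomogX /= mdeg_mon2.
  have: ideal_gen V ('X_[mon2 0 (N.+1 * delta)] * u).
    rewrite mulrC; apply: VM; apply: (weak_reductionX redV).
    by apply: highT; rewrite mdeg_mon2.
  elim: (N.+1 * delta)%N => [|k IHk].
    rewrite (_ : mon2 0 0 = 0%MM) ?mpolyX0 ?mul1r //.
    by apply/mnmP; apply: forall_ord2; rewrite mon2E mnm0E.
  have -> : mon2 0 k.+1 = (U_(ix1) + mon2 0 k)%MM.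
    by apply/mnmP; apply: forall_ord2; rewrite mnmDE mnm1E !mon2E.
  rewrite mpolyXD -mulrA => /(step _ _ (hX k u n hu)) hk; apply: IHk; apply: hk.
  by apply: leq_trans le_n _; apply: leq_addl.
- by move=> m _ dm; apply: (weak_reductionX redJ); apply: highT.
- by lia.
Qed.

End LowerBound2.

(** * Stability of L under triangular substitutions *)

Section StableIdeals.
Context {K : fieldType} {n : nat}.
Implicit Types (p : {mpoly K[n.+2]}) (P : 'X_{1..n.+2} -> Prop).

Lemma triang_stable_mdeg v (e : K) k p : monspan (fun m => k <= mdeg m)%N p ->
  monspan (fun m => k <= mdeg m)%N (p \mPo triang v e).
Proof.
move=> Pp m pm; rewrite leqNgt; apply/negP => lt_m; move/negP: pm; apply.
have := congr1 (mcoeff m) (pihomog_triang v e p (mdeg m)).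
rewrite mcoeff_pihomog eqxx => ->.
have -> : pihomog mdeg (mdeg m) p = 0; last by rewrite comp_mpoly0 mcoeff0.
apply/mpolyP => u; rewrite mcoeff_pihomog mcoeff0; case: (mdeg u =P _) => // du.
by apply/eqP/negPn/negP => /Pp; rewrite du leqNgt lt_m.
Qed.

Lemma triang_ideal (I : set {mpoly K[n.+2]}) v (e : K) P : is_ideal I ->
  (forall m, P m -> I ('X_[m] \mPo triang v e)) ->
  forall p, monspan P p -> I (p \mPo triang v e).
Proof.
move=> [I0 ID IM] PI; apply: (@monspan_min _ _ P [set p | I (p \mPo triang v e)]) => //.
split=> [|p q Ip Iq|b p Ip] /=; first by rewrite comp_mpoly0.
  by rewrite comp_mpolyD; apply: ID.
by rewrite rmorphM; apply: IM.
Qed.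

Lemma linear_power_xy (b c : K) t :
  monspan (fun m : 'X_{1..n.+2} => (0 < m ix0)%N \/ (t <= m ix1)%N)
    ((b *: 'X_ix1 + c *: 'X_ix0) ^+ t : {mpoly K[n.+2]}).
Proof.
elim: t => [|t IHt]; first by move=> m _; right.
rewrite exprSr => m; rewrite -mcoeff_msupp => /msuppM_le /allpairsP [[m1 m2] /= []].
rewrite !mcoeff_msupp mcoeffD !mcoeffZ !mcoeffX => /IHt [lt0|le_t] nz -> /=.
  by left; rewrite mnmDE addn_gt0 lt0.
move: nz; case: (U_(ix1)%MM =P m2) => [<- _|_]; last case: (U_(ix0)%MM =P m2) => [<- _|_].
- by right; rewrite mnmDE mnm1E eqxx addn1.
- by left; rewrite mnmDE mnm1E eqxx addn1.
- by rewrite !mulr0 addr0 eqxx.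
Qed.

(** x is sent to a multiple of itself, and y^a to the a-th power of a linear form in x and y, which
    lies in (x, y^a). *)
Lemma triang_stable_xy v (e : K) a p :
  monspan (fun m => (0 < m ix0)%N \/ (a <= m ix1)%N) p ->
  monspan (fun m => (0 < m ix0)%N \/ (a <= m ix1)%N) (p \mPo triang v e).
Proof.
set P := fun m : 'X_{1..n.+2} => _; have upP : upclosed P.
  move=> m u /mnm_lepP le_mu [m0|m1]; [left|right].
    exact: leq_trans (le_mu ix0).
  exact: leq_trans (le_mu ix1).
have idP := monspan_ideal (K := K) upP; have [_ _ IM] := idP.
have ix0E : ix0 = ord0 :> 'I_n.+2 by apply: val_inj.
apply: triang_ideal => // m [m0|m1].
  have le_m : (U_(ix0) <= m)%MM by rewrite lep1mP -lt0n.
  rewrite -(submK le_m) mpolyXD rmorphM; apply: IM => /=.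
  rewrite triangX ix0E eqxx scale0r add0r => u; rewrite mcoeffZ mcoeffX.
  case: (U_(ord0)%MM =P u) => [<- _|_]; last by rewrite mulr0 eqxx.
  by left; rewrite mnm1E -ix0E eqxx.
have le_m : (U_(ix1) *+ a <= m)%MM.
  apply/mnm_lepP => i; rewrite mulmnE mnm1E; case: eqP => [<-|]; last by rewrite mul0n.
  by rewrite mul1n.
rewrite -(submK le_m) mpolyXD rmorphM; apply: IM => /=.
rewrite -mpolyXn rmorphXn /= triangX /= -ix0E; exact: linear_power_xy.
Qed.

End StableIdeals.

Lemma ideal_gen_wsum (K : fieldType) n (N : 'X_{1..n} -> nat) (S : set {mpoly K[n]}) :
  (forall p, S p -> forall m, wsum N ('X_[m] * p) = 0) ->
  forall p, ideal_gen S p -> wsum N p = 0.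
Proof.
move=> S0 p /ideal_gen_sum [s [sS ->]]; rewrite wsum_sum big_seq big1 // => t /sS.
by move=> /S0 t0; apply: wsum_mull_eq0.
Qed.

Lemma wsumB (K : fieldType) n (N : 'X_{1..n} -> nat) (p q : {mpoly K[n]}) :
  wsum N (p - q) = wsum N p - wsum N q.
Proof. by rewrite wsumD -scaleN1r wsumZ mulN1r. Qed.

Lemma reduction_monspan (K : fieldType) d delta (T : nat -> 'X_{1..d} -> Prop)
    (J : set {mpoly K[d]}) M0 : power_system delta T -> is_ideal J ->
  J `<=` monspan (T 1) ->
  (forall M m, (M0 <= M)%N -> T M.+1 m -> ideal_mul J (monspan (T M)) 'X_[m]) ->
  is_reduction J (monspan (T 1)).
Proof.
move=> psT idJ JL red; split=> //; exists M0 => M le_M.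
have E1 := @ideal_exp_monspan K _ _ _ psT M.+1.
have E2 := @ideal_exp_monspan K _ _ _ psT M.
rewrite eqEsubset; split; last by rewrite ideal_expS; apply: ideal_mul_mono.
rewrite E1 E2; apply: monspan_min; first exact: is_ideal_mul.
by move=> m; apply: red.
Qed.

(** * Upper bound in two variables *)

Section Reduction2.
Context {K : fieldType} {delta : nat} (d_gt0 : (0 < delta)%N).
Local Notation T := (@lexpow 0 0 delta).

(** The second generator rewrites x^delta to x^(delta - 1) y, which shifts exponents from x to y
    until y^delta divides the monomial or only x^(delta - 1) is left. *)
Definition red2_gens : set {mpoly K[2]} :=
  [set 'X_[mon2 0 delta]; 'X_[mon2 delta 0] - 'X_[mon2 delta.-1 1]].

Lemma red2_reduction : is_reduction (ideal_gen red2_gens) (monspan (T 1)).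
Proof.
have psT : power_system delta T := lexpow_power_system0 0 delta.
have Tdeg M m : (M * delta <= mdeg m)%N -> T M m by move=> dm; split.
apply: (reduction_monspan (M0 := 1) psT); first exact: is_ideal_gen.
  have idT := monspan_ideal (K := K) (psys_up psT (M := 1)).
  apply: ideal_gen_min => // _ [] ->; first by apply/monspanX/Tdeg; rewrite mdeg_mon2; lia.
  by apply: (idealB idT); apply/monspanX/Tdeg; rewrite mdeg_mon2; lia.
move=> M m M1; move: m; apply: mnm2_ind; set J := ideal_gen _.
have idI := is_ideal_mul J (@monspan K 2 (T M)); have [_ ID _] := idI.
elim=> [|i IHi] j [dm _]; rewrite mdeg_mon2 in dm.
all: have [le_j|lt_j] := leqP delta j.
all: try (rewrite -[X in mon2 X _](add0n _) -(subnKC le_j) -mon2D mpolyXD;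
  apply: mem_ideal_mul; [by apply: sub_ideal_gen; left|];
  by apply/monspanX/Tdeg; rewrite mdeg_mon2; lia).
  nia.
have le_i : (delta <= i.+1)%N by nia.
apply: (ideal_subr (y := 'X_[mon2 i j.+1]) idI); last first.
  by apply: IHi; apply: Tdeg; rewrite mdeg_mon2; lia.
have -> : 'X_[mon2 i.+1 j] - 'X_[mon2 i j.+1] =
    ('X_[mon2 delta 0] - 'X_[mon2 delta.-1 1]) * 'X_[mon2 (i.+1 - delta) j]
    :> {mpoly K[2]}.
  rewrite mulrBl -!mpolyXD !mon2D; congr ('X_[mon2 _ _] - 'X_[mon2 _ _]); lia.
apply: mem_ideal_mul; first by apply: sub_ideal_gen; right.
by apply/monspanX/Tdeg; rewrite mdeg_mon2; nia.
Qed.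

(** The coefficient of x^(delta - 1) y^(delta - 1) modulo [red2_gens]: in degree 2 delta - 2 a
    monomial is rewritten to it unless y^delta divides it. *)
Definition weight2 (m : 'X_{1..2}) : nat :=
  [&& delta.-1 <= m ix0, m ix1 <= delta.-1 & m ix0 + m ix1 == 2 * delta - 2]%N.

Lemma core_upper2 : [pchar K] =i pred0 ->
  core (@monspan K 2 (T 1)) `<=` monspan (fun m => 2 * delta - 2 < mdeg m)%N.
Proof.
move=> charK; apply: (core_sub_mdeg (N := weight2) charK) red2_reduction _ _ _.
- move=> v e p Tp m pm; split=> //; rewrite mul1n.
  by apply: (triang_stable_mdeg (k := delta)) pm => u /Tp []; rewrite mul1n.
- apply: ideal_gen_wsum => p [] -> m; last rewrite mulrBr wsumB.
    rewrite -mpolyXD wsumX (mnm2_eq m) mon2D (_ : weight2 _ = 0%N) //.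
    by rewrite /weight2 !mon2E; case: and3P => // -[]; lia.
  rewrite -!mpolyXD !wsumX (mnm2_eq m) !mon2D.
  move: (m ix0) (m ix1) => i j; apply/eqP; rewrite subr_eq0; apply/eqP.
  congr (_%:R); rewrite /weight2 !mon2E.
  by congr (nat_of_bool _); apply/and3P/and3P => -[]; split; lia.
- move=> m; rewrite /weight2 [in mdeg _](mnm2_eq m) mdeg_mon2.
  by case: and3P => // -[_ _ /eqP].
- rewrite /weight2 !mulmnE !mnm1E /= !mul1n mul0n addn0 eqxx andbT.
  by have -> : (delta.-1 <= 2 * delta - 2)%N by lia.
Qed.

End Reduction2.

(** * Upper bound in three variables *)

Section Reduction3.
Context {K : fieldType} {a delta : nat} (le_ad : (a <= delta)%N) (d_gt1 : (1 < delta)%N).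
Local Notation T := (@lexpow 1 a delta).
Local Notation xymon := (fun m : 'X_{1..3} => (0 < m ix0)%N \/ (a <= m ix1)%N).
Local Notation b := (nat_of_bool (0 < a)%N).

Definition red3_form : {mpoly K[3]} :=
  'X_[mon3 delta 0 0] - 'X_[mon3 delta.-1 1 0] - 'X_[mon3 delta.-1 0 1]
  - 'X_[mon3 0 a (delta - a)].

Definition red3_gens : set {mpoly K[3]} :=
  [set 'X_[mon3 b 0 (delta - b)]; 'X_[mon3 0 delta 0]; red3_form].

(** Induction on the exponent of x: [red3_form] lowers a high power of x, and the monomial
    generators absorb high powers of y and, if a = 0 or x is present, of z. When a > 0, x-free
    monomials of small y-exponent escape these rules; there [red3_form] is read backwards, its last
    term being exchanged for multiples of x. *)
Lemma red3_monomial M i j k : (2 * delta <= M)%N -> T M.+1 (mon3 i j k) ->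
  ideal_mul (ideal_gen red3_gens) (monspan (T M)) 'X_[mon3 i j k].
Proof.
set J := ideal_gen _; set I := ideal_mul J _ => le_M.
have idI : is_ideal I := is_ideal_mul _ _; have [_ ID _] := idI.
have TE N i' j' k' : T N (mon3 i' j' k') <->
    (N * delta <= i' + j' + k')%N /\ (a * N <= a * i' + j')%N.
  by rewrite /lexpow mdeg_mon3 !mon3E.
have mulJ p i' j' k' : red3_gens p -> T M (mon3 i' j' k') ->
    I (p * 'X_[mon3 i' j' k']).
  by move=> Jp Tm; apply: mem_ideal_mul; [apply: sub_ideal_gen | apply/monspanX].
have rulex i' j' k' : (b <= i')%N -> (delta - b <= k')%N ->
    T M (mon3 (i' - b) j' (k' - (delta - b))) -> I 'X_[mon3 i' j' k'].
  move=> le_i le_k Tm; have /mulJ /(_ Tm) : red3_gens 'X_[mon3 b 0 (delta - b)].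
    by left; left.
  by rewrite -mpolyXD mon3D !subnKC.
have ruley i' j' k' : (delta <= j')%N -> T M (mon3 i' (j' - delta) k') ->
    I 'X_[mon3 i' j' k'].
  move=> le_j Tm; have /mulJ /(_ Tm) : red3_gens 'X_[mon3 0 delta 0] by left; right.
  by rewrite -mpolyXD mon3D !subnKC.
have ruleG i' j' k' : T M (mon3 i' j' k') ->
    I ('X_[mon3 (delta + i') j' k'] - 'X_[mon3 (delta.-1 + i') j'.+1 k']
       - 'X_[mon3 (delta.-1 + i') j' k'.+1] - 'X_[mon3 i' (a + j') (delta - a + k')]).
  move=> Tm; have /mulJ /(_ Tm) : red3_gens red3_form by right.
  by rewrite /red3_form !mulrBl -!mpolyXD !mon3D.
have [D eD] : exists D, D = (M * delta)%N by eexists.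
have [A eA] : exists A, A = (a * M)%N by eexists.
have leD : (2 * M <= D)%N by rewrite eD mulnC leq_mul2l d_gt1 orbT.
have TM i' j' k' : (D <= i' + j' + k')%N -> (A <= a * i' + j')%N ->
    T M (mon3 i' j' k') by rewrite eD eA => h1 h2; apply/TE.
have TS i' j' k' : (delta + D <= i' + j' + k')%N -> (a + A <= a * i' + j')%N ->
    T M.+1 (mon3 i' j' k').
  by rewrite eD eA => h1 h2; apply/TE; rewrite mulSn mulnS.
have TSE i' j' k' : T M.+1 (mon3 i' j' k') ->
    (delta + D <= i' + j' + k')%N /\ (a + A <= a * i' + j')%N.
  by move/TE; rewrite mulSn mulnS eD eA.
have [n] := ubnP i; elim: n i j k => // n IHn i j k lt_in /TSE [dm am].
have descend : (delta <= i)%N -> (A <= a * (i - delta) + j)%N -> I 'X_[mon3 i j k].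
  move=> le_i am'; have Tm : T M (mon3 (i - delta) j k) by apply: TM => //; lia.
  have gt_i : (0 < i)%N by lia.
  have := ruleG _ _ _ Tm; rewrite subnKC // => hG.
  apply: (ideal_subr idI (y := 'X_[mon3 (delta.-1 + (i - delta)) j.+1 k])); last first.
    by apply: IHn; [lia|apply: TS; [lia|nia]].
  apply: (ideal_subr idI (y := 'X_[mon3 (delta.-1 + (i - delta)) j k.+1])); last first.
    by apply: IHn; [lia|apply: TS; [lia|nia]].
  apply: (ideal_subr idI hG); apply: IHn; [lia|apply: TS; lia].
have [a0|a_gt0] := posnP a.
  have b0 : b = 0%N by rewrite a0.
  have [le_k|lt_k] := leqP delta k.
    by apply: rulex; rewrite ?b0 //; [lia|apply: TM; rewrite ?a0 ?eA ?a0; lia].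
  have [le_j|lt_j] := leqP delta j.
    by apply: ruley => //; apply: TM; rewrite ?eA ?a0; lia.
  by apply: descend; rewrite ?eA ?a0; lia.
have b1 : b = 1%N by rewrite a_gt0.
(* For a < delta, the least degree [D] in L^M exceeds the least weight [A] by at least [M], which
   outweighs a z-exponent below delta. For a = delta there is no such excess. *)
have A_le : (A + M * (a < delta) <= D)%N.
  rewrite eA eD; case: ltnP => [lt_ad|_]; last by rewrite muln0 addn0 mulnC leq_mul2l le_ad orbT.
  by rewrite muln1 mulnC -mulnSr leq_mul2l lt_ad orbT.
have ruleX i' j' k' : (0 < i')%N -> (delta.-1 <= k')%N ->
    (delta + D <= i' + j' + k')%N -> (a + A <= a * i' + j')%N -> I 'X_[mon3 i' j' k'].
  move=> i'0 le_k h1 h2; apply: rulex; rewrite b1; [lia|lia|apply: TM; first lia].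
  by rewrite mulnBr muln1; have := leq_pmulr a i'0; lia.
have ai : (i <= a * i)%N by apply: leq_pmull.
have [le_k|lt_k] := leqP delta.-1 k; last first.
  have [le_j|lt_j] := leqP delta j; last first.
    have le_Mi : (M <= i - delta)%N by lia.
    apply: descend; first lia.
    by rewrite eA; apply: leq_trans (leq_addr _ _); rewrite leq_mul2l le_Mi orbT.
  apply: ruley => //; apply: TM; first lia.
  case: (ltnP a delta) A_le => [_|le_da]; rewrite ?muln1 ?muln0; first lia.
  have ea : a = delta by apply/eqP; rewrite eqn_leq le_ad.
  have [i0|i_gt0] := posnP i; first by move: am; rewrite i0; lia.
  have : (i + delta.-1 <= a * i)%N by rewrite ea; nia.
  lia.
have [i0|i_gt0] := posnP i; last exact: ruleX.
rewrite i0 muln0 add0n in dm am *.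
have [le_j|lt_j] := leqP (A + delta) j.
  by apply: ruley; [lia|apply: TM; lia].
have le_Mk : (2 * delta <= k)%N.
  by case: (ltnP a delta) A_le => le_da; rewrite ?muln1 ?muln0; lia.
(* The backward use of [red3_form]: its other three terms contain x and still leave a large power of
   z, so that [ruleX] applies. *)
have Tm : T M (mon3 0 (j - a) (k - (delta - a))) by apply: TM; [lia|rewrite muln0; lia].
have [le_aj le_ak] : (a <= j)%N /\ (delta - a <= k)%N by lia.
have := ruleG _ _ _ Tm; rewrite !addn0 (subnKC le_aj) (subnKC le_ak) => hG.
have a2 : (a + a <= a * delta)%N by rewrite addnn -muln2 leq_mul2l d_gt1 orbT.
have a1 : (a <= a * delta.-1)%N by apply: leq_pmulr; lia.
have h1 : I 'X_[mon3 delta (j - a) (k - (delta - a))] by apply: ruleX; lia.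
have h2 : I 'X_[mon3 delta.-1 (j - a).+1 (k - (delta - a))] by apply: ruleX; lia.
have h3 : I 'X_[mon3 delta.-1 (j - a) (k - (delta - a)).+1] by apply: ruleX; lia.
by have := idealB idI (idealB idI (idealB idI h1 h2) h3) hG; rewrite subKr.
Qed.

Lemma red3_reduction : is_reduction (ideal_gen red3_gens) (monspan (T 1)).
Proof.
have psT : power_system delta T := lexpow_power_system le_ad.
apply: (reduction_monspan (M0 := 2 * delta) psT); first exact: is_ideal_gen.
  have idT := monspan_ideal (K := K) (psys_up psT (M := 1)).
  have TX i j k : (delta <= i + j + k)%N -> (0 < i)%N || (a <= j)%N ->
      monspan (T 1) ('X_[mon3 i j k] : {mpoly K[3]}).
    move=> dm /orP hij; apply/monspanX/(lexpow1P le_ad d_gt1).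
    by rewrite mdeg_mon3 !mon3E.
  apply: ideal_gen_min => // _ [[->|->]|->].
  - by apply: TX; case: (posnP a) => a0 /=; lia.
  - by apply: TX; rewrite ?le_ad ?orbT // addn0.
  apply: (idealB idT); last by apply: TX; lia.
  apply: (idealB idT); last by apply: TX; lia.
  by apply: (idealB idT); apply: TX; lia.
by move=> M m le_M; move: m; apply: mnm3_ind => i j k; apply: red3_monomial.
Qed.

(* The functional with weights weight3 is, in the quotient of K[x, y, z] by y^delta,
   z^(delta - b) and the monic polynomial red3_form in x, the coefficient of
   x^(delta - 1) y^(delta - 1) z^(delta - b - 1): the rewriting rule
   x^delta -> x^(delta - 1) (y + z) + y^a z^(delta - a) has nonnegative
   coefficients, so no cancellation can occur. *)
Fixpoint weight3_rec s i j k : nat :=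
  if (delta <= j)%N || (delta - b <= k)%N then 0%N
  else if (i < delta)%N then
    nat_of_bool [&& i == delta.-1, j == delta.-1 & k == (delta - b).-1]
  else if s is s'.+1 then
    (weight3_rec s' i.-1 j.+1 k + weight3_rec s' i.-1 j k.+1 +
     weight3_rec s' (i - delta) (j + a) (k + (delta - a)))%N
  else 0%N.

(** [s] is fuel: each rewriting lowers the exponent of x, so all values from [i] on give the same
    result. *)
Lemma weight3_recE s s' i j k : (i <= s)%N -> (i <= s')%N ->
  weight3_rec s i j k = weight3_rec s' i j k.
Proof.
elim: s s' i j k => [|s IHs] [|s'] i j k le_is le_is' //=.
- by case: ifP => // _; case: ifP => //; lia.
- by case: ifP => // _; case: ifP => //; lia.
case: ifP => // _; case: ltnP => // le_di.
by congr (_ + _ + _)%N; apply: IHs; lia.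
Qed.

Definition weight3 (m : 'X_{1..3}) : nat :=
  weight3_rec (m ix0) (m ix0) (m ix1) (m ix2).

Lemma weight3E i j k : weight3 (mon3 i j k) = weight3_rec i i j k.
Proof. by rewrite /weight3 !mon3E. Qed.

Lemma weight3_0 i j k : (delta <= j)%N || (delta - b <= k)%N ->
  weight3 (mon3 i j k) = 0%N.
Proof. by rewrite weight3E; case: i => [|i] /= ->. Qed.

Lemma weight3_lt i j k : (i < delta)%N -> (j < delta)%N -> (k < delta - b)%N ->
  weight3 (mon3 i j k) = [&& i == delta.-1, j == delta.-1 & k == (delta - b).-1].
Proof.
move=> lt_i lt_j lt_k; rewrite weight3E.
by case: i lt_i => [|i] lt_i; rewrite /= lt_i (leqNgt delta) lt_j leqNgt lt_k.
Qed.

Lemma weight3_rule i j k : weight3 (mon3 (delta + i) j k) =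
  (weight3 (mon3 (delta.-1 + i) j.+1 k) + weight3 (mon3 (delta.-1 + i) j k.+1) +
   weight3 (mon3 i (a + j) (delta - a + k)))%N.
Proof.
have [jk|jk] := boolP ((delta <= j)%N || (delta - b <= k)%N).
  by rewrite !weight3_0 //; case/orP: jk => jk; apply/orP; lia.
have ei : (delta + i = (delta.-1 + i).+1)%N by lia.
rewrite !weight3E ei /= (negPf jk) ltnNge -ei leq_addr /= addKn.
rewrite [(j + a)%N]addnC [(k + _)%N]addnC; congr (_ + _ + _)%N.
by apply: weight3_recE => //; apply: leq_addl.
Qed.

Lemma weight3_mdeg m : weight3 m != 0%N -> mdeg m = (3 * delta - b - 3)%N.
Proof.
move: m; apply: mnm3_ind => i j k; have [n] := ubnP i.
elim: n i j k => // n IHn i j k lt_in nz.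
have [jk|jk] := boolP ((delta <= j)%N || (delta - b <= k)%N).
  by rewrite weight3_0 in nz.
have [lt_i|le_i] := ltnP i delta.
  have [lt_j lt_k] : (j < delta)%N /\ (k < delta - b)%N.
    by move: jk; rewrite negb_or -!ltnNge => /andP.
  move: nz; rewrite weight3_lt // mdeg_mon3.
  by case: and3P => // -[/eqP -> /eqP -> /eqP ->] _; have := leq_b1 (0 < a)%N; lia.
move: nz; rewrite -(subnKC le_i) weight3_rule !addn_eq0 !negb_and.
have lt1 : (delta.-1 + (i - delta) < n)%N by lia.
have lt2 : (i - delta < n)%N by lia.
by case/orP=> [/orP [] /IHn|/IHn]; rewrite !mdeg_mon3 => h; [have := h lt1|
  have := h lt1|have := h lt2]; lia.
Qed.

(** The terms x^(delta - 1) y and x^(delta - 1) z of the rule suffice to reach x^(delta - 1)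
    y^(delta - 1) z^(delta - b - 1): as long as t > 0, the exponent of y or that of z can still
    grow. *)
Lemma weight3_pos t j k : (j < delta)%N -> (k < delta - b)%N ->
  (j + k + t = delta.-1 + (delta - b).-1)%N ->
  weight3 (mon3 (delta.-1 + t) j k) != 0%N.
Proof.
elim: t j k => [|t IHt] j k lt_j lt_k e.
  have ej : j = delta.-1 by lia.
  have ek : k = (delta - b).-1 by lia.
  have lt_d : (delta.-1 < delta)%N by lia.
  by rewrite addn0 weight3_lt // ej ek !eqxx.
have -> : (delta.-1 + t.+1 = delta + t)%N by lia.
rewrite weight3_rule !addn_eq0 !negb_and; apply/orP; left; apply/orP.
have [lt_j'|le_j'] := ltnP j.+1 delta; first by left; apply: IHt; lia.
by right; apply: IHt; lia.
Qed.

Lemma core_upper3 : [pchar K] =i pred0 ->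
  core (@monspan K 3 (T 1)) `<=` monspan (fun m => 3 * delta - b - 3 < mdeg m)%N.
Proof.
move=> charK; apply: (core_sub_mdeg (N := weight3) charK) red3_reduction _ _ _.
- move=> v e p Tp m pm; apply/(lexpow1P le_ad d_gt1); split.
    by apply: (triang_stable_xy (a := a)) pm => u /Tp /(lexpow1P le_ad d_gt1) [].
  by apply: (triang_stable_mdeg (k := delta)) pm => u /Tp /(lexpow1P le_ad d_gt1) [].
- apply: ideal_gen_wsum => p [[->|->]|->]; apply: mnm3_ind => i j k.
  + by rewrite -mpolyXD wsumX mon3D weight3_0 // leq_addl orbT.
  + by rewrite -mpolyXD wsumX mon3D weight3_0 // leq_addl.
  rewrite /red3_form !mulrBr !wsumB -!mpolyXD !wsumX !mon3D !addn0 !addn1.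
  rewrite [(i + delta)%N]addnC [(i + _)%N]addnC [(j + a)%N]addnC [(k + _)%N]addnC.
  by rewrite weight3_rule !natrD; ring.
- exact: weight3_mdeg.
- have b1 : (b <= 1)%N by apply: leq_b1.
  have -> : (U_(ord0) *+ (3 * delta - b - 3))%MM =
      mon3 (delta.-1 + (2 * delta - b - 2)) 0 0.
    apply/mnmP; apply: forall_ord3; rewrite mulmnE mnm1E mon3E -val_eqE /=; lia.
  by apply: weight3_pos; lia.
Qed.

End Reduction3.

(** * The two bounds combined *)

Lemma core_sub (R : comNzRingType) (L : set R) : is_ideal L -> core L `<=` L.
Proof. by move=> idL p core_p; apply: core_p; split=> //; exists 0%N. Qed.

(* The truncated subtraction in the exponent is exact: for d >= 1, delta >= 2
   and g >= 2 we have delta <= d * (delta - 2) + g + 1, and height at least 2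
   forces d >= 2. *)
Theorem corollary6p14 (K : fieldType) (d : nat) (L : set {mpoly K[d]})
    (g delta : nat) :
  [pchar K] =i pred0 ->
  (d <= 3)%N ->
  is_lex_segment_ideal L ->
  has_height L g ->
  (2 <= g)%N ->
  generated_in_degree L delta ->
  (2 <= delta)%N ->
  core L =
    ideal_mul L
      (ideal_exp (hom_max_ideal K d) (d * (delta - 2) + g + 1 - delta)%N).
Proof.
move=> charK d3 lexL htL g2 genL d2.
have le_gd : (g <= d)%N.
  by apply: (height_le_dim _ genL _ (proj1 htL)); [case: lexL | lia].
have d_cases : d = 2%N \/ d = 3%N by lia.
move: L d3 lexL htL genL le_gd; case: d_cases => -> {d} L _ lexL htL genL _.
- have [eg eL] := lex_classification2 lexL htL g2 genL d2.
  have psT := lexpow_power_system0 0 delta.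
  (* delta plus the exponent equals 2 delta - 1 here; in three variables it equals 3 delta - 2 for g
     = 3 and 3 delta - 3 for g = 2. *)
  rewrite eL (ideal_mul_hom_max_ideal _ psT) eg eqEsubset; split=> p.
  + move=> core_p m pm; split.
      by apply: (core_sub _ core_p) pm; apply/monspan_ideal/(psys_up psT).
    by have := core_upper2 (ltnW d2) charK core_p pm; lia.
  + move=> Lp J redJ; apply: (core_lower2 (ltnW d2) redJ).
    by apply: monspan_sub Lp => m []; lia.
have [a [le_ad eg eL]] := lex_classification3 lexL htL g2 genL d2.
have psT := lexpow_power_system le_ad.
rewrite eL (ideal_mul_hom_max_ideal _ psT) eqEsubset; split=> p.
- move=> core_p m pm; split.
    by apply: (core_sub _ core_p) pm; apply/monspan_ideal/(psys_up psT).
  have := core_upper3 le_ad d2 charK core_p pm.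
  by rewrite eg lt0n; case: (a == 0%N); lia.
move=> Lp J redJ; apply: (core_lower3 charK le_ad d2 redJ).
apply: monspan_sub Lp => m [/(lexpow1P le_ad d2) [Pm _] dm]; split=> //.
by move: dm; rewrite /core_degree3 eg lt0n; case: (a == 0%N); lia.
Qed.
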